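(* Let $F:\mathbb{R}\to\mathbb{H}$ and $F\in L^p(\mathbb{R})$ for $1\le p\le 2$. Assume that there exists a quaternionic imaginary unit $I\in\mathbb{S}$ such that $\operatorname{supp}\mathscr{F}_I(F)\subset(-\infty,0]$. Then there exists a function $f\in H^p(\mathbb{H}_+)$, whose non-tangential boundary limit at $Iy$ is $F(y)$, whence $\mathscr{F}_E(f)=\mathscr{F}_I(F)$ and $$f(x+Jy):=\frac{1}{\sqrt{2\pi}}\int_{-\infty}^{0}e^{(x+Jy)t}\,\mathscr{F}_I(F)(t)\,dt,$$ for all $x>0$, $y\in\mathbb{R}$, $J\in\mathbb{S}$.
   Context: $\mathbb{H}$ denotes the real quaternions with the usual norm, and $\mathbb{S}=\{I\in\mathbb{H}: I^2=-1\}$ is the unit sphere of purely imaginary quaternions. For $I\in\mathbb{S}$, $\mathbb{C}_I=\{x+Iy:x,y\in\mathbb{R}\}$. $\mathbb{H}_+=\{x+Iy: x>0,\ y\in\mathbb{R},\ I\in\mathbb{S}\}$ is the open right half-space. $e^{(x+Jy)t}=e^{xt}(\cos(yt)+J\sin(yt))$ for $t\in\mathbb{R}$. Left slice regular: for $\Omega\subset\mathbb{H}$ open, a real differentiable function $f:\Omega\to\mathbb{H}$ is left slice regular (written $f\in\mathscr{R}_l(\Omega)$) if for every $I\in\mathbb{S}$ the restriction $f_I$ of $f$ to $\Omega\cap\mathbb{C}_I$ satisfies $\frac12\left(\frac{\partial}{\partial x}+I\frac{\partial}{\partial y}\right)f_I(x+Iy)=0$ on $\Omega\cap\mathbb{C}_I$.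 Hardy space: for $1\le p\le 2$, $H^p(\mathbb{H}_+)$ is the space of functions $f\in\mathscr{R}_l(\mathbb{H}_+)$ such that $\sup_{I\in\mathbb{S}}\int_{-\infty}^{+\infty}|F^I(y)|^p\,dy<\infty$, where $F^I(y)=f(Iy)$ denotes the non-tangential value (non-tangential boundary limit) of $f$ at $Iy$. One-dimensional left-sided quaternion Fourier transform: for $I\in\mathbb{S}$ and $F:\mathbb{R}\to\mathbb{H}$ in $L^1(\mathbb{R})$, $\mathscr{F}_I(F)(t)=\frac{1}{\sqrt{2\pi}}\int_{\mathbb{R}}e^{-Ixt}F(x)\,dx$ (exponential on the left), extended to $L^p(\mathbb{R})$, $1\le p\le 2$, in the usual way. Essential Fourier transform: for $f\in H^p(\mathbb{H}_+)$, $1\le p\le2$, the function $\mathscr{F}_I(F^I)$ does not depend on $I\in\mathbb{S}$, and $\mathscr{F}_E(f):=\mathscr{F}_I(F^I)$ (any $I\in\mathbb{S}$). *)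

(* Defs.v *)
From HB Require Import structures.
From mathcomp Require Import all_boot all_order all_algebra.
From mathcomp Require Import all_classical all_reals all_analysis.

Set Implicit Arguments.
Unset Strict Implicit.
Unset Printing Implicit Defensive.
Import Order.TTheory GRing.Theory Num.Theory.
Import numFieldNormedType.Exports.
Local Open Scope classical_set_scope.
Local Open Scope ring_scope.

(* The quaternion a + b i + c j + d k is the tuple (a, b, c, d).  The product
   normed space R * R * R * R carries the sup norm: it is used only for the
   topology and for real differentiability, which do not depend on the choice
   of the norm; the usual norm of quaternions is qnorm. *)
Notation quat R := (R * R * R * R)%type.

Section Quaternions.
Context {R : realType}.
Implicit Types (q a b : quat R).

Definition qre q : R := q.1.1.1.
Definition qi q : R := q.1.1.2.
Definition qj q : R := q.1.2.
Definition qk q : R := q.2.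

Definition qreal (x : R) : quat R := (x, 0, 0, 0).

Definition qscale (r : R) q : quat R :=
  (r * qre q, r * qi q, r * qj q, r * qk q).

Definition qmul a b : quat R :=
  (qre a * qre b - qi a * qi b - qj a * qj b - qk a * qk b,
   qre a * qi b + qi a * qre b + qj a * qk b - qk a * qj b,
   qre a * qj b - qi a * qk b + qj a * qre b + qk a * qi b,
   qre a * qk b + qi a * qj b - qj a * qi b + qk a * qre b).

Definition qnorm q : R :=
  Num.sqrt (qre q ^+ 2 + qi q ^+ 2 + qj q ^+ 2 + qk q ^+ 2).

Definition sphere : set (quat R) := [set I | qmul I I = - qreal 1].

(* x + I y *)
Definition slice (I : quat R) (x y : R) : quat R := qreal x + qscale y I.

Definition Hplus : set (quat R) :=
  [set q | exists x y I, [/\ 0 < x, sphere I & q = slice I x y]].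

(* e^(u + J v) = e^u (cos v + J sin v) *)
Definition qexp (J : quat R) (u v : R) : quat R :=
  qscale (expR u) (slice J (cos v) (sin v)).

End Quaternions.

Section SliceRegular.
Context {R : realType}.

Definition slice_regular (Omega : set (quat R)) (f : quat R -> quat R) :=
  (forall q, Omega q -> differentiable f q) /\
  forall I x y, sphere I -> Omega (slice I x y) ->
    qscale 2^-1 (derive1 (fun u : R => f (slice I u y)) x +
                 qmul I (derive1 (fun v : R => f (slice I x v)) y)) = 0.

Definition nt_cone (a : R) (q0 : quat R) : set (quat R) :=
  [set q | Hplus q /\ qnorm (q - q0) < a * qre q].

Definition nt_lim (f : quat R -> quat R) (q0 l : quat R) :=
  forall a : R, 0 < a -> f q @[q --> within (nt_cone a q0) (nbhs q0)] --> l.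

End SliceRegular.

Section FunctionSpaces.
Context {R : realType}.
Local Notation mu := (@lebesgue_measure R).
Implicit Types (F G : R -> quat R) (f : quat R -> quat R) (I J : quat R).

Definition qmeasurable F :=
  [/\ measurable_fun setT (qre \o F), measurable_fun setT (qi \o F),
      measurable_fun setT (qj \o F) & measurable_fun setT (qk \o F)].

Definition qLnorm (p : \bar R) F : \bar R :=
  Lnorm mu p (fun x => (qnorm (F x))%:E).

Definition qLp (p : \bar R) F := qmeasurable F /\ (qLnorm p F < +oo)%E.

Definition qint (D : set R) F : quat R :=
  (\int[mu]_(x in D) qre (F x), \int[mu]_(x in D) qi (F x),
   \int[mu]_(x in D) qj (F x), \int[mu]_(x in D) qk (F x)).

Definition qFT1 I F (t : R) : quat R :=
  qscale (Num.sqrt (2 * pi))^-1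
    (qint setT (fun x => qmul (qexp I 0 (- (x * t))) (F x))).

(* G represents the Fourier transform of F in L^p, 1 <= p <= 2, obtained by
   extending qFT1 from L^1 `&` L^p by continuity as an operator from L^p to
   L^p', with 1/p + 1/p' = 1.  As an element of L^p', the transform is defined
   up to almost everywhere equality, hence the relational presentation. *)
Definition is_qFT I (p : R) F G :=
  qLp (hoelder_conjugate p%:E) G /\
  forall Fn : nat -> R -> quat R,
    (forall n, qLp 1%E (Fn n) /\ qLp p%:E (Fn n)) ->
    qLnorm p%:E (fun x => Fn n x - F x) @[n --> \oo] --> 0%E ->
    qLnorm (hoelder_conjugate p%:E) (fun t => qFT1 I (Fn n) t - G t)
      @[n --> \oo] --> 0%E.

(* Support of an a.e. equivalence class: the complement of the largest open
   set on which G vanishes almost everywhere. *)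
Definition esupp G : set R :=
  [set t | forall U : set R, open U -> U t ->
             ~ {ae mu, forall s, U s -> G s = 0}].

(* Phi is (a measurable version of) F^I, the boundary value of f on I R *)
Definition boundary_value f I Phi :=
  qmeasurable Phi /\ {ae mu, forall y, nt_lim f (slice I 0 y) (Phi y)}.

Definition hardy (p : R) f :=
  slice_regular Hplus f /\
  exists Phi : quat R -> R -> quat R,
    (forall I, sphere I -> boundary_value f I (Phi I)) /\
    (ereal_sup [set \int[mu]_y (qnorm (Phi I y) `^ p)%:E | I in sphere]
       < +oo)%E.

Definition is_essential_FT (p : R) f G :=
  forall I, sphere I ->
    exists2 Phi, boundary_value f I Phi & is_qFT I p Phi G.

End FunctionSpaces.

(* Main.v *)
From HB Require Import structures.
Require Import Defs.
From mathcomp Require Import all_boot all_order all_algebra.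
From mathcomp Require Import all_classical all_reals all_analysis.
From mathcomp Require Import measurable_realfun ess_sup_inf.
From mathcomp Require Import ring lra.
Import Order.TTheory GRing.Theory Num.Theory.
Import numFieldNormedType.Exports.
Set Implicit Arguments.
Unset Strict Implicit.
Local Open Scope classical_set_scope.
Local Open Scope ring_scope.

(** Let [G] be the transform of [F] for the unit [I], and let [Fe], [Fo] be the
    even and odd parts of [F].

    Fubini's theorem gives, for an integrable [F] and an integrable real
    kernel [k], the multiplication formula
      int k G = (2 pi)^(-1/2) (int (cosT k) F - I int (sinT k) F),
    where [cosT k], [sinT k] are the cosine and sine transforms of [k].  If
    [|k t| <= e^(- x |t|)] with [x > 0], Hoelder's inequality extends it to [F]
    in L^p by truncation ([qmultiplication_formula_Lp]).  As [G] vanishes on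
    [t > 0], the kernels [e^(- x |t|) cos (y t)] and [e^(- x |t|) sin (y t)]
    express
      [lapC G x y = (2 pi)^(-1/2) int_(t <= 0) e^(x t) cos (y t) G t dt]
    and [lapS G x y], the same integral with the sine, by the Poisson integral
    [P] of [F] ([lapC_poisson], [lapS_poisson]):
      lapC G x y = (P x y + P x (- y)) / 2,
      lapS G x y = - I (P x y - P x (- y)) / 2.

    The required function is [f (x + J y) = lapC G x y + J lapS G x y]; it is
    well defined because [lapC] is even and [lapS] odd in [y].
    Differentiation under the integral sign, in the form of a quadratic bound
    of the Taylor remainder ([lap_expansion]), gives the Cauchy-Riemann equation
    on each slice and real differentiability, including at the real points,
    where the polar form of a quaternion is singular ([laplace_slice_regular]).

    The Poisson integral has nontangential limits at the Lebesgue points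
    ([poisson_nontangential]), so that the boundary value of [f] on [J R] is
    [twist I J F = Fe - J I Fo], which is [F] for [J = I]
    ([boundary_value_laplace_slice]).  Its norm at [y] is at most a multiple of
    [|F y| + |F (- y)|], whence the Hardy bound ([hardy_laplace_slice]).
    Finally, the transform for [J] of an integrable [H] is the transform for [I]
    of [twist J I H] ([qFT1_twist]), and [twist J I] is inverse to [twist I J];
    hence a sequence that tends to [twist I J F] in L^p is carried to a
    sequence that tends to [F], whose transforms tend to [G]
    ([essential_FT_laplace_slice]). *)

(** * Quaternions *)

Section quaternion_algebra.
Context {R : realType}.
Implicit Types (q a b I J : quat R) (r s : R).

Lemma quatP a b : qre a = qre b -> qi a = qi b -> qj a = qj b -> qk a = qk b ->
  a = b.
Proof.
by case: a => [[[? ?] ?] ?]; case: b => [[[? ?] ?] ?]; rewrite /qre /qi /qj /qk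
  /= => -> -> -> ->.
Qed.

Lemma quatE : (forall a b, (qre (a + b) = qre a + qre b) *
    (qi (a + b) = qi a + qi b) * (qj (a + b) = qj a + qj b) *
    (qk (a + b) = qk a + qk b)) *
  (forall a, (qre (- a) = - qre a) * (qi (- a) = - qi a) *
    (qj (- a) = - qj a) * (qk (- a) = - qk a)) *
  ((qre (0 : quat R) = 0) * (qi (0 : quat R) = 0) * (qj (0 : quat R) = 0) *
    (qk (0 : quat R) = 0)) *
  (forall r a, (qre (r *: a) = r * qre a) * (qi (r *: a) = r * qi a) *
    (qj (r *: a) = r * qj a) * (qk (r *: a) = r * qk a)).
Proof. by []. Qed.

Lemma qscaleE r a : qscale r a = r *: a.
Proof. by apply: quatP. Qed.

End quaternion_algebra.

(** Decides identities of quaternions that hold as polynomial identities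
    between components. *)
Ltac quat_ring :=
  apply: quatP; rewrite /slice /qexp /qscale /qmul /qreal ?quatE
    /qre /qi /qj /qk /=; ring.

Section quaternion_theory.
Context {R : realType}.
Implicit Types (q a b I J : quat R) (r s : R).

Lemma qmulDr a b c : qmul a (b + c) = qmul a b + qmul a c.
Proof. quat_ring. Qed.
Lemma qmulDl a b c : qmul (a + b) c = qmul a c + qmul b c.
Proof. quat_ring. Qed.
Lemma qmulNr a b : qmul a (- b) = - qmul a b.
Proof. quat_ring. Qed.
Lemma qmulNl a b : qmul (- a) b = - qmul a b.
Proof. quat_ring. Qed.
Lemma qmulBr a b c : qmul a (b - c) = qmul a b - qmul a c.
Proof. quat_ring. Qed.
Lemma qmulZr r a b : qmul a (r *: b) = r *: qmul a b.
Proof. quat_ring. Qed.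
Lemma qmulZl r a b : qmul (r *: a) b = r *: qmul a b.
Proof. quat_ring. Qed.
Lemma qmulA a b c : qmul a (qmul b c) = qmul (qmul a b) c.
Proof. quat_ring. Qed.
Lemma qmul1 a : qmul (qreal 1) a = a.
Proof. quat_ring. Qed.

Lemma qmul_sphere I a : sphere I -> qmul I (qmul I a) = - a.
Proof. by move=> II; rewrite qmulA II qmulNl qmul1. Qed.

Lemma sphereP I :
  sphere I <-> qre I = 0 /\ qi I ^+ 2 + qj I ^+ 2 + qk I ^+ 2 = 1.
Proof.
case: I => [[[a b] c] d]; rewrite /sphere/= /qmul /qreal /qre /qi /qj /qk /=.
split.
  case=> e1 e2 e3 e4.
  have H : a ^+ 2 = b ^+ 2 + c ^+ 2 + d ^+ 2 - 1 by lra.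
  have a0 : a = 0.
    apply/eqP; apply: contraT => a0; exfalso.
    have hb : b = 0 by apply: (mulfI a0); rewrite mulr0; lra.
    have hc : c = 0 by apply: (mulfI a0); rewrite mulr0; lra.
    have hd : d = 0 by apply: (mulfI a0); rewrite mulr0; lra.
    have := sqr_ge0 a; rewrite H hb hc hd; lra.
  by split=> //; move: H; rewrite a0 expr0n/=; lra.
move=> [-> H]; apply: quatP; rewrite ?quatE /qre /qi /qj /qk /=; try by ring.
by lra.
Qed.

Lemma qnorm_ge0 a : 0 <= qnorm a. Proof. exact: sqrtr_ge0. Qed.

Lemma sqr_qnorm a :
  qnorm a ^+ 2 = qre a ^+ 2 + qi a ^+ 2 + qj a ^+ 2 + qk a ^+ 2.
Proof. by rewrite /qnorm sqr_sqrtr// !addr_ge0// sqr_ge0. Qed.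

Lemma qnormM a b : qnorm (qmul a b) = qnorm a * qnorm b.
Proof.
apply/eqP; rewrite -(@eqrXn2 _ 2)// ?mulr_ge0 ?qnorm_ge0//.
apply/eqP; rewrite exprMn !sqr_qnorm /qmul /qre /qi /qj /qk /=; ring.
Qed.

Lemma qnorm_sphere I : sphere I -> qnorm I = 1.
Proof. by move=> /sphereP[h0 h]; rewrite /qnorm h0 expr0n add0r h sqrtr1. Qed.

Lemma qnormZ r a : qnorm (r *: a) = `|r| * qnorm a.
Proof.
apply/eqP; rewrite -(@eqrXn2 _ 2)// ?mulr_ge0 ?qnorm_ge0//.
apply/eqP; rewrite exprMn real_normK ?num_real// !sqr_qnorm !quatE; ring.
Qed.

(** Convexity of the square; the factor 2 spares the Cauchy-Schwarz inequality
    and is harmless in the estimates that use it. *)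
Lemma qnormD_le a b : qnorm (a + b) <= 2 * (qnorm a + qnorm b).
Proof.
have ha := qnorm_ge0 a; have hb := qnorm_ge0 b.
rewrite -(@ler_pXn2r _ 2) ?nnegrE ?qnorm_ge0 ?mulr_ge0 ?addr_ge0//.
apply: (@le_trans _ _ (2 * (qnorm a ^+ 2 + qnorm b ^+ 2))).
  rewrite !sqr_qnorm !quatE.
  have := sqr_ge0 (qre a - qre b); have := sqr_ge0 (qi a - qi b).
  have := sqr_ge0 (qj a - qj b); have := sqr_ge0 (qk a - qk b).
  lra.
by nra.
Qed.

Lemma qnorm_le_sum a :
  qnorm a <= `|qre a| + `|qi a| + `|qj a| + `|qk a|.
Proof.
rewrite -(@ler_pXn2r _ 2) ?nnegrE ?qnorm_ge0 ?addr_ge0//.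
rewrite sqr_qnorm -!(real_normK (num_real (_ a))).
have := normr_ge0 (qre a); have := normr_ge0 (qi a).
have := normr_ge0 (qj a); have := normr_ge0 (qk a).
nra.
Qed.

Lemma norm_comp_le a : [/\ `|qre a| <= qnorm a, `|qi a| <= qnorm a,
  `|qj a| <= qnorm a & `|qk a| <= qnorm a].
Proof.
by split; rewrite -(@ler_pXn2r _ 2) ?nnegrE ?qnorm_ge0//
  real_normK ?num_real// sqr_qnorm;
  have := sqr_ge0 (qre a); have := sqr_ge0 (qi a);
  have := sqr_ge0 (qj a); have := sqr_ge0 (qk a); lra.
Qed.

Lemma qmul_qexp J u v a : qmul (qexp J u v) a =
  (expR u * cos v) *: a + qmul J ((expR u * sin v) *: a).
Proof. quat_ring. Qed.

End quaternion_theory.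

(** * Reflection of the line *)

Section reflection.
Context {R : realType}.
Local Notation mu := (@lebesgue_measure R).
Implicit Types c : R.

Lemma measurable_reflect c : measurable_fun setT (fun s : R => c - s).
Proof. exact: measurable_funB. Qed.

Lemma lebesgue_measure_reflect c (A : set R) : measurable A ->
  pushforward mu ((fun s => c - s) : R -> measurableTypeR R) A = mu A.
Proof.
pose r : R -> measurableTypeR R := fun s => c - s.
have mr : measurable_fun setT r by exact: measurable_reflect.
pose r' : {mfun R >-> measurableTypeR R} :=
  HB.pack r (isMeasurableFun.Build _ _ _ _ _ mr).
move=> mA; apply/esym.
apply: (@lebesgue_measure_unique R (pushforward mu r')) => //= _ [[a b]] _ <-.
rewrite /pushforward.
rewrite (_ : r @^-1` _ = `[c - b, c - a[%classic); last first.
  by apply/seteqP; split => s; rewrite /r /= !in_itv/= => /andP[? ?];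
    apply/andP; split; lra.
rewrite !lebesgue_measure_itv/= !lte_fin.
rewrite (_ : (c - b < c - a) = (a < b)); last by lra.
by case: ifP => // _; rewrite -!EFinB; congr EFin; ring.
Qed.

Lemma ge0_integral_reflect c (f : R -> \bar R) : measurable_fun setT f ->
  (forall s, (0 <= f s)%E) ->
  (\int[mu]_s f (c - s)%R = \int[mu]_s f s)%E.
Proof.
move=> mf f0.
pose r : measurableTypeR R -> measurableTypeR R := fun s : R => c - s.
have mr : measurable_fun setT r by exact: measurable_reflect.
rewrite -[LHS](@ge0_integral_pushforward _ _ _ _ _ _ mr mu setT f)//.
by apply: eq_measure_integral => A mA _; exact: lebesgue_measure_reflect.
Qed.

Lemma integral_reflect c (f : R -> \bar R) : measurable_fun setT f ->
  (\int[mu]_s f (c - s)%R = \int[mu]_s f s)%E.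
Proof.
move=> mf; rewrite integralE [RHS]integralE.
rewrite -(@ge0_integral_reflect c (f^\+)%E)//; last exact: measurable_funepos.
rewrite -(@ge0_integral_reflect c (f^\-)%E)//; last exact: measurable_funeneg.
by congr (_ - _)%E; apply: eq_integral => s _; rewrite ?funeposE ?funenegE.
Qed.

Lemma Rintegral_reflect c (f : R -> R) : measurable_fun setT f ->
  \int[mu]_s f (c - s) = \int[mu]_s f s.
Proof.
move=> mf; rewrite /Rintegral; congr fine.
exact/(@integral_reflect c (EFin \o f))/measurable_EFinP.
Qed.

Lemma integrable_reflect c (f : R -> R) : mu.-integrable setT (EFin \o f) ->
  mu.-integrable setT (EFin \o (fun s => f (c - s))).
Proof.
move=> /integrableP[mf fi]; apply/integrableP; split.
  exact: (measurableT_comp mf (measurable_reflect c)).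
by rewrite (@ge0_integral_reflect c (fun s => `|(f s)%:E|%E))//;
  exact: measurableT_comp.
Qed.

Lemma ae_reflect (P : R -> Prop) : {ae mu, forall y, P y} ->
  {ae mu, forall y, P (- y)}.
Proof.
move=> [N [mN N0 PN]]; exists ((fun s => 0 - s) @^-1` N); split.
- by rewrite -[X in measurable X]setTI; exact: measurable_reflect.
- by rewrite -[RHS]N0; exact: (@lebesgue_measure_reflect 0).
- by move=> y /= ny; apply: PN; rewrite /= sub0r.
Qed.

End reflection.

(** * Integrability of real functions *)

Section integrability_tools.
Context {R : realType}.
Local Notation mu := (@lebesgue_measure R).
Implicit Types (D : set R) (f g : R -> R).

Lemma le_integrableR D f g : measurable D -> measurable_fun D f ->
  (forall x, D x -> `|f x| <= g x) -> mu.-integrable D (EFin \o g) ->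
  mu.-integrable D (EFin \o f).
Proof.
move=> mD mf fg; apply: le_integrable => //; first exact/measurable_EFinP.
by move=> x Dx /=; rewrite lee_fin (le_trans (fg _ Dx))// ler_norm.
Qed.

Lemma integrable_bddMl D f g (C : R) : measurable D ->
  measurable_fun D f -> (forall x, D x -> `|f x| <= C) ->
  mu.-integrable D (EFin \o g) -> mu.-integrable D (EFin \o (fun x => f x * g x)).
Proof.
move=> mD mf fC ig.
have mg : measurable_fun D g by move/measurable_int: ig => /measurable_EFinP.
apply: (@le_integrableR D _ (fun x => C * `|g x|)) => //.
- exact: measurable_funM.
- by move=> x Dx /=; rewrite normrM ler_wpM2r// fC.
- have /= := @integrableZl _ _ _ mu D mD C _ (integrable_abse ig).
  by apply: eq_integrable => // x _ /=; rewrite EFinM.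
Qed.

Lemma integrable_bddMr D f g (C : R) : measurable D ->
  measurable_fun D g -> (forall x, D x -> `|g x| <= C) ->
  mu.-integrable D (EFin \o f) ->
  mu.-integrable D (EFin \o (fun x => f x * g x)).
Proof.
move=> mD mg gC If; rewrite (_ : (fun x => _) = (fun x => g x * f x)).
  exact: integrable_bddMl gC If.
by apply/funext => x; rewrite mulrC.
Qed.

Lemma eq_integrableR D f g : measurable D -> (forall t, D t -> f t = g t) ->
  mu.-integrable D (EFin \o f) -> mu.-integrable D (EFin \o g).
Proof.
by move=> mD fg; apply: eq_integrable => // t /set_mem /fg /= ->.
Qed.

Lemma integrableRD D f g : measurable D -> mu.-integrable D (EFin \o f) ->
  mu.-integrable D (EFin \o g) ->
  mu.-integrable D (EFin \o (fun t => f t + g t)).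
Proof. by move=> mD If Ig; apply: eq_integrable (integrableD _ If Ig). Qed.

Lemma integrableRB D f g : measurable D -> mu.-integrable D (EFin \o f) ->
  mu.-integrable D (EFin \o g) ->
  mu.-integrable D (EFin \o (fun t => f t - g t)).
Proof. by move=> mD If Ig; apply: eq_integrable (integrableB _ If Ig). Qed.

Lemma integrableRZ D (r : R) f : measurable D ->
  mu.-integrable D (EFin \o f) ->
  mu.-integrable D (EFin \o (fun t => r * f t)).
Proof. by move=> mD If; apply: eq_integrable (integrableZl _ r If). Qed.

Lemma Rintegral_odd f : mu.-integrable setT (EFin \o f) ->
  (forall t, f (- t) = - f t) -> \int[mu]_t f t = 0.
Proof.
move=> If odd_f.
have mf : measurable_fun setT f by move/measurable_int: If => /measurable_EFinP.
have := @Rintegral_reflect _ 0 f mf.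
under eq_Rintegral do rewrite sub0r odd_f -mulN1r.
by rewrite RintegralZl//; lra.
Qed.

End integrability_tools.

(** * The exponential kernel and its cosine transform *)

Section exponential_kernel.
Context {R : realType}.
Local Notation mu := (@lebesgue_measure R).
Implicit Types x y s t u : R.

Definition expker x t := expR (- (x * `|t|)).

(** The Poisson kernel of the half-plane [x > 0], with total mass [2 pi]. *)
Definition poisker x u := 2 * x / (x ^+ 2 + u ^+ 2).

Lemma expker_ge0 x t : 0 <= expker x t. Proof. exact: expR_ge0. Qed.

Lemma continuous_expker x : continuous (expker x).
Proof.
move=> t; apply: continuous_comp; last exact: continuous_expR.
by apply: continuousN; apply: continuousM; [exact: cst_continuous|exact: norm_continuous].
Qed.

Lemma measurable_expker x : measurable_fun setT (expker x).
Proof. by apply: continuous_measurable_fun; exact: continuous_expker. Qed.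

Lemma expkerE x t : 0 <= t -> expker x t = expR (- x * t).
Proof. by move=> t0; rewrite /expker ger0_norm// mulNr. Qed.

Lemma cvg_expRM_pinfty x : 0 < x -> expR (- x * t) @[t --> +oo] --> 0.
Proof.
move=> x0; under eq_fun do rewrite mulNr.
apply: (@cvg_comp _ _ _ (fun t => x * t) (fun t => expR (- t))).
  exact: gt0_cvgMry.
exact: cvgr_expR.
Qed.

Lemma continuous_cosM u : continuous (fun t : R => cos (u * t)).
Proof.
move=> t; apply: (@continuous_comp _ _ _ (fun t => u * t)).
  exact: mulrl_continuous.
exact: continuous_cos.
Qed.

Lemma continuous_sinM u : continuous (fun t : R => sin (u * t)).
Proof.
move=> t; apply: (@continuous_comp _ _ _ (fun t => u * t)).
  exact: mulrl_continuous.
exact: continuous_sin.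
Qed.

Lemma measurable_cosM u : measurable_fun setT (fun t : R => cos (u * t)).
Proof. by apply: continuous_measurable_fun; exact: continuous_cosM. Qed.

Lemma measurable_sinM u : measurable_fun setT (fun t : R => sin (u * t)).
Proof. by apply: continuous_measurable_fun; exact: continuous_sinM. Qed.

(** The integrand is nonnegative and even, so that its improper integral
    reduces to the fundamental theorem of calculus on a half-line. *)
Lemma integral_expker_2Bcos x u : 0 < x ->
  (\int[mu]_t (expker x t * (2 - cos (u * t)))%:E =
   (4 / x - poisker x u)%:E)%E.
Proof.
move=> x0.
have cf : continuous (fun t => expker x t * (2 - cos (u * t))).
  move=> t; apply: continuousM; first exact: continuous_expker.
  by apply: continuousB; [exact: cst_continuous|exact: continuous_cosM].
have f0 t : 0 <= expker x t * (2 - cos (u * t)).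
  rewrite mulr_ge0 ?expker_ge0// subr_ge0 (le_trans (cos_le1 _))// ler1n.
rewrite ge0_symfun_integralT//; last first.
  by move=> t /=; rewrite /expker normrN mulrN cosN.
rewrite -set_itvcy.
have d0 : x ^+ 2 + u ^+ 2 != 0.
  by rewrite gt_eqF// ltr_wpDr ?sqr_ge0// exprn_gt0.
pose E t := expR (- x * t) * (- 2 / x + (x ^+ 2 + u ^+ 2)^-1 *
  (x * cos (u * t) - u * sin (u * t))).
have dE t : is_derive t 1 E (expR (- x * t) * (2 - cos (u * t))).
  rewrite /E; apply: is_derive_eq; rewrite /GRing.scale/=.
  by field; rewrite d0 gt_eqF.
rewrite (@ge0_continuous_FTC2y _ _ E 0 0)//.
- rewrite -EFinB -EFinM; congr EFin; rewrite /E /poisker !mulr0 expR0 cos0 sin0.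
  by field; rewrite d0 gt_eqF.
- exact: continuous_subspaceT.
- pose C := 2 / x + (x ^+ 2 + u ^+ 2)^-1 * (x + `|u|).
  have C0 : 0 <= C.
    by rewrite addr_ge0 ?mulr_ge0 ?invr_ge0 ?addr_ge0 ?sqr_ge0// ltW.
  apply: norm_cvg0.
  apply: (@squeeze_cvgr _ _ _ _ (cst 0) (fun t => expR (- x * t) * C)).
  + near=> t; rewrite normr_ge0/= /E normrM ger0_norm ?expR_ge0// ler_wpM2l//.
    rewrite (le_trans (ler_normD _ _))// mulNr normrN normf_div (gtr0_norm x0).
    rewrite [`|2|]ger0_norm// lerD2l normrM ger0_norm ?invr_ge0 ?addr_ge0 ?sqr_ge0//.
    rewrite ler_wpM2l ?invr_ge0 ?addr_ge0 ?sqr_ge0//.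
    rewrite (le_trans (ler_normB _ _))// !normrM (gtr0_norm x0).
    by rewrite lerD// ler_piMr ?cos_max ?sin_max// ltW.
  + exact: cvg_cst.
  + rewrite -(mul0r C); apply: cvgMr_tmp; exact: cvg_expRM_pinfty.
- apply: cvg_at_right_filter; apply: differentiable_continuous.
  by have ? := dE 0; exact/derivable1_diffP/ex_derive.
- move=> t; have ? := dE t; rewrite in_itv/= andbT => t0; rewrite derive1E derive_val.
  by rewrite expkerE// ltW.
Unshelve. all: by end_near. Qed.

Lemma integrable_expker x : 0 < x -> mu.-integrable setT (EFin \o expker x).
Proof.
move=> x0; apply/integrableP; split.
  by apply/measurable_EFinP; exact: measurable_expker.
apply: le_lt_trans (ltry (4 / x - poisker x 0)).
rewrite -(@integral_expker_2Bcos x 0 x0) le_eqVlt; apply/orP; left; apply/eqP.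
apply: eq_integral => t _ /=; rewrite mul0r cos0 ger0_norm ?expker_ge0//.
by congr EFin; ring.
Qed.

Lemma integral_expker x : 0 < x -> \int[mu]_t expker x t = 2 / x.
Proof.
move=> x0; have := @integral_expker_2Bcos x 0 x0.
under eq_integral do rewrite mul0r cos0.
have -> : 4 / x - poisker x 0 = 2 / x.
  by rewrite /poisker expr0n addr0; field; rewrite gt_eqF.
move=> H; rewrite /Rintegral -[RHS]/(fine (2 / x)%:E) -H; congr fine.
by apply: eq_integral => t _; congr EFin; ring.
Qed.

Lemma integral_expker_cos x u : 0 < x ->
  \int[mu]_t (expker x t * cos (u * t)) = poisker x u.
Proof.
move=> x0.
have ie := integrable_expker x0.
have ic : mu.-integrable setT (EFin \o (fun t => expker x t * cos (u * t))).
  apply: (integrable_bddMr _ (measurable_cosM u)) ie => // t _; exact: cos_max.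
have : \int[mu]_t (2 * expker x t - expker x t * cos (u * t)) =
    4 / x - poisker x u.
  rewrite /Rintegral -[RHS]/(fine (4 / x - poisker x u)%:E).
  rewrite -(integral_expker_2Bcos u x0); congr fine; apply: eq_integral => t _.
  by congr EFin; ring.
rewrite RintegralB//; last first.
  by have := integrableZl measurableT 2 ie; apply: eq_integrable.
rewrite RintegralZl// integral_expker// => ?; lra.
Qed.

End exponential_kernel.

(** * Transposition of an integral transform *)

Section multiplication_formula.
Context {R : realType}.
Local Notation mu := (@lebesgue_measure R).
Variables (k h phi : R -> R).
Hypotheses (ik : mu.-integrable setT (EFin \o k))
  (ih : mu.-integrable setT (EFin \o h))
  (mphi : measurable_fun setT phi) (phi1 : forall s, `|phi s| <= 1).

Let measurable_phiM (t : R) : measurable_fun setT (fun s : R => phi (s * t)).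
Proof. by apply: measurableT_comp => //; exact: measurable_funM. Qed.

Let integrable_inner (t : R) :
  mu.-integrable setT (EFin \o (fun s => phi (s * t) * h s)).
Proof. exact: (integrable_bddMl _ (measurable_phiM t)) ih. Qed.

Let integrable_inner' (s : R) :
  mu.-integrable setT (EFin \o (fun t => k t * phi (s * t))).
Proof.
apply: (integrable_bddMr _ _ (fun t _ => phi1 (s * t))) ik => //.
by apply: measurableT_comp => //; exact: measurable_funM.
Qed.

Let f (z : R * R) : \bar R := (k z.1 * (phi (z.2 * z.1) * h z.2))%:E.

Let mf : measurable_fun setT f.
Proof.
have mk : measurable_fun setT k by move/measurable_int: ik => /measurable_EFinP.
have mh : measurable_fun setT h by move/measurable_int: ih => /measurable_EFinP.
apply/measurable_EFinP; apply: measurable_funM.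
  exact: measurableT_comp.
apply: measurable_funM; last exact: measurableT_comp.
by apply: measurableT_comp => //; exact: measurable_funM.
Qed.

Let integrable_f : (mu \x mu)%E.-integrable setT f.
Proof.
apply/integrable12ltyP => //.
have mk := measurable_int _ ik; have mh := measurable_int _ ih.
pose c := (\int[mu]_s `|(h s)%:E|)%E.
have c0 : (0 <= c)%E by exact: integral_ge0.
have coo : (c < +oo)%E by move/integrableP: ih => [].
apply: (@le_lt_trans _ _ (\int[mu]_t (`|(k t)%:E| * c))%E).
  apply: ge0_le_integral => //.
  - by move=> t _; exact: integral_ge0.
  - apply: (@measurable_fun_fubini_tonelli_F _ _ _ _ _ mu (abse \o f)) => //=.
    exact: measurableT_comp.
  - by apply: emeasurable_funM => //; exact: measurableT_comp.
  - move=> t _; rewrite -ge0_integralZl//; last exact: measurableT_comp.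
    apply: ge0_le_integral => //.
    + have mkt : measurable_fun setT (fun s : R => k t * (phi (s * t) * h s)).
        apply: measurable_funM => //; apply: measurable_funM => //.
        exact/measurable_EFinP.
      by apply: measurableT_comp => //; exact/measurable_EFinP.
    + by apply: measurable_funeM; exact: measurableT_comp.
    + move=> s _; rewrite /f /= lee_fin !normrM ler_wpM2l// ler_piMl//.
rewrite ge0_integralZr//; last exact: measurableT_comp.
have ik0 : (0 <= \int[mu]_t `|(k t)%:E|)%E by exact: integral_ge0.
have ikoo : (\int[mu]_t `|(k t)%:E| < +oo)%E by move/integrableP: ik => [].
by rewrite lte_mul_pinfty// ge0_fin_numE.
Qed.

(** Fubini's theorem applies because [phi] is bounded and [k], [h] are
    integrable. *)
Lemma multiplication_formula :
  \int[mu]_t (k t * \int[mu]_s (phi (s * t) * h s)) =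
  \int[mu]_s (\int[mu]_t (k t * phi (s * t)) * h s).
Proof.
rewrite /Rintegral; congr fine.
transitivity (\int[mu]_t \int[mu]_s f (t, s))%E.
  apply: eq_integral => t _.
  rewrite EFinM fineK; last exact/integrable_fin_num/integrable_inner.
  by rewrite -integralZl//; exact: integrable_inner.
rewrite Fubini//; apply: eq_integral => s _.
rewrite EFinM fineK; last exact/integrable_fin_num/integrable_inner'.
rewrite muleC -integralZl//; last exact: integrable_inner'.
by apply: eq_integral => t _; rewrite -EFinM /f /= mulrA mulrC.
Qed.

Lemma integrable_mul_transform : mu.-integrable setT
  (EFin \o (fun t => k t * \int[mu]_s (phi (s * t) * h s))).
Proof.
apply: eq_integrable (integrable_fubini_F integrable_f) => // t _ /=.
rewrite EFinM /Rintegral fineK; last exact/integrable_fin_num/integrable_inner.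
by rewrite -integralZl//; exact: integrable_inner.
Qed.

End multiplication_formula.

(** * Integrals of quaternion-valued functions *)

Section quaternion_integral.
Context {R : realType}.
Local Notation mu := (@lebesgue_measure R).
Implicit Types (D : set R) (F G : R -> quat R) (a : quat R).

Lemma integrable_lin4 D (c1 c2 c3 c4 : R) (f1 f2 f3 f4 : R -> R) :
  measurable D -> mu.-integrable D (EFin \o f1) ->
  mu.-integrable D (EFin \o f2) -> mu.-integrable D (EFin \o f3) ->
  mu.-integrable D (EFin \o f4) ->
  mu.-integrable D (EFin \o
    (fun t => c1 * f1 t + c2 * f2 t + c3 * f3 t + c4 * f4 t)).
Proof.
move=> mD i1 i2 i3 i4.
by do ![apply: integrableRD => //]; exact: integrableRZ.
Qed.

Lemma Rintegral_lin4 D (c1 c2 c3 c4 : R) (f1 f2 f3 f4 : R -> R) :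
  measurable D -> mu.-integrable D (EFin \o f1) ->
  mu.-integrable D (EFin \o f2) -> mu.-integrable D (EFin \o f3) ->
  mu.-integrable D (EFin \o f4) ->
  \int[mu]_(t in D) (c1 * f1 t + c2 * f2 t + c3 * f3 t + c4 * f4 t) =
  c1 * (\int[mu]_(t in D) f1 t) + c2 * (\int[mu]_(t in D) f2 t) +
  c3 * (\int[mu]_(t in D) f3 t) + c4 * (\int[mu]_(t in D) f4 t).
Proof.
move=> mD i1 i2 i3 i4.
have z1 := integrableRZ c1 mD i1; have z2 := integrableRZ c2 mD i2.
have z3 := integrableRZ c3 mD i3; have z4 := integrableRZ c4 mD i4.
have d12 := integrableRD mD z1 z2; have d123 := integrableRD mD d12 z3.
by rewrite !RintegralD// !RintegralZl.
Qed.

Definition qintegrable D F :=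
  [/\ mu.-integrable D (EFin \o (fun t => qre (F t))),
      mu.-integrable D (EFin \o (fun t => qi (F t))),
      mu.-integrable D (EFin \o (fun t => qj (F t))) &
      mu.-integrable D (EFin \o (fun t => qk (F t)))].

Lemma eq_qint D F G : (forall t, D t -> F t = G t) -> qint D F = qint D G.
Proof.
by move=> FG; rewrite /qint; congr (_, _, _, _);
  apply: eq_Rintegral => t /set_mem /FG ->.
Qed.

Lemma eq_qintegrable D F G : measurable D -> (forall t, D t -> F t = G t) ->
  qintegrable D F -> qintegrable D G.
Proof.
by move=> mD FG [i1 i2 i3 i4]; split;
  [move: i1|move: i2|move: i3|move: i4];
  apply: (eq_integrableR mD) => t /FG ->.
Qed.

Lemma qintegrableD D F G : measurable D -> qintegrable D F ->
  qintegrable D G -> qintegrable D (fun t => F t + G t).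
Proof.
move=> mD [F1 F2 F3 F4] [G1 G2 G3 G4]; by split; exact: integrableRD.
Qed.

Lemma qintD D F G : measurable D -> qintegrable D F -> qintegrable D G ->
  qint D (fun t => F t + G t) = qint D F + qint D G.
Proof.
by move=> mD [F1 F2 F3 F4] [G1 G2 G3 G4]; apply: quatP; exact: RintegralD.
Qed.

Lemma qintegrable_qmul D a F : measurable D -> qintegrable D F ->
  qintegrable D (fun t => qmul a (F t)).
Proof.
move=> mD [F1 F2 F3 F4]; split.
- apply: (eq_integrableR mD _ (integrable_lin4 (qre a) (- qi a) (- qj a) (- qk a)
    mD F1 F2 F3 F4)) => t _.
  by rewrite /qmul /qre /qi /qj /qk /=; ring.
- apply: (eq_integrableR mD _ (integrable_lin4 (qi a) (qre a) (- qk a) (qj a)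
    mD F1 F2 F3 F4)) => t _.
  by rewrite /qmul /qre /qi /qj /qk /=; ring.
- apply: (eq_integrableR mD _ (integrable_lin4 (qj a) (qk a) (qre a) (- qi a)
    mD F1 F2 F3 F4)) => t _.
  by rewrite /qmul /qre /qi /qj /qk /=; ring.
- apply: (eq_integrableR mD _ (integrable_lin4 (qk a) (- qj a) (qi a) (qre a)
    mD F1 F2 F3 F4)) => t _.
  by rewrite /qmul /qre /qi /qj /qk /=; ring.
Qed.

Lemma qint_qmul D a F : measurable D -> qintegrable D F ->
  qint D (fun t => qmul a (F t)) = qmul a (qint D F).
Proof.
move=> mD [F1 F2 F3 F4]; apply: quatP.
- transitivity (\int[mu]_(t in D) (qre a * qre (F t) + (- qi a) * qi (F t) +
    (- qj a) * qj (F t) + (- qk a) * qk (F t))).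
    by apply: eq_Rintegral => t _; rewrite /qmul /qre /qi /qj /qk /=; ring.
  by rewrite Rintegral_lin4// /qmul /qre /qi /qj /qk /=; ring.
- transitivity (\int[mu]_(t in D) (qi a * qre (F t) + qre a * qi (F t) +
    (- qk a) * qj (F t) + qj a * qk (F t))).
    by apply: eq_Rintegral => t _; rewrite /qmul /qre /qi /qj /qk /=; ring.
  by rewrite Rintegral_lin4// /qmul /qre /qi /qj /qk /=; ring.
- transitivity (\int[mu]_(t in D) (qj a * qre (F t) + qk a * qi (F t) +
    qre a * qj (F t) + (- qi a) * qk (F t))).
    by apply: eq_Rintegral => t _; rewrite /qmul /qre /qi /qj /qk /=; ring.
  by rewrite Rintegral_lin4// /qmul /qre /qi /qj /qk /=; ring.
- transitivity (\int[mu]_(t in D) (qk a * qre (F t) + (- qj a) * qi (F t) +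
    qi a * qj (F t) + qre a * qk (F t))).
    by apply: eq_Rintegral => t _; rewrite /qmul /qre /qi /qj /qk /=; ring.
  by rewrite Rintegral_lin4// /qmul /qre /qi /qj /qk /=; ring.
Qed.

Lemma qreal_mul (r : R) a : qmul (qreal r) a = r *: a.
Proof. quat_ring. Qed.

Lemma qintegrableZ D (r : R) F : measurable D -> qintegrable D F ->
  qintegrable D (fun t => r *: F t).
Proof.
move=> mD /(qintegrable_qmul (qreal r) mD).
by apply: eq_qintegrable => // t _; rewrite qreal_mul.
Qed.

Lemma qintZ D (r : R) F : measurable D -> qintegrable D F ->
  qint D (fun t => r *: F t) = r *: qint D F.
Proof.
move=> mD /(qint_qmul (qreal r) mD); rewrite qreal_mul => <-.
by apply: eq_qint => t _; rewrite qreal_mul.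
Qed.

Lemma qintegrable_bdd D (k : R -> R) (C : R) F : measurable D ->
  measurable_fun D k -> (forall t, D t -> `|k t| <= C) ->
  qintegrable D F -> qintegrable D (fun t => k t *: F t).
Proof.
by move=> mD mk kC [? ? ? ?]; split; exact: integrable_bddMl kC _.
Qed.

End quaternion_integral.

(** * Cosine and sine transforms of the damped kernels *)

Section kernel_transforms.
Context {R : realType}.
Local Notation mu := (@lebesgue_measure R).
Implicit Types x y s t u : R.

Definition cosT (k : R -> R) s := \int[mu]_t (k t * cos (s * t)).
Definition sinT (k : R -> R) s := \int[mu]_t (k t * sin (s * t)).

Lemma integrable_mul_cos k s : mu.-integrable setT (EFin \o k) ->
  mu.-integrable setT (EFin \o (fun t => k t * cos (s * t))).
Proof.
by apply: (integrable_bddMr _ (measurable_cosM s)) => // t _; exact: cos_max.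
Qed.

Lemma integrable_mul_sin k s : mu.-integrable setT (EFin \o k) ->
  mu.-integrable setT (EFin \o (fun t => k t * sin (s * t))).
Proof.
by apply: (integrable_bddMr _ (measurable_sinM s)) => // t _; exact: sin_max.
Qed.

Definition cosker x y t := expker x t * cos (y * t).
Definition sinker x y t := expker x t * sin (y * t).

Lemma integrable_cosker x y : 0 < x -> mu.-integrable setT (EFin \o cosker x y).
Proof. by move=> x0; exact/integrable_mul_cos/integrable_expker. Qed.

Lemma integrable_sinker x y : 0 < x -> mu.-integrable setT (EFin \o sinker x y).
Proof. by move=> x0; exact/integrable_mul_sin/integrable_expker. Qed.

Lemma expkerN x t : expker x (- t) = expker x t.
Proof. by rewrite /expker normrN. Qed.

Lemma sinT_cosker x y s : 0 < x -> sinT (cosker x y) s = 0.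
Proof.
move=> x0; apply: Rintegral_odd.
  exact/integrable_mul_sin/integrable_cosker.
by move=> t; rewrite /cosker expkerN !mulrN cosN sinN mulrN.
Qed.

Lemma cosT_sinker x y s : 0 < x -> cosT (sinker x y) s = 0.
Proof.
move=> x0; apply: Rintegral_odd.
  exact/integrable_mul_cos/integrable_sinker.
by move=> t; rewrite /sinker expkerN !mulrN cosN sinN mulrN mulNr.
Qed.

Lemma cosT_cosker x y s : 0 < x ->
  cosT (cosker x y) s = 2^-1 * (poisker x (y - s) + poisker x (y + s)).
Proof.
move=> x0; rewrite -!(integral_expker_cos _ x0) -RintegralD//; last 2 first.
- exact: integrable_cosker.
- exact: integrable_cosker.
rewrite -RintegralZl//; last first.
  have /= := integrableD measurableT (integrable_cosker (y - s) x0)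
    (integrable_cosker (y + s) x0).
  exact: eq_integrable.
by apply: eq_Rintegral => t _; rewrite /cosker mulrBl mulrDl cosB cosD; field.
Qed.

Lemma sinT_sinker x y s : 0 < x ->
  sinT (sinker x y) s = 2^-1 * (poisker x (y - s) - poisker x (y + s)).
Proof.
move=> x0; rewrite -!(integral_expker_cos _ x0) -RintegralB//; last 2 first.
- exact: integrable_cosker.
- exact: integrable_cosker.
rewrite -RintegralZl//; last first.
  have /= := integrableB measurableT (integrable_cosker (y - s) x0)
    (integrable_cosker (y + s) x0).
  exact: eq_integrable.
by apply: eq_Rintegral => t _; rewrite /sinker mulrBl mulrDl cosB cosD; field.
Qed.

End kernel_transforms.

(** * The Fourier transform on integrable functions *)

Section fourier_L1.
Context {R : realType}.
Local Notation mu := (@lebesgue_measure R).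
Implicit Types (F : R -> quat R) (k : R -> R) (I J : quat R).

Definition ftc : R := (Num.sqrt (2 * pi))^-1.

Definition qcosT F (t : R) := qint setT (fun s => cos (s * t) *: F s).
Definition qsinT F (t : R) := qint setT (fun s => sin (s * t) *: F s).

Let mcos (t : R) : measurable_fun setT (fun s : R => cos (s * t)).
Proof.
by rewrite (_ : (fun s => _) = (fun s : R => cos (t * s)))//;
  [exact: measurable_cosM|apply/funext => s; rewrite mulrC].
Qed.

Let msin (t : R) : measurable_fun setT (fun s : R => sin (s * t)).
Proof.
by rewrite (_ : (fun s => _) = (fun s : R => sin (t * s)))//;
  [exact: measurable_sinM|apply/funext => s; rewrite mulrC].
Qed.

Lemma qintegrable_cos F (t : R) : qintegrable setT F ->
  qintegrable setT (fun s => cos (s * t) *: F s).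
Proof.
by apply: (qintegrable_bdd _ (mcos t)) => // s _; exact: cos_max.
Qed.

Lemma qintegrable_sin F (t : R) : qintegrable setT F ->
  qintegrable setT (fun s => sin (s * t) *: F s).
Proof.
by apply: (qintegrable_bdd _ (msin t)) => // s _; exact: sin_max.
Qed.

(** The real and imaginary parts of the exponential act separately, and the
    unit [I], which stands on the left, leaves the integral. *)
Lemma qFT1E I F t : qintegrable setT F ->
  qFT1 I F t = ftc *: (qcosT F t - qmul I (qsinT F t)).
Proof.
move=> iF; have ic := qintegrable_cos t iF; have is_ := qintegrable_sin t iF.
rewrite /qFT1 qscaleE -/ftc; congr (_ *: _).
rewrite /qcosT /qsinT -qmulNl -qint_qmul// -qintD//; last exact: qintegrable_qmul.
apply: eq_qint => s _; rewrite qmul_qexp expR0 !mul1r cosN sinN; congr (_ + _).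
by rewrite scaleNr qmulNr qmulNl.
Qed.

Lemma qintegrable_mul_cosT k F : mu.-integrable setT (EFin \o k) ->
  qintegrable setT F -> qintegrable setT (fun t => k t *: qcosT F t).
Proof.
have mc : measurable_fun setT (@cos R).
  by apply: continuous_measurable_fun; exact: continuous_cos.
move=> ik [i1 i2 i3 i4]; split.
- exact: (integrable_mul_transform ik i1 mc (@cos_max R)).
- exact: (integrable_mul_transform ik i2 mc (@cos_max R)).
- exact: (integrable_mul_transform ik i3 mc (@cos_max R)).
- exact: (integrable_mul_transform ik i4 mc (@cos_max R)).
Qed.

Lemma qintegrable_mul_sinT k F : mu.-integrable setT (EFin \o k) ->
  qintegrable setT F -> qintegrable setT (fun t => k t *: qsinT F t).
Proof.
have mc : measurable_fun setT (@sin R).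
  by apply: continuous_measurable_fun; exact: continuous_sin.
move=> ik [i1 i2 i3 i4]; split.
- exact: (integrable_mul_transform ik i1 mc (@sin_max R)).
- exact: (integrable_mul_transform ik i2 mc (@sin_max R)).
- exact: (integrable_mul_transform ik i3 mc (@sin_max R)).
- exact: (integrable_mul_transform ik i4 mc (@sin_max R)).
Qed.

Lemma qint_mul_cosT k F : mu.-integrable setT (EFin \o k) ->
  qintegrable setT F ->
  qint setT (fun t => k t *: qcosT F t) = qint setT (fun s => cosT k s *: F s).
Proof.
have mc : measurable_fun setT (@cos R).
  by apply: continuous_measurable_fun; exact: continuous_cos.
move=> ik [i1 i2 i3 i4]; apply: quatP.
- exact: (multiplication_formula ik i1 mc (@cos_max R)).
- exact: (multiplication_formula ik i2 mc (@cos_max R)).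
- exact: (multiplication_formula ik i3 mc (@cos_max R)).
- exact: (multiplication_formula ik i4 mc (@cos_max R)).
Qed.

Lemma qint_mul_sinT k F : mu.-integrable setT (EFin \o k) ->
  qintegrable setT F ->
  qint setT (fun t => k t *: qsinT F t) = qint setT (fun s => sinT k s *: F s).
Proof.
have mc : measurable_fun setT (@sin R).
  by apply: continuous_measurable_fun; exact: continuous_sin.
move=> ik [i1 i2 i3 i4]; apply: quatP.
- exact: (multiplication_formula ik i1 mc (@sin_max R)).
- exact: (multiplication_formula ik i2 mc (@sin_max R)).
- exact: (multiplication_formula ik i3 mc (@sin_max R)).
- exact: (multiplication_formula ik i4 mc (@sin_max R)).
Qed.

Lemma mul_qFT1 I (k : R) F t : qintegrable setT F -> k *: qFT1 I F t =
  ftc *: (k *: qcosT F t) + qmul ((- ftc) *: I) (k *: qsinT F t).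
Proof.
move=> iF; rewrite qFT1E//; move: (qcosT F t) (qsinT F t) => a b.
by rewrite qmulZr qmulZl scalerBr scalerA mulrC -scalerA -scalerBr scaleNr
  !scalerBr !scalerN !scalerA mulrC.
Qed.

Lemma qintegrable_mul_qFT1 I k F : mu.-integrable setT (EFin \o k) ->
  qintegrable setT F -> qintegrable setT (fun t => k t *: qFT1 I F t).
Proof.
move=> ik iF; have mT := @measurableT _ R.
apply: (eq_qintegrable mT) (qintegrableD mT
  (qintegrableZ ftc mT (qintegrable_mul_cosT ik iF))
  (qintegrable_qmul ((- ftc) *: I) mT (qintegrable_mul_sinT ik iF))).
by move=> t _; rewrite mul_qFT1.
Qed.

(** A real kernel commutes with [I], so that the cosine and sine parts of the
    transform can be transposed onto the kernel one at a time. *)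
Lemma qmultiplication_formula I k F : mu.-integrable setT (EFin \o k) ->
  qintegrable setT F -> qint setT (fun t => k t *: qFT1 I F t) =
  ftc *: (qint setT (fun s => cosT k s *: F s) -
          qmul I (qint setT (fun s => sinT k s *: F s))).
Proof.
move=> ik iF; have mT := @measurableT _ R.
have ic := qintegrable_mul_cosT ik iF; have is_ := qintegrable_mul_sinT ik iF.
rewrite -qint_mul_cosT// -qint_mul_sinT//.
transitivity (ftc *: qint setT (fun t => k t *: qcosT F t) +
    qmul ((- ftc) *: I) (qint setT (fun t => k t *: qsinT F t))).
  rewrite -qintZ// -qint_qmul// -qintD//.
  - by apply: eq_qint => t _; rewrite mul_qFT1.
  - exact: qintegrableZ.
  - exact: qintegrable_qmul.
by rewrite scalerBr qmulZl scaleNr.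
Qed.

(** Fubini's theorem yields the measurability of the transform times an
    integrable weight; the exponential weight is then divided out. *)
Lemma qmeasurable_qFT1 I F : qintegrable setT F -> qmeasurable (qFT1 I F).
Proof.
move=> iF.
have [i1 i2 i3 i4] := qintegrable_mul_qFT1 I (@integrable_expker R 1 ltr01) iF.
have mt (g : R -> R) :
    mu.-integrable setT (EFin \o (fun t => expker 1 t * g t)) ->
    measurable_fun setT g.
  move=> /measurable_int/measurable_EFinP mg.
  rewrite (_ : g = (fun t => expker (-1) t * (expker 1 t * g t))).
    by apply: measurable_funM => //; exact: measurable_expker.
  apply/funext => t; rewrite mulrA /expker -expRD.
  by rewrite mulN1r mul1r opprK subrr expR0 mul1r.
by split; apply: mt.
Qed.

End fourier_L1.

(** * Limits of quaternions *)

Section quaternion_topology.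
Context {R : realType} {T : Type} {F : set_system T} {FF : Filter F}.
Implicit Types (f g : T -> quat R) (l m a : quat R).

Lemma cvg_quatP f l : f x @[x --> F] --> l <->
  [/\ qre (f x) @[x --> F] --> qre l, qi (f x) @[x --> F] --> qi l,
      qj (f x) @[x --> F] --> qj l & qk (f x) @[x --> F] --> qk l].
Proof.
split=> [fl|[h1 h2 h3 h4]].
  have fst_ (U V : normedModType R) (h : T -> U * V) (c : (U * V)%type) :
      h x @[x --> F] --> c -> (h x).1 @[x --> F] --> c.1.
    by case: c => c d hc; apply: cvg_comp hc _; exact: cvg_fst.
  have snd_ (U V : normedModType R) (h : T -> U * V) (c : (U * V)%type) :
      h x @[x --> F] --> c -> (h x).2 @[x --> F] --> c.2.
    by case: c => c d hc; apply: cvg_comp hc _; exact: cvg_snd.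
  split.
  - exact: (fst_ _ _ _ _ (fst_ _ _ _ _ (fst_ _ _ _ _ fl))).
  - exact: (snd_ _ _ _ _ (fst_ _ _ _ _ (fst_ _ _ _ _ fl))).
  - exact: (snd_ _ _ _ _ (fst_ _ _ _ _ fl)).
  - exact: (snd_ _ _ _ _ fl).
rewrite (_ : f = fun x => (qre (f x), qi (f x), qj (f x), qk (f x))); last first.
  by apply/funext => x; case: (f x) => [[[? ?] ?] ?].
case: l h1 h2 h3 h4 => [[[l1 l2] l3] l4] /= h1 h2 h3 h4.
exact: (cvg_pair (cvg_pair (cvg_pair h1 h2) h3) h4).
Qed.

Lemma cvg_qnorm f l : qnorm (f x - l) @[x --> F] --> (0 : R) ->
  f x @[x --> F] --> l.
Proof.
move=> fl; apply/cvg_quatP.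
have sub (c : quat R -> R) : (forall a b, c (a - b) = c a - c b) ->
    (forall a, `|c a| <= qnorm a) -> c (f x) @[x --> F] --> c l.
  move=> cB cn; apply/subr_cvg0; apply: norm_cvg0.
  apply: (squeeze_cvgr _ (cvg_cst 0) fl).
  by apply: nearW => x; rewrite normr_ge0/= -cB.
by split; apply: sub => // a; case: (norm_comp_le a).
Qed.

Lemma cvg_qmul f g l m : f x @[x --> F] --> l -> g x @[x --> F] --> m ->
  qmul (f x) (g x) @[x --> F] --> qmul l m.
Proof.
move=> /cvg_quatP[f1 f2 f3 f4] /cvg_quatP[g1 g2 g3 g4].
apply/cvg_quatP; split; rewrite /qmul /=.
- by apply: cvgB; [apply: cvgB; [apply: cvgB|]|]; exact: cvgM.
- by apply: cvgB; [apply: cvgD; [apply: cvgD|]|]; exact: cvgM.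
- by apply: cvgD; [apply: cvgD; [apply: cvgB|]|]; exact: cvgM.
- by apply: cvgD; [apply: cvgB; [apply: cvgD|]|]; exact: cvgM.
Qed.

Lemma cvg_qZ (r : R) f l : f x @[x --> F] --> l ->
  r *: f x @[x --> F] --> r *: l.
Proof.
by move=> /cvg_quatP[f1 f2 f3 f4]; apply/cvg_quatP; split; apply: cvgMl_tmp.
Qed.

Lemma cvg_qD f g l m : f x @[x --> F] --> l -> g x @[x --> F] --> m ->
  f x + g x @[x --> F] --> l + m.
Proof.
move=> /cvg_quatP[f1 f2 f3 f4] /cvg_quatP[g1 g2 g3 g4].
by apply/cvg_quatP; split; apply: cvgD.
Qed.

Lemma cvg_qB f g l m : f x @[x --> F] --> l -> g x @[x --> F] --> m ->
  f x - g x @[x --> F] --> l - m.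
Proof.
move=> /cvg_quatP[f1 f2 f3 f4] /cvg_quatP[g1 g2 g3 g4].
by apply/cvg_quatP; split; apply: cvgB.
Qed.

End quaternion_topology.

(** * L^p functions *)

Section Lp_functions.
Context {R : realType}.
Local Notation mu := (@lebesgue_measure R).
Implicit Types (F G : R -> quat R) (p : R).

Lemma qmeasurable_qnorm F : qmeasurable F ->
  measurable_fun setT (fun s => qnorm (F s)).
Proof.
move=> [m1 m2 m3 m4]; rewrite /qnorm.
apply: (@measurableT_comp _ _ _ _ _ _ (@Num.sqrt R)).
  by apply: continuous_measurable_fun; exact: sqrt_continuous.
by do ![apply: measurable_funD]; exact: measurable_funX.
Qed.

Lemma qmeasurable_qmul a F : qmeasurable F -> qmeasurable (fun s => qmul a (F s)).
Proof.
move=> [m1 m2 m3 m4]; split; rewrite /qmul /=.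
- by do ![apply: measurable_funB]; exact: measurable_funM.
- by apply: measurable_funB; [do ![apply: measurable_funD]|];
    exact: measurable_funM.
- by apply: measurable_funD; [apply: measurable_funD;
    [apply: measurable_funB|]|]; exact: measurable_funM.
- by apply: measurable_funD; [apply: measurable_funB;
    [apply: measurable_funD|]|]; exact: measurable_funM.
Qed.

Lemma qmeasurableD F G : qmeasurable F -> qmeasurable G ->
  qmeasurable (fun s => F s + G s).
Proof. by move=> [? ? ? ?] [? ? ? ?]; split; exact: measurable_funD. Qed.

Lemma qmeasurable_scale (k : R -> R) F : measurable_fun setT k ->
  qmeasurable F -> qmeasurable (fun s => k s *: F s).
Proof. by move=> mk [? ? ? ?]; split; exact: measurable_funM. Qed.

Lemma qmeasurableB F G : qmeasurable F -> qmeasurable G ->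
  qmeasurable (fun s => F s - G s).
Proof. by move=> [? ? ? ?] [? ? ? ?]; split; exact: measurable_funB. Qed.

Lemma qLnormE p F : 0 < p ->
  qLnorm p%:E F = ((\int[mu]_s (qnorm (F s) `^ p)%:E) `^ p^-1)%E.
Proof.
move=> p0; rewrite /qLnorm unlock; apply: (congr1 (fun z => (z `^ p^-1)%E)).
by apply: eq_integral => s _ /=; rewrite ger0_norm ?qnorm_ge0.
Qed.

Lemma qLp_integrable p F : 0 < p -> qLp p%:E F ->
  mu.-integrable setT (EFin \o (fun s => qnorm (F s) `^ p)).
Proof.
move=> p0 [mF Foo]; apply/integrableP; split.
  apply/measurable_EFinP; apply: (measurableT_comp (measurable_powR p)).
  exact: qmeasurable_qnorm.
move: Foo; rewrite qLnormE// => /lty_poweRy; rewrite invr_eq0 gt_eqF// => h.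
under eq_integral do rewrite /= ger0_norm ?powR_ge0//.
exact: h.
Qed.

Lemma qintegrable_qmeasurable F : qintegrable setT F -> qmeasurable F.
Proof.
move=> [i1 i2 i3 i4]; split; apply/measurable_EFinP.
- exact: measurable_int i1.
- exact: measurable_int i2.
- exact: measurable_int i3.
- exact: measurable_int i4.
Qed.

Lemma qLp1_qintegrable F : qLp 1%E F <-> qintegrable setT F.
Proof.
split=> [Fp|iF]; last first.
  have mF := qintegrable_qmeasurable iF.
  split=> //; rewrite qLnormE// invr1 poweRe1; last first.
    by apply: integral_ge0 => s _; rewrite lee_fin powR_ge0.
  have [i1 i2 i3 i4] := iF.
  suff : mu.-integrable setT (EFin \o (fun s => qnorm (F s))).
    move=> /integrableP[_]; congr (_ < _)%E; apply: eq_integral => s _ /=.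
    by rewrite powRr1 ?qnorm_ge0// ger0_norm ?qnorm_ge0.
  apply: (@le_integrableR _ setT _ (fun s => `|qre (F s)| + `|qi (F s)| +
      `|qj (F s)| + `|qk (F s)|)) => //.
  - exact: qmeasurable_qnorm.
  - by move=> s _; rewrite ger0_norm ?qnorm_ge0// qnorm_le_sum.
  - by do ![apply: integrableRD => //]; exact: integrable_norm.
have [mF _] := Fp; have := qLp_integrable ltr01 Fp.
rewrite (_ : (fun s => _) = (fun s => qnorm (F s))); last first.
  by apply/funext => s; rewrite powRr1// qnorm_ge0.
case: mF => m1 m2 m3 m4 iF.
by split; apply: (le_integrableR _ _ _ iF) => // s _;
  case: (norm_comp_le (F s)).
Qed.

Lemma le_1DpowR p (a : R) : 1 <= p -> 0 <= a -> a <= 1 + a `^ p.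
Proof.
move=> p1 a0; have [a1|a1] := leP a 1; first by rewrite ler_wpDr// powR_ge0.
rewrite ler_wpDl// -[leLHS]powRr1//; apply: ler_powR => //; exact: ltW.
Qed.

(** A bounded integrable weight turns an L^p function, p >= 1, into an
    integrable one, because a <= 1 + a^p for a >= 0. *)
Lemma qintegrable_weight p (w : R -> R) (C : R) F : 1 <= p -> qLp p%:E F ->
  mu.-integrable setT (EFin \o w) -> (forall s, `|w s| <= C) ->
  qintegrable setT (fun s => w s *: F s).
Proof.
move=> p1 Fp iw wC; have p0 : 0 < p by rewrite (lt_le_trans ltr01).
have mw : measurable_fun setT w by move/measurable_int: iw => /measurable_EFinP.
have [mF _] := Fp; have iFp := qLp_integrable p0 Fp.
have mwF := qmeasurable_scale mw mF.
have iB : mu.-integrable setT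
    (EFin \o (fun s => `|w s| + C * qnorm (F s) `^ p)).
  by apply: integrableRD => //; [exact: integrable_norm|exact: integrableRZ].
have B a s : `|a| <= qnorm (F s) -> `|w s * a| <= `|w s| + C * qnorm (F s) `^ p.
  move=> aF; rewrite normrM.
  apply: (@le_trans _ _ (`|w s| * (1 + qnorm (F s) `^ p))).
    by rewrite ler_wpM2l// (le_trans aF)// le_1DpowR// qnorm_ge0.
  by rewrite mulrDr mulr1 lerD2l ler_wpM2r// powR_ge0.
case: mwF => m1 m2 m3 m4.
by split; apply: (le_integrableR _ _ _ iB) => // s _; apply: B;
  case: (norm_comp_le (F s)).
Qed.

Lemma qLp_le p F G : 0 < p -> qmeasurable G ->
  (forall s, qnorm (G s) <= qnorm (F s)) -> qLp p%:E F -> qLp p%:E G.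
Proof.
move=> p0 mG GF Fp; split=> //; rewrite qLnormE// poweR_lty//.
have /integrableP[_] := qLp_integrable p0 Fp; apply: le_lt_trans.
have [mF _] := Fp; apply: ge0_le_integral => //.
- by move=> s _; rewrite lee_fin powR_ge0.
- by apply/measurable_EFinP; apply: (measurableT_comp (measurable_powR p));
    exact: qmeasurable_qnorm.
- apply: measurableT_comp => //.
  by apply/measurable_EFinP; apply: (measurableT_comp (measurable_powR p));
    exact: qmeasurable_qnorm.
- move=> s _ /=; rewrite lee_fin ger0_norm ?powR_ge0//.
  by rewrite ge0_ler_powR ?nnegrE ?qnorm_ge0// ltW.
Qed.

End Lp_functions.

(** * Truncation *)

Section truncation.
Context {R : realType}.
Local Notation mu := (@lebesgue_measure R).
Variables (p : R) (F : R -> quat R).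
Hypotheses (p1 : 1 <= p) (Fp : qLp p%:E F).

Definition cutoff (n : nat) : R -> R := \1_(`[- n%:R, n%:R]%classic).

Definition truncate n s := cutoff n s *: F s.

Let p0 : 0 < p. Proof. exact: lt_le_trans ltr01 p1. Qed.

Lemma cutoff_bound n s : 0 <= cutoff n s <= 1.
Proof. by rewrite /cutoff indicE; case: (_ \in _); rewrite lexx ler01. Qed.

Lemma norm_cutoff_le1 n s : `|cutoff n s| <= 1.
Proof. by have /andP[? ?] := cutoff_bound n s; rewrite ger0_norm. Qed.

Lemma cutoff_eventually s : \forall n \near \oo, cutoff n s = 1.
Proof.
near=> n; rewrite /cutoff indicE mem_set//= in_itv/= -ler_norml.
near: n; exact: nbhs_infty_ger.
Unshelve. all: by end_near. Qed.

Lemma measurable_cutoff n : measurable_fun setT (cutoff n).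
Proof. exact: measurable_indic. Qed.

Lemma integrable_cutoff n : mu.-integrable setT (EFin \o cutoff n).
Proof. exact: integrable_indic_itv. Qed.

Lemma qmeasurable_truncate n : qmeasurable (truncate n).
Proof. by apply: qmeasurable_scale; [exact: measurable_cutoff|case: Fp]. Qed.

Lemma truncate_L1 n : qLp 1%E (truncate n).
Proof.
apply/qLp1_qintegrable/(qintegrable_weight p1 Fp (integrable_cutoff n)).
exact: norm_cutoff_le1.
Qed.

Lemma truncate_Lp n : qLp p%:E (truncate n).
Proof.
apply: qLp_le p0 (qmeasurable_truncate n) _ Fp => s; rewrite /truncate qnormZ.
by rewrite ler_piMl ?qnorm_ge0// norm_cutoff_le1.
Qed.

Let tail n s := qnorm (truncate n s - F s) `^ p.

Let tail_le n s : 0 <= tail n s <= qnorm (F s) `^ p.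
Proof.
rewrite /tail powR_ge0/= ge0_ler_powR ?nnegrE ?qnorm_ge0 ?(ltW p0)//.
rewrite /truncate -[X in _ - X]scale1r -scalerBl qnormZ.
rewrite ler_piMl ?qnorm_ge0// distrC ger0_norm.
  by have /andP[? ?] := cutoff_bound n s; lra.
by have /andP[? ?] := cutoff_bound n s; lra.
Qed.

Let measurable_tail n : measurable_fun setT (tail n).
Proof.
apply: (measurableT_comp (measurable_powR p)); apply: qmeasurable_qnorm.
by apply: qmeasurableB; [exact: qmeasurable_truncate|case: Fp].
Qed.

(** Dominated convergence, with the p-th power of the norm of [F] as bound. *)
Lemma truncate_cvg :
  qLnorm p%:E (fun s => truncate n s - F s) @[n --> \oo] --> 0%E.
Proof.
have tail0 : (\int[mu]_s (tail n s)%:E)%E @[n --> \oo] --> 0%E.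
  have := @dominated_cvg _ _ _ mu setT measurableT
    (fun n s => (tail n s)%:E) (cst 0%E) (fun s => (qnorm (F s) `^ p)%:E).
  rewrite integral0; apply => //.
  - by move=> n; apply/measurable_EFinP; exact: measurable_tail.
  - move=> s _; apply: cvg_near_cst; near=> n.
    rewrite /tail /truncate (_ : cutoff n s = 1).
      by rewrite scale1r subrr /qnorm !quatE expr0n/= !addr0 sqrtr0 powR0// gt_eqF.
    by near: n; exact: cutoff_eventually.
  - exact: qLp_integrable.
  - by move=> n s _; have /andP[? ?] := tail_le n s; rewrite gee0_abs ?lee_fin.
have fin n : (\int[mu]_s (tail n s)%:E)%E \is a fin_num.
  rewrite ge0_fin_numE; last first.
    by apply: integral_ge0 => s _; rewrite lee_fin powR_ge0.
  have /integrableP[_] := qLp_integrable p0 Fp; apply: le_lt_trans.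
  apply: ge0_le_integral => //.
  - by move=> s _; rewrite lee_fin powR_ge0.
  - by apply/measurable_EFinP; exact: measurable_tail.
  - apply: measurableT_comp => //; apply/measurable_EFinP.
    by have /measurable_int/measurable_EFinP := qLp_integrable p0 Fp.
  - move=> s _ /=; rewrite lee_fin ger0_norm ?powR_ge0//.
    by have /andP[] := tail_le n s.
under eq_fun do rewrite qLnormE// -/(tail _ _) -(fineK (fin _)) poweR_EFin.
apply: cvg_EFin; first exact: nearW.
have /cvgrPdist_lt f0 :
    fine (\int[mu]_s (tail n s)%:E)%E @[n --> \oo] --> (0 : R).
  exact: fine_cvg tail0.
apply/cvgrPdist_le => e e0.
have := f0 (e `^ p) (powR_gt0 p e0).
apply: filterS => n /=; rewrite !sub0r !normrN.
rewrite ger0_norm ?fine_ge0//; last first.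
  by apply: integral_ge0 => s _; rewrite lee_fin powR_ge0.
move=> H; rewrite ger0_norm ?powR_ge0//.
rewrite (_ : e = (e `^ p) `^ p^-1); last first.
  by rewrite -powRrM mulfV ?gt_eqF// powRr1// ltW.
rewrite ge0_ler_powR ?invr_ge0 ?(ltW p0) ?nnegrE ?powR_ge0 ?(ltW H)//.
by rewrite fine_ge0//; apply: integral_ge0 => s _; rewrite lee_fin powR_ge0.
Unshelve. all: by end_near. Qed.

End truncation.

(** * The multiplication formula in L^p *)

Section duality.
Context {R : realType}.
Local Notation mu := (@lebesgue_measure R).
Implicit Types (F G H : R -> quat R) (k : R -> R) (x p : R).

(** Hoelder's inequality with the exponential kernel as one factor, which lies in
    every L^p.  For [p = 1] the conjugate exponent is infinite and the estimate
    is the one by the essential supremum. *)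
Lemma expker_hoelder p x : 1 <= p -> 0 < x ->
  exists2 C : R, 0 < C & forall g : R -> R, measurable_fun setT g ->
  (\int[mu]_t (expker x t * `|g t|)%:E <=
   C%:E * Lnorm mu (hoelder_conjugate p%:E) (EFin \o g))%E.
Proof.
move=> p1 x0; have mek := @measurable_expker R x.
move: p1; rewrite le_eqVlt => /predU1P[<-|p1].
  exists (2 / x) => [|g mg]; first by rewrite divr_gt0.
  rewrite hoelder_conjugate1 unlock /=.
  have muT : (0 < mu [set: R])%E.
    by rewrite -set_itvNyy lebesgue_measure_itv/= ltry.
  rewrite ifT; last exact: muT.
  set M := ess_sup _ _.
  have gM : \forall t \ae mu, (`|(g t)%:E| <= M)%E by exact: ess_sup_ge.
  have [Moo|Mfin] := eqVneq M +oo%E.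
    by rewrite Moo gt0_muley ?leey// lte_fin divr_gt0.
  have M0 : (0 <= M)%E.
    apply: ess_sup_gee; last by apply: nearW => t /=; rewrite lee_fin.
    exact: muT.
  have Mf : M \is a fin_num by rewrite ge0_fin_numE// ltey.
  apply: (@le_trans _ _ (\int[mu]_t ((expker x t)%:E * M))%E).
    apply: ae_ge0_le_integral => //.
    - by move=> t _; rewrite lee_fin mulr_ge0 ?expker_ge0.
    - apply/measurable_EFinP; apply: measurable_funM => //.
      exact: measurableT_comp.
    - by move=> t _; rewrite mule_ge0// lee_fin expker_ge0.
    - by apply: emeasurable_funM => //; exact/measurable_EFinP.
    - move: gM; apply: (@filterS _ _ (ae_filter_ringOfSetsType mu)) => t gM _.
      by rewrite EFinM lee_wpmul2l// lee_fin expker_ge0.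
  rewrite ge0_integralZr//; last 2 first.
    exact/measurable_EFinP.
    by move=> t _; rewrite lee_fin expker_ge0.
  rewrite -(integral_expker x0) /Rintegral fineK//.
  by apply: integrable_fin_num => //; exact: integrable_expker.
pose q := p / (p - 1).
have p0 : 0 < p by rewrite (lt_trans ltr01).
have q0 : 0 < q by rewrite divr_gt0// subr_gt0.
have -> : hoelder_conjugate p%:E = q%:E.
  rewrite /hoelder_conjugate/= gt_eqF ?lte_fin// inver subr_eq0 gt_eqF//.
have Nfin : (Lnorm mu p%:E (EFin \o expker x) < +oo)%E.
  rewrite unlock poweR_lty//.
  have /integrableP[_] := @integrable_expker R (p * x) (mulr_gt0 p0 x0).
  congr (_ < _)%E; apply: eq_integral => t _ /=.
  rewrite !ger0_norm ?expker_ge0// /expker.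
  by rewrite -expRM; congr (expR _)%:E; ring.
exists (fine (Lnorm mu p%:E (EFin \o expker x)) + 1) => [|g mg].
  by rewrite ltr_wpDl// fine_ge0// Lnorm_ge0.
have := @hoelder _ _ R mu (expker x) g p q mek mg p0 q0.
rewrite Lnorm1 /q invf_div -{1}div1r -mulrDl subrKC mulfV ?gt_eqF//.
move=> /(_ erefl) h; apply: le_trans (le_trans h _).
  rewrite le_eqVlt; apply/orP; left; apply/eqP; apply: eq_integral => t _ /=.
  by rewrite normrM (ger0_norm (expker_ge0 _ _)).
rewrite lee_wpmul2r ?Lnorm_ge0// EFinD fineK ?ge0_fin_numE ?Lnorm_ge0//.
by rewrite leeDl.
Qed.

(** The constant is the same for all the kernels dominated by a given
    exponential. *)
Lemma kernel_pairing p x : 1 <= p -> 0 < x ->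
  exists2 C : R, 0 < C & forall k H, measurable_fun setT k ->
  (forall t, `|k t| <= expker x t) -> qmeasurable H ->
  (qLnorm (hoelder_conjugate p%:E) H < +oo)%E ->
  qintegrable setT (fun t => k t *: H t) /\
  qnorm (qint setT (fun t => k t *: H t)) <=
    C * fine (qLnorm (hoelder_conjugate p%:E) H).
Proof.
move=> p1 x0; have [C C0 hC] := expker_hoelder p1 x0.
exists (4 * C) => [|k H mk kx mH Hoo]; first by rewrite mulr_gt0.
have mnH := qmeasurable_qnorm mH.
have intE : (\int[mu]_t `|(expker x t * qnorm (H t))%:E| <=
    C%:E * qLnorm (hoelder_conjugate p%:E) H)%E.
  apply: le_trans (hC (fun t => qnorm (H t)) mnH).
  rewrite le_eqVlt; apply/orP; left; apply/eqP; apply: eq_integral => t _ /=.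
  by rewrite !ger0_norm ?mulr_ge0 ?expker_ge0 ?qnorm_ge0.
have Nfin : qLnorm (hoelder_conjugate p%:E) H \is a fin_num.
  by rewrite ge0_fin_numE//; exact: Lnorm_ge0.
have iE : mu.-integrable setT (EFin \o (fun t => expker x t * qnorm (H t))).
  apply/integrableP; split.
    by apply/measurable_EFinP; apply: measurable_funM => //;
      exact: measurable_expker.
  by apply: le_lt_trans intE _; rewrite -(fineK Nfin) -EFinM ltry.
have key (h : R -> R) : measurable_fun setT h ->
    (forall t, `|h t| <= qnorm (H t)) ->
    mu.-integrable setT (EFin \o (fun t => k t * h t)) /\
    `|\int[mu]_t (k t * h t)| <= C * fine (qLnorm (hoelder_conjugate p%:E) H).
  move=> mh hH; have kh t : `|k t * h t| <= expker x t * qnorm (H t).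
    by rewrite normrM ler_pM.
  have ikh : mu.-integrable setT (EFin \o (fun t => k t * h t)).
    by apply: (le_integrableR _ _ _ iE) => //; exact: measurable_funM.
  split=> //; apply: le_trans (le_normr_Rintegral _ ikh) _ => //.
  apply: (@le_trans _ _ (\int[mu]_t (expker x t * qnorm (H t)))).
    by apply: le_Rintegral => //; exact: integrable_norm.
  rewrite -lee_fin EFinM (fineK Nfin); apply: le_trans intE.
  rewrite /Rintegral fineK; last exact: integrable_fin_num.
  rewrite le_eqVlt; apply/orP; left; apply/eqP; apply: eq_integral => t _ /=.
  by rewrite ger0_norm ?mulr_ge0 ?expker_ge0 ?qnorm_ge0.
case: mH => m1 m2 m3 m4.
have [||i1 b1] := key (fun t => qre (H t)) => //.
  by move=> t; case: (norm_comp_le (H t)).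
have [||i2 b2] := key (fun t => qi (H t)) => //.
  by move=> t; case: (norm_comp_le (H t)).
have [||i3 b3] := key (fun t => qj (H t)) => //.
  by move=> t; case: (norm_comp_le (H t)).
have [||i4 b4] := key (fun t => qk (H t)) => //.
  by move=> t; case: (norm_comp_le (H t)).
split; first by split.
apply: le_trans (qnorm_le_sum _) _.
rewrite (_ : 4 * C * _ = C * fine (qLnorm (hoelder_conjugate p%:E) H) +
  C * fine (qLnorm (hoelder_conjugate p%:E) H) +
  C * fine (qLnorm (hoelder_conjugate p%:E) H) +
  C * fine (qLnorm (hoelder_conjugate p%:E) H)); last by ring.
by do ![apply: lerD].
Qed.

Lemma Rintegral_cutoff_cvg (g : R -> R) : mu.-integrable setT (EFin \o g) ->
  \int[mu]_s (g s * cutoff n s) @[n --> \oo] --> \int[mu]_s g s.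
Proof.
move=> ig; have mg : measurable_fun setT g.
  by move/measurable_int: ig => /measurable_EFinP.
apply: fine_cvg; rewrite fineK; last exact: integrable_fin_num.
apply: (@dominated_cvg _ _ _ mu setT measurableT
  (fun n s => (g s * cutoff n s)%:E) (EFin \o g) (fun s => `|g s|%:E)) => //.
- move=> n; apply/measurable_EFinP; apply: measurable_funM => //.
  exact: measurable_cutoff.
- move=> s _; apply: cvg_near_cst; have := @cutoff_eventually R s.
  by apply: filterS => n ->; rewrite mulr1.
- exact: integrable_norm.
- move=> n s _ /=; rewrite lee_fin normrM ler_piMr//; exact: norm_cutoff_le1.
Qed.

Lemma qint_truncate_cvg (w : R -> R) F :
  qintegrable setT (fun s => w s *: F s) ->
  qint setT (fun s => w s *: truncate F n s) @[n --> \oo] -->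
  qint setT (fun s => w s *: F s).
Proof.
move=> [i1 i2 i3 i4].
have E (h : R -> R) : mu.-integrable setT (EFin \o (fun s => w s * h s)) ->
    \int[mu]_s (w s * (cutoff n s * h s)) @[n --> \oo] --> \int[mu]_s (w s * h s).
  move=> /Rintegral_cutoff_cvg; under eq_fun do
    under eq_Rintegral do rewrite -mulrA [_ * cutoff _ _]mulrC.
  by [].
apply/cvg_quatP; split.
- exact: (E (fun s => qre (F s)) i1).
- exact: (E (fun s => qi (F s)) i2).
- exact: (E (fun s => qj (F s)) i3).
- exact: (E (fun s => qk (F s)) i4).
Qed.

(** The transforms of the truncations of [F] tend to [G] in the conjugate space.
    As [k] is dominated by an exponential, the left side passes to the limit by
    [kernel_pairing]; the right side does by dominated convergence. *)
Lemma qmultiplication_formula_Lp p x I F G k (C : R) : 1 <= p -> 0 < x ->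
  qLp p%:E F -> is_qFT I p F G ->
  measurable_fun setT k -> (forall t, `|k t| <= expker x t) ->
  mu.-integrable setT (EFin \o cosT k) -> (forall s, `|cosT k s| <= C) ->
  mu.-integrable setT (EFin \o sinT k) -> (forall s, `|sinT k s| <= C) ->
  qintegrable setT (fun t => k t *: G t) /\
  qint setT (fun t => k t *: G t) =
  ftc *: (qint setT (fun s => cosT k s *: F s) -
          qmul I (qint setT (fun s => sinT k s *: F s))).
Proof.
move=> p1 x0 Fp [[mG Goo] FT] mk kx ick ck isk sk.
have ik : mu.-integrable setT (EFin \o k).
  apply: (le_integrableR _ mk _ (integrable_expker x0)) => // t _; exact: kx.
have [D D0 pairing] := kernel_pairing p1 x0.
have [ikG _] := pairing k G mk kx mG Goo.
split=> //.
have iT n : qintegrable setT (truncate F n).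
  exact/qLp1_qintegrable/(truncate_L1 p1 Fp n).
pose Gn n := qFT1 I (truncate F n).
have lim0 : qLnorm (hoelder_conjugate p%:E) (fun t => Gn n t - G t)
    @[n --> \oo] --> 0%E.
  apply: FT (truncate_cvg p1 Fp) => n; split; first exact: truncate_L1 p1 Fp n.
  exact: truncate_Lp.
have left_cvg : qint setT (fun t => k t *: Gn n t) @[n --> \oo] -->
    qint setT (fun t => k t *: G t).
  apply: cvg_qnorm.
  have /fine_cvgP[fin0 /(cvgMl_tmp (a := D))] := lim0; rewrite mulr0 => cvg0.
  apply: (squeeze_cvgr _ (cvg_cst 0) cvg0).
  apply: filterS fin0 => n fin_n; rewrite qnorm_ge0/=.
  have mB : qmeasurable (fun t => Gn n t - G t).
    by apply: qmeasurableB => //; exact: qmeasurable_qFT1.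
  have Noo : (qLnorm (hoelder_conjugate p%:E) (fun t => Gn n t - G t)%R < +oo)%E.
    by rewrite -ge0_fin_numE//; exact: Lnorm_ge0.
  have [ikB] := pairing k _ mk kx mB Noo.
  rewrite (_ : qint setT (fun t => k t *: (Gn n t - G t)) =
    qint setT (fun t => k t *: Gn n t) - qint setT (fun t => k t *: G t))//.
  apply/eqP; rewrite -subr_eq opprK; apply/eqP; rewrite -qintD//.
  by apply: eq_qint => t _; rewrite -scalerDr subrK.
have right_cvg : ftc *: (qint setT (fun s => cosT k s *: truncate F n s) -
    qmul I (qint setT (fun s => sinT k s *: truncate F n s))) @[n --> \oo] -->
    ftc *: (qint setT (fun s => cosT k s *: F s) -
          qmul I (qint setT (fun s => sinT k s *: F s))).
  apply: cvg_qZ; apply: cvg_qB.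
    exact/qint_truncate_cvg/(qintegrable_weight p1 Fp ick ck).
  apply: cvg_qmul; first exact: cvg_cst.
  exact/qint_truncate_cvg/(qintegrable_weight p1 Fp isk sk).
apply: (cvg_unique _ left_cvg); first exact: norm_hausdorff.
rewrite /= (_ : (fun n => qint setT (fun t => k t *: Gn n t)) =
  fun n => ftc *: (qint setT (fun s => cosT k s *: truncate F n s) -
    qmul I (qint setT (fun s => sinT k s *: truncate F n s)))); first exact.
by apply/funext => n; exact: qmultiplication_formula.
Qed.

End duality.

(** * Nontangential limits of Poisson integrals *)

Section poisson_kernel.
Context {R : realType}.
Local Notation mu := (@lebesgue_measure R).
Implicit Types (x y s u : R).

Lemma poisker_ge0 x u : 0 <= x -> 0 <= poisker x u.
Proof. by move=> x0; rewrite divr_ge0 ?mulr_ge0 ?addr_ge0 ?sqr_ge0. Qed.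

Lemma poiskerN x u : poisker x (- u) = poisker x u.
Proof. by rewrite /poisker sqrrN. Qed.

Lemma poisker_den_gt0 x u : 0 < x -> 0 < x ^+ 2 + u ^+ 2.
Proof. by move=> x0; rewrite ltr_wpDr ?sqr_ge0// exprn_gt0. Qed.

Lemma poisker_le x u : 0 < x -> poisker x u <= 2 / x.
Proof.
move=> x0; rewrite ler_pdivrMr ?poisker_den_gt0// mulrAC ler_pdivlMr//.
have := sqr_ge0 u; nra.
Qed.

Lemma continuous_poisker x : 0 < x -> continuous (poisker x).
Proof.
move=> x0 u; apply: cvgMl_tmp; apply: cvgV; first by rewrite gt_eqF// poisker_den_gt0.
by apply: cvgD; [exact: cvg_cst|exact: exprn_continuous].
Qed.

Lemma measurable_poisker x : 0 < x -> measurable_fun setT (poisker x).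
Proof.
by move=> x0; apply: continuous_measurable_fun; exact: continuous_poisker.
Qed.

Lemma integral_poisker x : 0 < x ->
  (\int[mu]_u (poisker x u)%:E = (2 * pi)%:E)%E.
Proof.
move=> x0; have cp := continuous_poisker x0.
rewrite ge0_symfun_integralT//; last 2 first.
- by move=> u; rewrite poisker_ge0// ltW.
- by move=> u /=; rewrite poiskerN.
rewrite -set_itvcy; pose E u := 2 * atan (x^-1 * u).
have dE u : is_derive u 1 E (poisker x u).
  rewrite /E; apply: is_derive_eq; rewrite /GRing.scale/= /poisker.
  by field; rewrite !gt_eqF ?poisker_den_gt0.
rewrite (@ge0_continuous_FTC2y _ _ E 0 pi)//.
- by rewrite -EFinB -EFinM /E mulr0 atan0; congr EFin; ring.
- by move=> u _; rewrite poisker_ge0// ltW.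
- exact: continuous_subspaceT.
- rewrite /E (_ : pi = 2 * (pi / 2)); last by field.
  apply: cvgMl_tmp; apply: (@cvg_comp _ _ _ (fun u => x^-1 * u) atan).
    by apply: gt0_cvgMry => //; rewrite invr_gt0.
  exact: cvgy_atan.
- apply: cvg_at_right_filter; apply: differentiable_continuous.
  by have ? := dE 0; exact/derivable1_diffP/ex_derive.
- by move=> u _; have ? := dE u; rewrite derive1E derive_val.
Qed.

Lemma integrable_poisker x y : 0 < x ->
  mu.-integrable setT (EFin \o (fun s => poisker x (y - s))).
Proof.
move=> x0; apply: (@integrable_reflect _ y (poisker x)); apply/integrableP.
split; first by apply/measurable_EFinP; exact: measurable_poisker.
apply: le_lt_trans (ltry (2 * pi)); rewrite -(integral_poisker x0).
rewrite le_eqVlt; apply/orP; left; apply/eqP; apply: eq_integral => u _ /=.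
by rewrite ger0_norm// poisker_ge0// ltW.
Qed.

Lemma Rintegral_poisker x y : 0 < x -> \int[mu]_s poisker x (y - s) = 2 * pi.
Proof.
move=> x0; rewrite (@Rintegral_reflect _ y (poisker x)).
  by rewrite /Rintegral integral_poisker.
exact: measurable_poisker.
Qed.

(** A Harnack inequality: the denominators of the two kernels are comparable,
    since [y - s] and [y0 - s] differ by at most [a x]. *)
Lemma poisker_cone a x y y0 s : 0 < x -> `|y - y0| <= a * x ->
  poisker x (y - s) <= (2 + 2 * a ^+ 2) * poisker x (y0 - s).
Proof.
move=> x0 yy0; rewrite mulrA ler_pdivrMr ?poisker_den_gt0// mulrAC.
rewrite ler_pdivlMr ?poisker_den_gt0//.
have : `|y - y0| ^+ 2 <= (a * x) ^+ 2.
  by rewrite ler_pXn2r ?nnegrE// (le_trans _ yy0).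
rewrite real_normK ?num_real// exprMn => h.
have key : x ^+ 2 + (y0 - s) ^+ 2 <=
    (2 + 2 * a ^+ 2) * (x ^+ 2 + (y - s) ^+ 2).
  have := sqr_ge0 (y - s + (y - y0)).
  have := mulr_ge0 (sqr_ge0 a) (sqr_ge0 (y - s)); have := sqr_ge0 x.
  lra.
rewrite [leRHS](_ : _ =
  2 * x * ((2 + 2 * a ^+ 2) * (x ^+ 2 + (y - s) ^+ 2))); last by ring.
by rewrite ler_wpM2l// mulr_ge0// ltW.
Qed.

Lemma integral_le_bounded_mul (D : set R) (p g : R -> R) (c : R) :
  measurable D -> measurable_fun setT p -> measurable_fun setT g ->
  0 <= c -> (forall s, 0 <= p s) -> (forall s, 0 <= g s) ->
  (forall s, D s -> p s <= c) ->
  (\int[mu]_(s in D) (p s * g s)%:E <= c%:E * \int[mu]_(s in D) (g s)%:E)%E.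
Proof.
move=> mD mp mg c0 p0 g0 pc; rewrite -ge0_integralZl_EFin//; last 2 first.
- by move=> s _; rewrite lee_fin.
- by apply: measurable_funTS; exact/measurable_EFinP.
apply: ge0_le_integral => //.
- by move=> s _; rewrite lee_fin mulr_ge0.
- by apply: measurable_funTS; apply/measurable_EFinP; exact: measurable_funM.
- apply: emeasurable_funM => //.
  by apply: measurable_funTS; exact/measurable_EFinP.
- by move=> s Ds; rewrite -EFinM lee_fin ler_wpM2r// pc.
Qed.

(** The ball of radius 2^N x is split into dyadic shells; on the shell of
    radius 2^j x the kernel is at most 2 / (4^j x), so that the shells
    contribute a geometric series. *)
Lemma poisson_ball (g : R -> R) (y0 d e x : R) :
  measurable_fun setT g -> (forall s, 0 <= g s) -> 0 < x -> 0 <= e ->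
  (forall r, 0 < r -> r < d ->
    (\int[mu]_(s in ball y0 r) (g s)%:E <= (e * (2 * r))%:E)%E) ->
  forall N : nat, 2 ^+ N * x < d ->
  (\int[mu]_(s in ball y0 (2 ^+ N * x)) (poisker x (y0 - s) * g s)%:E <=
   ((20 - 16 / 2 ^+ N) * e)%:E)%E.
Proof.
move=> mg g0 x0 e0 avg.
have mp : measurable_fun setT (fun s => poisker x (y0 - s)).
  by move/measurable_int: (integrable_poisker y0 x0) => /measurable_EFinP.
have p0 s : 0 <= poisker x (y0 - s) by rewrite poisker_ge0// ltW.
elim=> [|N IH] Nd.
  rewrite expr0 mul1r in Nd *; apply: le_trans (_ : (2 / x)%:E * _ <= _)%E.
    apply: (integral_le_bounded_mul _ mp mg _ p0 g0) => //.
    - exact: measurable_ball.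
    - by rewrite divr_ge0// ltW.
    - by move=> s _; exact: poisker_le.
  apply: le_trans (_ : (2 / x)%:E * (e * (2 * x))%:E <= _)%E.
    by rewrite lee_wpmul2l ?lee_fin ?divr_ge0 ?(ltW x0)//; exact: avg.
  rewrite -EFinM lee_fin le_eqVlt; apply/orP; left; apply/eqP.
  by field; rewrite gt_eqF.
have P0 : 0 < 2 ^+ N :> R by rewrite exprn_gt0.
have r0 : 0 < 2 ^+ N * x by rewrite mulr_gt0.
have rS : 2 ^+ N.+1 * x = 2 * (2 ^+ N * x) by rewrite exprS mulrA.
have Nd' : 2 ^+ N * x < d.
  by apply: lt_trans Nd; rewrite rS; lra.
pose B : set R := ball y0 (2 ^+ N * x).
pose B' : set R := ball y0 (2 ^+ N.+1 * x).
have BB' : B `<=` B' by apply: le_ball; rewrite rS; lra.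
have mB : measurable B by exact: measurable_ball.
have mB' : measurable B' by exact: measurable_ball.
have mpg : measurable_fun setT (fun s => (poisker x (y0 - s) * g s)%:E).
  by apply/measurable_EFinP; exact: measurable_funM.
rewrite (_ : ball y0 (2 ^+ N.+1 * x) = B `|` (B' `\` B)); last by rewrite setDUK.
rewrite ge0_integral_setU//=; last 4 first.
- exact: measurableD.
- exact: measurable_funTS.
- by move=> s _; rewrite lee_fin mulr_ge0.
- by apply/disj_setPS => s [? []].
have c0 : 0 <= 2 / (x * (2 ^+ N) ^+ 2) by rewrite divr_ge0// mulr_ge0 ?sqr_ge0 ?ltW.
have shell : (\int[mu]_(s in B' `\` B) (poisker x (y0 - s) * g s)%:E <=
    (8 / 2 ^+ N * e)%:E)%E.
  apply: le_trans (_ : (2 / (x * (2 ^+ N) ^+ 2))%:E *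
      \int[mu]_(s in B' `\` B) (g s)%:E <= _)%E.
    apply: (integral_le_bounded_mul _ mp mg _ p0 g0) => //.
    - exact: measurableD.
    - move=> s [_]; rewrite /B /ball /= => /negP; rewrite -leNgt => h.
      have h2 : (2 ^+ N * x) ^+ 2 <= (y0 - s) ^+ 2.
        by rewrite -[leRHS]real_normK ?num_real// ler_pXn2r// nnegrE ltW.
      rewrite ler_pdivrMr ?poisker_den_gt0// mulrAC.
      rewrite ler_pdivlMr; last by rewrite mulr_gt0// exprn_gt0.
      rewrite exprMn in h2.
      have := sqr_ge0 x; have := ltW x0; nra.
  apply: le_trans (_ : (2 / (x * (2 ^+ N) ^+ 2))%:E *
      (e * (2 * (2 ^+ N.+1 * x)))%:E <= _)%E.
    rewrite lee_wpmul2l ?lee_fin//; apply: le_trans (avg _ _ Nd); last first.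
      by rewrite rS mulr_gt0.
    apply: ge0_subset_integral => //.
    - exact: measurableD.
    - by apply: measurable_funTS; exact/measurable_EFinP.
    - by move=> s _; rewrite lee_fin.
  rewrite -EFinM lee_fin le_eqVlt; apply/orP; left; apply/eqP.
  by rewrite rS; field; rewrite !gt_eqF.
apply: le_trans (leeD (IH Nd') shell) _.
rewrite -EFinD lee_fin le_eqVlt; apply/orP; left; apply/eqP.
by rewrite exprS; field; rewrite gt_eqF.
Qed.

Lemma dyadic_scale (x d : R) : 0 < x -> x < d ->
  exists N : nat, 2 ^+ N * x < d <= 2 ^+ N.+1 * x.
Proof.
move=> x0 xd.
have ex : exists N : nat, d <= 2 ^+ N * x.
  exists (Num.bound (d / x)); rewrite -ler_pdivrMr//.
  apply: le_trans (ltW (archi_boundP _)) _; first by rewrite divr_ge0 ?ltW// (lt_trans x0).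
  by rewrite -natrX ler_nat ltnW// ltn_expl.
case: (ex_minnP ex) => -[|N] dN minN.
  by move: dN; rewrite expr0 mul1r leNgt xd.
exists N; rewrite dN andbT ltNge; apply/negP => /minN.
by rewrite ltnn.
Qed.

Lemma lebesgue_ptP (h : R -> R) (y0 e : R) : lebesgue_pt h y0 -> 0 < e ->
  exists2 d : R, 0 < d & forall r, 0 < r -> r < d ->
  (\int[mu]_(s in ball y0 r) (`|h s - h y0|)%:E <= (e * (2 * r))%:E)%E.
Proof.
move=> /fine_cvgP[fin /cvgrPdist_lt lim] e0.
have /= := lim _ e0.
case=> d1 /= d10 h1; case: fin => d2 /= d20 h2.
exists (Num.min d1 d2) => [|r r0]; first by rewrite lt_min d10.
rewrite lt_min => /andP[rd1 rd2].
have br (d : R) : r < d -> ball_ Num.norm 0 d r.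
  by move=> rd; rewrite /ball_/= sub0r normrN gtr0_norm.
have {}h1 := h1 _ (br _ rd1) r0; have {}h2 := h2 _ (br _ rd2) r0.
have := h1; rewrite sub0r normrN ger0_norm; last by rewrite fine_ge0 ?davg_ge0.
rewrite -lte_fin fineK// => /ltW.
rewrite /davg /iavg (lebesgue_measure_ball _ (ltW r0)) inver mulrn_eq0/= gt_eqF//.
rewrite lee_pdivrMl ?mulrn_wgt0// -EFinM.
by rewrite (_ : r *+ 2 * e = e * (2 * r)); last by ring.
Qed.

(** By [poisker_cone] it suffices to bound the integral of [|h - h y0|] against
    the kernel centred at [y0].  Over a ball on which [y0] is a good Lebesgue
    point, [poisson_ball] applies; outside it the kernel is at most a multiple
    of [x] times the kernel of parameter 1, so that the rest tends to 0 with
    [x]. *)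
Lemma poisson_nontangential (h : R -> R) (y0 a e : R) :
  measurable_fun setT h ->
  (forall x y, 0 < x ->
    mu.-integrable setT (EFin \o (fun s => poisker x (y - s) * h s))) ->
  lebesgue_pt h y0 -> 0 < e ->
  exists2 d : R, 0 < d & forall x y, 0 < x -> x < d -> `|y - y0| <= a * x ->
    `|\int[mu]_s (poisker x (y - s) * h s) - 2 * pi * h y0| <= e.
Proof.
move=> mh ih leb e0.
pose K := 2 + 2 * a ^+ 2.
have K0 : 0 < K by rewrite ltr_pwDl// mulr_ge0 ?sqr_ge0.
(* The ball contributes 20 e1, its complement e1, the cone a factor K. *)
pose e1 := e / (21 * K).
have e10 : 0 < e1 by rewrite divr_gt0// mulr_gt0.
have [d d0 avg] := lebesgue_ptP leb e10.
pose g s := `|h s - h y0|.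
have g0 s : 0 <= g s by exact: normr_ge0.
have mg : measurable_fun setT g.
  by apply: measurableT_comp => //; exact: measurable_funB.
have ip x y : 0 < x ->
    mu.-integrable setT (EFin \o (fun s => poisker x (y - s) * (h s - h y0))).
  move=> x0; apply: eq_integrableR (integrableRB measurableT (ih x y x0)
    (integrableRZ (h y0) measurableT (integrable_poisker y x0))) => // s _.
  by rewrite mulrBr; congr (_ - _); rewrite mulrC.
have ipg x y : 0 < x ->
    mu.-integrable setT (EFin \o (fun s => poisker x (y - s) * g s)).
  move=> x0; apply: eq_integrableR (integrable_norm (ip x y x0)) => // s _ /=.
  by rewrite normrM ger0_norm ?poisker_ge0 ?(ltW x0).
(* Outside the ball, |y0 - s| >= d / 2 and the kernel of parameter x is at most
   x c times the kernel of parameter 1. *)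
pose M := \int[mu]_s (poisker 1 (y0 - s) * g s).
have M0 : 0 <= M by apply: Rintegral_ge0 => s _; rewrite mulr_ge0// poisker_ge0.
pose c := 1 + (d / 2) ^- 2.
have c0 : 0 < c by rewrite ltr_pwDl// invr_ge0 sqr_ge0.
exists (Num.min d (e1 / (c * (M + 1)))) => [|x y x0].
  by rewrite lt_min d0 divr_gt0// mulr_gt0// ltr_wpDl.
rewrite lt_min => /andP[xd xe] yy0.
have mp : measurable_fun setT (fun s => poisker x (y0 - s)).
  by move/measurable_int: (integrable_poisker y0 x0) => /measurable_EFinP.
have mpg : measurable_fun setT (fun s => (poisker x (y0 - s) * g s)%:E).
  by apply/measurable_EFinP; exact: measurable_funM.
have pg0 s : (0 <= (poisker x (y0 - s) * g s)%:E)%E.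
  by rewrite lee_fin mulr_ge0// poisker_ge0// ltW.
have mp1g : measurable_fun setT
    (fun s => ((x * c) * (poisker 1 (y0 - s) * g s))%:E).
  apply/measurable_EFinP; apply: measurable_funM => //.
  by move/measurable_int: (ipg 1 y0 ltr01) => /measurable_EFinP.
have p1g0 s : (0 <= (poisker 1 (y0 - s) * g s)%:E)%E.
  by rewrite lee_fin mulr_ge0// poisker_ge0.
have total : (\int[mu]_s (poisker x (y0 - s) * g s)%:E <= (21 * e1)%:E)%E.
  have [N /andP[Nd dN]] := dyadic_scale x0 xd.
  pose B : set R := ball y0 (2 ^+ N * x).
  have mB : measurable B by exact: measurable_ball.
  rewrite -(setUv B) ge0_integral_setU//; last 3 first.
  - exact: measurableC.
  - by rewrite setUv.
  - exact/disj_setPCl.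
  have near_B := poisson_ball mg g0 x0 (ltW e10) avg Nd.
  have far_B : (\int[mu]_(s in ~` B) (poisker x (y0 - s) * g s)%:E <= e1%:E)%E.
    apply: (@le_trans _ _ (\int[mu]_s ((x * c) * (poisker 1 (y0 - s) * g s))%:E)%E).
      apply: (@le_trans _ _ (\int[mu]_(s in ~` B)
          ((x * c) * (poisker 1 (y0 - s) * g s))%:E)%E).
        apply: ge0_le_integral => //.
        - exact: measurableC.
        - exact: measurable_funTS.
        - exact: measurable_funTS.
        - move=> s; rewrite /B /ball /= => /negP; rewrite -leNgt => Bs.
          rewrite lee_fin mulrA ler_wpM2r//.
          have du : d / 2 <= `|y0 - s|.
            by apply: le_trans Bs; rewrite ler_pdivrMr// mulrC mulrA -exprS.
          have du2 : 1 <= (d / 2) ^- 2 * (y0 - s) ^+ 2.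
            rewrite mulrC ler_pdivlMr ?exprn_gt0 ?divr_gt0// mul1r.
            rewrite -[leRHS]real_normK ?num_real//.
            by rewrite ler_pXn2r ?nnegrE// divr_ge0// ltW.
          rewrite ler_pdivrMr ?poisker_den_gt0// /poisker expr1n mulr1.
          rewrite [leRHS](_ : _ = (2 * x) * ((c * (x ^+ 2 + (y0 - s) ^+ 2)) /
            (1 + (y0 - s) ^+ 2))); last first.
            by field; rewrite gt_eqF// ltr_pwDl// sqr_ge0.
          rewrite ler_peMr ?mulr_ge0 ?(ltW x0)//.
          rewrite ler_pdivlMr; last by rewrite ltr_pwDl// sqr_ge0.
          rewrite mul1r /c.
          have := sqr_ge0 x; have : 0 <= (d / 2) ^- 2 * x ^+ 2.
            by rewrite mulr_ge0 ?sqr_ge0// invr_ge0 sqr_ge0.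
          nra.
      apply: ge0_subset_integral => //; first exact: measurableC.
      move=> s _; rewrite EFinM mule_ge0// lee_fin mulr_ge0// ltW//.
    under eq_integral do rewrite EFinM.
    rewrite ge0_integralZl_EFin//; last 2 first.
    - exact: (measurable_int _ (ipg 1 y0 ltr01)).
    - by rewrite mulr_ge0// ltW.
    rewrite (_ : (\int[mu]_s (poisker 1 (y0 - s) * g s)%:E)%E = M%:E); last first.
      by rewrite /M /Rintegral fineK//; apply: integrable_fin_num => //; exact: ipg.
    rewrite -EFinM lee_fin -mulrA.
    apply: le_trans (_ : e1 / (c * (M + 1)) * (c * M) <= _).
      by rewrite ler_wpM2r ?(ltW xe)// mulr_ge0// ltW.
    rewrite mulrAC ler_pdivrMr; last by rewrite mulr_gt0// ltr_wpDl.
    by rewrite ler_wpM2l ?(ltW e10)// ler_wpM2l ?(ltW c0)// lerDl.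
  apply: le_trans (leeD near_B far_B) _; rewrite -EFinD lee_fin.
  have : 0 <= 16 / 2 ^+ N :> R by rewrite divr_ge0// exprn_ge0.
  nra.
rewrite (_ : _ - _ = \int[mu]_s (poisker x (y - s) * (h s - h y0))); last first.
  rewrite -(Rintegral_poisker y x0) [_ * h y0]mulrC -RintegralZl//; last first.
    exact: integrable_poisker.
  rewrite -RintegralB//; last 2 first.
  - exact: ih.
  - exact/integrableRZ/integrable_poisker.
  by apply: eq_Rintegral => s _; rewrite mulrBr [h y0 * _]mulrC.
apply: le_trans (le_normr_Rintegral measurableT (ip x y x0)) _.
apply: (@le_trans _ _ (\int[mu]_s (K * (poisker x (y0 - s) * g s)))).
  apply: le_Rintegral => //.
  - exact: integrable_norm (ip x y x0).
  - exact/integrableRZ/ipg.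
  - move=> s _; rewrite normrM ger0_norm ?poisker_ge0 ?(ltW x0)// mulrA.
    by rewrite ler_wpM2r// poisker_cone.
rewrite RintegralZl//; last exact: ipg.
rewrite (_ : e = K * (21 * e1)); last by rewrite /e1; field; rewrite gt_eqF.
rewrite ler_wpM2l ?(ltW K0)// -lee_fin /Rintegral fineK//.
by apply: integrable_fin_num => //; exact: ipg.
Qed.

End poisson_kernel.

(** * Functions with spectrum in a half-line *)

Section half_line_spectrum.
Context {R : realType}.
Local Notation mu := (@lebesgue_measure R).
Implicit Types (F G : R -> quat R) (x y p : R) (I : quat R).

(** The complement of the support is open, hence a countable union of rational
    intervals on each of which G vanishes almost everywhere. *)
Lemma esupp_ae0 G : esupp G `<=` [set t : R | t <= 0] ->
  {ae mu, forall t, 0 < t -> G t = 0}.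
Proof.
move=> supp.
pose N (ab : rat * rat) :=
  [set s : R | (ratr ab.1 < s < ratr ab.2)%R /\ G s <> 0].
pose V n := if unpickle n is Some ab
  then [set s | mu.-negligible (N ab) /\ N ab s] else set0.
have negV n : mu.-negligible (V n).
  rewrite /V; case: unpickle => [ab|]; last exact: negligible_set0.
  have [h|h] := pselect (mu.-negligible (N ab)).
    by apply: negligibleS h => s [].
  by apply: negligibleS (@negligible_set0 _ _ _ mu) => s [].
apply: negligibleS (negligible_bigcup negV) => t /= /not_implyP[t0 Gt].
have : ~ esupp G t by move=> /supp /=; rewrite leNgt t0.
move=> /existsNP[U /not_implyP[oU /not_implyP[Ut /contrapT aeU]]].
have [e /= e0 eU] : nbhs_ball t U by rewrite nbhs_ballE; exact: open_nbhs_nbhs.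
have [a /andP[a1 a2]] : exists a : rat, t - e < ratr a < t.
  by apply: rat_in_itvoo; rewrite ltrBlDr ltrDl.
have [b /andP[b1 b2]] : exists b : rat, t < ratr b < t + e.
  by apply: rat_in_itvoo; rewrite ltrDl.
have := pickleK (a, b); move: (pickle (a, b)) => n hn.
exists n; [exact: Logic.I|rewrite /V hn].
split; last by split=> //=; rewrite a2 b1.
apply: negligibleS aeU => s /= [/andP[as_ sb] Gs] /(_ _)/Gs; apply.
apply: eU; rewrite /ball/= ltr_norml; apply/andP; split; lra.
Qed.

Lemma qint_eq0 (D : set R) F : (forall s, D s -> F s = 0) -> qint D F = 0.
Proof.
move=> F0; rewrite (@eq_qint _ D F (fun=> 0)) //.
by apply: quatP; rewrite /qint /Rintegral ?quatE/= ?quatE integral0.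
Qed.

Lemma qint_restrict_half_line F : qintegrable setT F ->
  {ae mu, forall t, 0 < t -> F t = 0} ->
  qint setT F = qint [set t | t <= 0] F.
Proof.
move=> [i1 i2 i3 i4] F0.
have mD : measurable [set t : R | t <= 0] by rewrite -set_itvNyc.
have key (h : R -> R) : mu.-integrable setT (EFin \o h) ->
    {ae mu, forall t, 0 < t -> h t = 0} ->
    \int[mu]_t h t = \int[mu]_(t in [set t | t <= 0]) h t.
  move=> ih h0; rewrite [RHS]Rintegral_mkcond /Rintegral; congr fine.
  have mh := measurable_int _ ih.
  apply: ae_eq_integral => //.
  - apply/measurable_EFinP.
    apply/(measurable_restrictT _ _).1 => //.
    by apply: measurable_funTS; exact/measurable_EFinP.
  - move: h0; apply: (@filterS _ _ (ae_filter_ringOfSetsType mu)) => t ht _ /=.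
    rewrite patchE; case: ifPn => // /negP.
    by rewrite inE/= => /negP; rewrite -ltNge => /ht ->.
apply: quatP; apply: key => //;
  by move: F0; apply: (@filterS _ _ (ae_filter_ringOfSetsType mu)) => t Ft /Ft ->.
Qed.

(** The coefficients of [1] and [J] in the Laplace integral at [x + J y]. *)
Definition lapC G x y :=
  ftc *: qint [set t | t <= 0] (fun t => (expR (x * t) * cos (y * t)) *: G t).
Definition lapS G x y :=
  ftc *: qint [set t | t <= 0] (fun t => (expR (x * t) * sin (y * t)) *: G t).

Definition poissonQ F x y :=
  (2 * pi)^-1 *: qint setT (fun s => poisker x (y - s) *: F s).

Variables (p : R) (I : quat R) (F G : R -> quat R).
Hypotheses (p1 : 1 <= p) (Fp : qLp p%:E F) (FG : is_qFT I p F G)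
  (supp : esupp G `<=` [set t : R | t <= 0]).

Lemma norm_poisker_le x u : 0 < x -> `|poisker x u| <= 2 / x.
Proof. by move=> x0; rewrite ger0_norm ?poisker_le// poisker_ge0// ltW. Qed.

Lemma qintegrable_poisker x y : 0 < x ->
  qintegrable setT (fun s => poisker x (y - s) *: F s).
Proof.
move=> x0; apply: (qintegrable_weight p1 Fp (integrable_poisker y x0)) => s.
exact: norm_poisker_le.
Qed.

Lemma ftcM : ftc * ftc = (2 * pi)^-1 :> R.
Proof.
by rewrite /ftc -invfM -expr2 sqr_sqrtr// mulr_ge0// ltW// pi_gt0.
Qed.

Let poiskerD x y s : poisker x (y + s) = poisker x (- y - s).
Proof. by rewrite -poiskerN opprD. Qed.

(** For [t <= 0] the kernel [cosker x y] is the one of [lapC]; for [t > 0] it meets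
    the zeros of [G].  Its sine transform vanishes by parity and its cosine
    transform is the Poisson kernel made even in [y]. *)
Lemma lapC_poisson x y : 0 < x ->
  qintegrable [set t | t <= 0] (fun t => (expR (x * t) * cos (y * t)) *: G t) /\
  lapC G x y = 2^-1 *: (poissonQ F x y + poissonQ F x (- y)).
Proof.
move=> x0.
have cE : cosT (cosker x y) =
    (fun s => 2^-1 * (poisker x (y - s) + poisker x (- y - s))).
  by apply/funext => s; rewrite cosT_cosker// (poiskerD x y s).
have sE : sinT (cosker x y) = (fun=> 0).
  by apply/funext => s; rewrite sinT_cosker.
have [||||||iG qG] :=
    @qmultiplication_formula_Lp _ p x I F G (cosker x y) (2 / x) p1 x0 Fp FG.
- by apply: measurable_funM; [exact: measurable_expker|exact: measurable_cosM].
- move=> t; rewrite normrM ger0_norm ?expker_ge0// ler_piMr ?expker_ge0//.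
  exact: cos_max.
- rewrite cE; apply: integrableRZ => //; apply: integrableRD => //;
    exact: integrable_poisker.
- move=> s; rewrite cE normrM ger0_norm//.
  have := norm_poisker_le (y - s) x0; have := norm_poisker_le (- y - s) x0.
  by have := ler_normD (poisker x (y - s)) (poisker x (- y - s)); lra.
- by rewrite sE; exact: integrable0.
- by move=> s; rewrite sE normr0 divr_ge0// ltW.
have mD : measurable [set t : R | t <= 0] by rewrite -set_itvNyc.
have half t : [set t | t <= 0] t ->
    cosker x y t *: G t = (expR (x * t) * cos (y * t)) *: G t.
  by move=> t0; rewrite /cosker /expker ler0_norm// mulrN opprK.
split.
  case: iG => i1 i2 i3 i4; apply: (eq_qintegrable mD half).
  split; [apply: integrableS i1|apply: integrableS i2|apply: integrableS i3|
    apply: integrableS i4] => //; exact: mD.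
rewrite /lapC -(eq_qint half) -qint_restrict_half_line//; last first.
  move: (esupp_ae0 supp).
  apply: (@filterS _ _ (ae_filter_ringOfSetsType mu)) => t Gt /Gt ->.
  by rewrite scaler0.
rewrite qG scalerA ftcM [X in _ - qmul I X]qint_eq0; last first.
  by move=> s _; rewrite sE scale0r.
rewrite (_ : qmul I 0 = 0) ?subr0; last by quat_ring.
rewrite /poissonQ -scalerDr -qintD//; try exact: qintegrable_poisker.
rewrite [RHS]scalerA [2^-1 * _]mulrC -[RHS]scalerA; congr (_ *: _).
rewrite -qintZ//; last first.
  by apply: qintegrableD => //; exact: qintegrable_poisker.
by apply: eq_qint => s _; rewrite cE -scalerA -scalerDl.
Qed.

Lemma lapS_poisson x y : 0 < x ->
  qintegrable [set t | t <= 0] (fun t => (expR (x * t) * sin (y * t)) *: G t) /\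
  lapS G x y = - (2^-1 *: qmul I (poissonQ F x y - poissonQ F x (- y))).
Proof.
move=> x0.
have cE : sinT (sinker x y) =
    (fun s => 2^-1 * (poisker x (y - s) - poisker x (- y - s))).
  by apply/funext => s; rewrite sinT_sinker// (poiskerD x y s).
have sE : cosT (sinker x y) = (fun=> 0).
  by apply/funext => s; rewrite cosT_sinker.
have [||||||iG qG] :=
    @qmultiplication_formula_Lp _ p x I F G (sinker x y) (2 / x) p1 x0 Fp FG.
- by apply: measurable_funM; [exact: measurable_expker|exact: measurable_sinM].
- move=> t; rewrite normrM ger0_norm ?expker_ge0// ler_piMr ?expker_ge0//.
  exact: sin_max.
- by rewrite sE; exact: integrable0.
- by move=> s; rewrite sE normr0 divr_ge0// ltW.
- rewrite cE; apply: integrableRZ => //; apply: integrableRB => //;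
    exact: integrable_poisker.
- move=> s; rewrite cE normrM ger0_norm//.
  have := norm_poisker_le (y - s) x0; have := norm_poisker_le (- y - s) x0.
  by have := ler_normB (poisker x (y - s)) (poisker x (- y - s)); lra.
have mD : measurable [set t : R | t <= 0] by rewrite -set_itvNyc.
have half t : [set t | t <= 0] t ->
    sinker x y t *: G t = (expR (x * t) * sin (y * t)) *: G t.
  by move=> t0; rewrite /sinker /expker ler0_norm// mulrN opprK.
split.
  case: iG => i1 i2 i3 i4; apply: (eq_qintegrable mD half).
  split; [apply: integrableS i1|apply: integrableS i2|apply: integrableS i3|
    apply: integrableS i4] => //; exact: mD.
rewrite /lapS -(eq_qint half) -qint_restrict_half_line//; last first.
  move: (esupp_ae0 supp).
  apply: (@filterS _ _ (ae_filter_ringOfSetsType mu)) => t Gt /Gt ->.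
  by rewrite scaler0.
rewrite qG scalerA ftcM qint_eq0; last by move=> s _; rewrite sE scale0r.
rewrite sub0r scalerN /poissonQ -scalerBr qmulZr; congr (- _).
rewrite [RHS]scalerA [2^-1 * _]mulrC -[RHS]scalerA; congr (_ *: _); rewrite -qmulZr; congr (qmul _ _).
have iP y' := qintegrable_poisker y' x0.
rewrite -[X in _ - X]scale1r -scaleNr -qintZ// -qintD//; last exact: qintegrableZ.
rewrite -qintZ//; last by apply: qintegrableD => //; exact: qintegrableZ.
apply: eq_qint => s _; rewrite cE -scalerA scaleN1r; congr (_ *: _).
by rewrite scalerBl.
Qed.

End half_line_spectrum.

(** * Taylor remainders of the complex exponential *)

Section quadratic_estimates.
Context {R : realType}.
Implicit Types (a b z : R).

(** The mean value inequality on the segment from 0 to [a], in the symmetric form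
    that lets the following bounds be obtained from one another by
    integration. *)
Lemma mvt_bound (f f' : R -> R) (M a : R) :
  (forall z, is_derive z 1 f (f' z)) -> (forall z, `|z| <= `|a| -> `|f' z| <= M) ->
  f 0 = 0 -> `|f a| <= M * `|a|.
Proof.
move=> df f'M f0.
have cf : continuous f.
  move=> z; apply: differentiable_continuous; apply/derivable1_diffP.
  by have ? := df z; exact: ex_derive.
have [a0|a0] := leP 0 a.
  have [c cI] := MVT_segment a0 (fun z _ => df z) (continuous_subspaceT cf).
  rewrite f0 !subr0 => ->; rewrite normrM ler_wpM2r// f'M//.
  by move: cI; rewrite in_itv/= => /andP[c0 ca]; rewrite !ger0_norm// (le_trans c0).
have [c cI] := MVT_segment (ltW a0) (fun z _ => df z) (continuous_subspaceT cf).
rewrite f0 !sub0r => /eqP; rewrite eqr_oppLR => /eqP ->.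
rewrite mulrN opprK normrM ler_wpM2r// f'M//.
move: cI; rewrite in_itv/= => /andP[ac c0].
by rewrite !ler0_norm ?lerN2// ltW.
Qed.

Lemma norm_sin_le b : `|sin b| <= `|b|.
Proof.
rewrite -[leRHS]mul1r; apply: (@mvt_bound sin cos); last exact: sin0.
by move=> z _; exact: cos_max.
Qed.

Lemma norm_cosB1_le (b M : R) : (forall z, `|z| <= `|b| -> `|sin z| <= M) ->
  `|cos b - 1| <= M * `|b|.
Proof.
move=> sM; apply: (@mvt_bound (fun z => cos z - 1) (fun z => - sin z)).
- by move=> z; apply: is_derive_eq; rewrite subr0.
- by move=> z /sM; rewrite normrN.
- by rewrite cos0 subrr.
Qed.

Lemma norm_sinB_le b : `|sin b - b| <= b ^+ 2.
Proof.
rewrite -real_normK ?num_real// expr2.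
apply: (@mvt_bound (fun z => sin z - z) (fun z => cos z - 1)).
- move=> z zb; apply: le_trans zb; rewrite -[leRHS]mul1r.
  by apply: norm_cosB1_le => ? _; exact: sin_max.
- by rewrite sin0 subrr.
Qed.

Lemma norm_cosB1_sqr b : `|cos b - 1| <= b ^+ 2.
Proof.
rewrite -real_normK ?num_real// expr2; apply: norm_cosB1_le => z zb.
by apply: le_trans zb; exact: norm_sin_le.
Qed.

Lemma norm_expRB1_le a : `|expR a - 1| <= expR `|a| * `|a|.
Proof.
apply: (@mvt_bound (fun z => expR z - 1) expR).
- by move=> z; apply: is_derive_eq; rewrite subr0.
- move=> z za; rewrite ger0_norm ?expR_ge0// ler_expR.
  by apply: le_trans za; exact: ler_norm.
- by rewrite expR0 subrr.
Qed.

Lemma norm_expRB_le a : `|expR a - 1 - a| <= expR `|a| * a ^+ 2.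
Proof.
rewrite -(real_normK (num_real a)) expr2 mulrA.
apply: (@mvt_bound (fun z => expR z - 1 - z) (fun z => expR z - 1)).
- by move=> z; apply: is_derive_eq; rewrite subr0.
- move=> z za; apply: le_trans (norm_expRB1_le z) _.
  by rewrite ler_pM ?expR_ge0// ler_expR.
- by rewrite expR0 subrr subr0.
Qed.

Lemma expR_cos_quad a b :
  `|expR a * cos b - 1 - a| <= (a ^+ 2 + b ^+ 2) * expR `|a|.
Proof.
have -> : expR a * cos b - 1 - a = (expR a - 1 - a) + expR a * (cos b - 1) by ring.
apply: le_trans (ler_normD _ _) _; rewrite mulrDl lerD//.
  by rewrite mulrC norm_expRB_le.
rewrite normrM mulrC ler_pM// ?norm_cosB1_sqr// ger0_norm ?expR_ge0//.
by rewrite ler_expR ler_norm.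
Qed.

Lemma expR_sin_quad a b :
  `|expR a * sin b - b| <= 2 * (a ^+ 2 + b ^+ 2) * expR `|a|.
Proof.
have -> : expR a * sin b - b = expR a * (sin b - b) + (expR a - 1) * b by ring.
apply: le_trans (ler_normD _ _) _; rewrite !normrM.
have h1 : `|expR a| * `|sin b - b| <= expR `|a| * b ^+ 2.
  rewrite ler_pM// ?norm_sinB_le// ger0_norm ?expR_ge0//.
  by rewrite ler_expR ler_norm.
have h2 : `|expR a - 1| * `|b| <= expR `|a| * (`|a| * `|b|).
  by rewrite mulrA ler_wpM2r// norm_expRB1_le.
apply: le_trans (lerD h1 h2) _; rewrite -mulrDr mulrC ler_wpM2r ?expR_ge0//.
rewrite -(real_normK (num_real a)) -(real_normK (num_real b)).
have := sqr_ge0 (`|a| - `|b|); have := sqr_ge0 `|a|; nra.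
Qed.

End quadratic_estimates.

(** * Differentiation of Laplace integrals *)

Section laplace_expansion.
Context {R : realType}.
Local Notation mu := (@lebesgue_measure R).
Local Notation D := [set t : R | t <= 0].
Implicit Types (g : R -> R) (x y h k t : R).

Let mD : measurable D. Proof. by rewrite -set_itvNyc. Qed.

Definition laplaceable g := forall x, 0 < x ->
  mu.-integrable D (EFin \o (fun t => expR (x * t) * g t)).

Definition lapcos x y t := expR (x * t) * cos (y * t).
Definition lapsin x y t := expR (x * t) * sin (y * t).

Lemma measurable_expRM x : measurable_fun setT (fun t => expR (x * t)).
Proof.
apply: continuous_measurable_fun => t.
apply: (@continuous_comp _ _ _ (fun t => x * t)); first exact: mulrl_continuous.
exact: continuous_expR.
Qed.

(** Half of the exponential absorbs the factor [t]. *)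
Lemma laplaceable_mul g : laplaceable g -> laplaceable (fun t => t * g t).
Proof.
move=> Lg x x0; have x20 : 0 < x / 2 by rewrite divr_gt0.
apply: eq_integrableR (integrable_bddMl (f := fun t => expR (x / 2 * t) * t)
  (C := 2 / x) mD _ _ (Lg _ x20)) => //.
- by move=> t _; rewrite [in RHS](splitr x) [in RHS]mulrDl expRD; ring.
- by apply: measurable_funTS; apply: measurable_funM => //; exact: measurable_expRM.
- move=> t /= t0; rewrite normrM ger0_norm ?expR_ge0//.
  have /= := expR_ge1Dx (x / 2 * `|t|).
  rewrite (_ : x / 2 * t = - (x / 2 * `|t|)); last by rewrite ler0_norm// mulrN opprK.
  rewrite expRN [_^-1 * _]mulrC ler_pdivrMr ?expR_gt0// => h.
  rewrite [leLHS](_ : _ = 2 / x * (x / 2 * `|t|)); last by field; rewrite gt_eqF.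
  by rewrite ler_wpM2l ?divr_ge0 ?(ltW x0)// (le_trans _ h)// lerDr.
Qed.

Lemma integrable_lapcos g x y : laplaceable g -> 0 < x ->
  mu.-integrable D (EFin \o (fun t => lapcos x y t * g t)).
Proof.
move=> Lg x0; have mc : measurable_fun D (fun t => cos (y * t)).
  by apply: measurable_funTS; exact: measurable_cosM.
apply: eq_integrableR (integrable_bddMl mD mc (fun t _ => cos_max (y * t))
  (Lg x x0)) => // t _; rewrite /lapcos; ring.
Qed.

Lemma integrable_lapsin g x y : laplaceable g -> 0 < x ->
  mu.-integrable D (EFin \o (fun t => lapsin x y t * g t)).
Proof.
move=> Lg x0; have mc : measurable_fun D (fun t => sin (y * t)).
  by apply: measurable_funTS; exact: measurable_sinM.
apply: eq_integrableR (integrable_bddMl mD mc (fun t _ => sin_max (y * t))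
  (Lg x x0)) => // t _; rewrite /lapsin; ring.
Qed.

Let exp_gap x h t : `|h| <= x / 2 -> t <= 0 ->
  expR (x * t) * expR `|h * t| <= expR (x / 2 * t).
Proof.
move=> hx t0; rewrite -expRD ler_expR normrM (ler0_norm t0).
have : (x / 2 - `|h|) * - t >= 0 by rewrite mulr_ge0 ?subr_ge0 ?oppr_ge0.
lra.
Qed.

(** The addition formulas factor the increment as the kernel at [x + i y] times
    the remainder of [e^((h + i k) t)], and [e^(|h t|)] costs at most half of
    the exponential. *)
Lemma lapcos_expansion x y h k t : `|h| <= x / 2 -> t <= 0 ->
  `|lapcos (x + h) (y + k) t - lapcos x y t -
    (h * (lapcos x y t * t) - k * (lapsin x y t * t))| <=
  3 * (h ^+ 2 + k ^+ 2) * (expR (x / 2 * t) * t ^+ 2).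
Proof.
move=> hx t0; rewrite (_ : _ - _ = expR (x * t) *
  (cos (y * t) * (expR (h * t) * cos (k * t) - 1 - h * t) -
   sin (y * t) * (expR (h * t) * sin (k * t) - k * t))); last first.
  by rewrite /lapcos /lapsin !mulrDl expRD cosD; ring.
have b1 := expR_cos_quad (h * t) (k * t); have b2 := expR_sin_quad (h * t) (k * t).
have c1 := cos_max (y * t); have s1 := sin_max (y * t).
rewrite normrM (ger0_norm (expR_ge0 _)).
apply: (@le_trans _ _ (expR (x * t) *
  (3 * ((h * t) ^+ 2 + (k * t) ^+ 2) * expR `|h * t|))).
  rewrite ler_wpM2l ?expR_ge0//; apply: le_trans (ler_normB _ _) _.
  rewrite (normrM (cos _)) (normrM (sin _)).
  have := ler_piMl (normr_ge0 (expR (h * t) * cos (k * t) - 1 - h * t)) c1.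
  have := ler_piMl (normr_ge0 (expR (h * t) * sin (k * t) - k * t)) s1.
  lra.
rewrite [leLHS](_ : _ = 3 * (h ^+ 2 + k ^+ 2) *
  ((expR (x * t) * expR `|h * t|) * t ^+ 2)); last by ring.
by rewrite ler_wpM2l ?mulr_ge0 ?addr_ge0 ?sqr_ge0// ler_wpM2r ?sqr_ge0// exp_gap.
Qed.

Lemma lapsin_expansion x y h k t : `|h| <= x / 2 -> t <= 0 ->
  `|lapsin (x + h) (y + k) t - lapsin x y t -
    (h * (lapsin x y t * t) + k * (lapcos x y t * t))| <=
  3 * (h ^+ 2 + k ^+ 2) * (expR (x / 2 * t) * t ^+ 2).
Proof.
move=> hx t0; rewrite (_ : _ - _ = expR (x * t) *
  (sin (y * t) * (expR (h * t) * cos (k * t) - 1 - h * t) +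
   cos (y * t) * (expR (h * t) * sin (k * t) - k * t))); last first.
  by rewrite /lapcos /lapsin !mulrDl expRD sinD; ring.
have b1 := expR_cos_quad (h * t) (k * t); have b2 := expR_sin_quad (h * t) (k * t).
have c1 := cos_max (y * t); have s1 := sin_max (y * t).
rewrite normrM (ger0_norm (expR_ge0 _)).
apply: (@le_trans _ _ (expR (x * t) *
  (3 * ((h * t) ^+ 2 + (k * t) ^+ 2) * expR `|h * t|))).
  rewrite ler_wpM2l ?expR_ge0//; apply: le_trans (ler_normD _ _) _.
  rewrite (normrM (cos _)) (normrM (sin _)).
  have := ler_piMl (normr_ge0 (expR (h * t) * cos (k * t) - 1 - h * t)) s1.
  have := ler_piMl (normr_ge0 (expR (h * t) * sin (k * t) - k * t)) c1.
  lra.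
rewrite [leLHS](_ : _ = 3 * (h ^+ 2 + k ^+ 2) *
  ((expR (x * t) * expR `|h * t|) * t ^+ 2)); last by ring.
by rewrite ler_wpM2l ?mulr_ge0 ?addr_ge0 ?sqr_ge0// ler_wpM2r ?sqr_ge0// exp_gap.
Qed.

(** Integration of the two pointwise expansions: the remainder is integrable
    because [t^2 g t] is again integrable against [e^(x t / 2)]. *)
Lemma laplace_expansion g x y : laplaceable g -> 0 < x ->
  exists2 M : R, 0 <= M & forall h k, `|h| <= x / 2 -> `|h| < x ->
  `|\int[mu]_(t in D) (lapcos (x + h) (y + k) t * g t) -
    \int[mu]_(t in D) (lapcos x y t * g t) -
    (h * (\int[mu]_(t in D) (lapcos x y t * (t * g t))) -
     k * (\int[mu]_(t in D) (lapsin x y t * (t * g t))))| <= M * (h ^+ 2 + k ^+ 2) /\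
  `|\int[mu]_(t in D) (lapsin (x + h) (y + k) t * g t) -
    \int[mu]_(t in D) (lapsin x y t * g t) -
    (h * (\int[mu]_(t in D) (lapsin x y t * (t * g t))) +
     k * (\int[mu]_(t in D) (lapcos x y t * (t * g t))))| <= M * (h ^+ 2 + k ^+ 2).
Proof.
move=> Lg x0; have Ltg := laplaceable_mul Lg; have Lttg := laplaceable_mul Ltg.
have x20 : 0 < x / 2 by rewrite divr_gt0.
pose m t : R := `|expR (x / 2 * t) * (t * (t * g t))|.
have im : mu.-integrable D (EFin \o m) by exact: integrable_norm (Lttg _ x20).
have [M M0 bound] : exists2 M : R, 0 <= M & forall (e : R -> R) (c : R), 0 <= c ->
    mu.-integrable D (EFin \o (fun t => e t * g t)) ->
    (forall t, t <= 0 -> `|e t| <= 3 * c * (expR (x / 2 * t) * t ^+ 2)) ->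
    `|\int[mu]_(t in D) (e t * g t)| <= M * c.
  exists (3 * \int[mu]_(t in D) m t) => [|e c c0 ie eb].
    by rewrite mulr_ge0//; apply: Rintegral_ge0 => t _; exact: normr_ge0.
  apply: (le_trans (le_normr_Rintegral _ ie)); first exact: mD.
  rewrite mulrAC -RintegralZl//; apply: le_Rintegral => //.
  - exact: integrable_norm.
  - exact: integrableRZ.
  - move=> t t0; rewrite normrM /m !normrM (ger0_norm (expR_ge0 _)).
    apply: le_trans (ler_wpM2r (normr_ge0 (g t)) (eb t t0)) _.
    by rewrite -(real_normK (num_real t)) le_eqVlt; apply/orP; left; apply/eqP; ring.
exists M => // h k hx hx'.
have xh0 : 0 < x + h by move: hx'; rewrite ltr_norml => /andP[]; lra.
have hk0 : 0 <= h ^+ 2 + k ^+ 2 by rewrite addr_ge0// sqr_ge0.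
have ic1 := integrable_lapcos (y + k) Lg xh0; have ic := integrable_lapcos y Lg x0.
have is1 := integrable_lapsin (y + k) Lg xh0; have is_ := integrable_lapsin y Lg x0.
have ict := integrableRZ h mD (integrable_lapcos y Ltg x0).
have ist := integrableRZ k mD (integrable_lapsin y Ltg x0).
have ict' := integrableRZ k mD (integrable_lapcos y Ltg x0).
have ist' := integrableRZ h mD (integrable_lapsin y Ltg x0).
split.
- rewrite -!RintegralZl//; try exact: integrable_lapcos; try exact: integrable_lapsin.
  rewrite -!RintegralB//; try exact: integrableRB.
  have E t : lapcos (x + h) (y + k) t * g t - lapcos x y t * g t -
      (h * (lapcos x y t * (t * g t)) - k * (lapsin x y t * (t * g t))) =
      (lapcos (x + h) (y + k) t - lapcos x y t -
       (h * (lapcos x y t * t) - k * (lapsin x y t * t))) * g t by ring.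
  under eq_Rintegral do rewrite E.
  apply: bound => //; last by move=> t t0; exact: lapcos_expansion.
  apply: (eq_integrableR mD (fun t _ => E t)).
  by apply: integrableRB => //; exact: integrableRB.
- rewrite -!RintegralZl//; try exact: integrable_lapcos; try exact: integrable_lapsin.
  rewrite -RintegralD// -!RintegralB//;
    try exact: integrableRB; try exact: integrableRD.
  have E t : lapsin (x + h) (y + k) t * g t - lapsin x y t * g t -
      (h * (lapsin x y t * (t * g t)) + k * (lapcos x y t * (t * g t))) =
      (lapsin (x + h) (y + k) t - lapsin x y t -
       (h * (lapsin x y t * t) + k * (lapcos x y t * t))) * g t by ring.
  under eq_Rintegral do rewrite E.
  apply: bound => //; last by move=> t t0; exact: lapsin_expansion.
  apply: (eq_integrableR mD (fun t _ => E t)).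
  by apply: integrableRB => //; [exact: integrableRB|exact: integrableRD].
Qed.

End laplace_expansion.

(** * Differentiability from quadratic remainders *)

Section quadratic_differentiability.
Context {R : realType}.

(** A remainder bounded by a multiple of the square of the increment identifies
    the differential. *)
Lemma differentiable_quadratic (V W : normedModType R) (f L : V -> W) (x : V)
    (C M d : R) :
  linear L -> (forall h, `|L h| <= C * `|h|) -> 0 < d ->
  (forall h, `|h| < d -> `|f (h + x) - f x - L h| <= M * `|h| ^+ 2) ->
  differentiable f x /\ 'd f x = L :> (V -> W).
Proof.
move=> linL bL d0 q.
pose isL := GRing.isLinear.Build _ _ _ _ L linL.
pose l : {linear V -> W} := HB.pack L isL.
have cl : continuous l.
  apply: bounded_linear_continuous; apply/linear_boundedP; exists C.
  split; first exact: num_real.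
  by move=> r Cr h; apply: le_trans (bL h) _; rewrite ler_wpM2r// ltW.
have o : f \o shift x = cst (f x) + l +o_0 id.
  apply/eqaddoP => e e0.
  pose d' := Num.min d (e / (`|M| + 1)).
  have d'0 : 0 < d' by rewrite lt_min d0 divr_gt0// ltr_wpDl.
  near=> h.
  have hd : `|h| < d' by near: h; exact: nbhs0_lt.
  have := hd; rewrite lt_min => /andP[h1 h2].
  rewrite !fctE [leLHS](_ : _ = `|f (h + x) - f x - L h|); last first.
    by rewrite /= opprD addrA.
  apply: (le_trans (q h h1)); rewrite expr2 mulrA ler_wpM2r//.
  move: h2; rewrite ltr_pdivlMr ?ltr_wpDl// => h2.
  apply: le_trans (ltW h2); rewrite mulrC ler_wpM2l//.
  by rewrite (le_trans (ler_norm M))// lerDl.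
have dE := diff_unique cl o.
split; last by rewrite dE.
apply/diff_locallyxP; rewrite dE; split=> // h.
by have := congr1 (fun F => F h) o; rewrite /= !fctE => ->.
Unshelve. all: by end_near.
Qed.

End quadratic_differentiability.

Section quaternion_calculus.
Context {R : realType}.
Implicit Types (q a b : quat R) (r c : R).

Lemma norm_quat_le q c : `|qre q| <= c -> `|qi q| <= c -> `|qj q| <= c ->
  `|qk q| <= c -> `|q| <= c.
Proof. by move=> h1 h2 h3 h4; rewrite !prod_normE !ge_max h1 h2 h3 h4. Qed.

Lemma norm_quat_comp q : [/\ `|qre q| <= `|q|, `|qi q| <= `|q|,
  `|qj q| <= `|q| & `|qk q| <= `|q|].
Proof. by rewrite !prod_normE !le_max !lexx !orbT. Qed.

Lemma norm_quat_le_qnorm q : `|q| <= qnorm q.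
Proof. by have [h1 h2 h3 h4] := norm_comp_le q; exact: norm_quat_le. Qed.

Lemma qnorm_le_norm_quat q : qnorm q <= 2 * `|q|.
Proof.
rewrite -(@ler_pXn2r _ 2) ?nnegrE ?qnorm_ge0 ?mulr_ge0// sqr_qnorm exprMn.
have sq r : `|r| <= `|q| -> r ^+ 2 <= `|q| ^+ 2.
  by move=> rq; rewrite -real_normK ?num_real// ler_pXn2r ?nnegrE.
have [/sq h1 /sq h2 /sq h3 /sq h4] := norm_quat_comp q; lra.
Qed.

Lemma norm_qmul a b : `|qmul a b| <= 4 * (`|a| * `|b|).
Proof.
have [a1 a2 a3 a4] := norm_quat_comp a; have [b1 b2 b3 b4] := norm_quat_comp b.
have pr r c : `|r| <= `|a| -> `|c| <= `|b| -> `|r * c| <= `|a| * `|b|.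
  by move=> ra cb; rewrite normrM ler_pM.
have sum4 (r1 r2 r3 r4 c : R) : `|r1| <= c -> `|r2| <= c -> `|r3| <= c ->
    `|r4| <= c -> [/\ `|r1 - r2 - r3 - r4| <= 4 * c, `|r1 + r2 + r3 - r4| <= 4 * c,
      `|r1 - r2 + r3 + r4| <= 4 * c & `|r1 + r2 - r3 + r4| <= 4 * c].
  rewrite !ler_norml => /andP[? ?] /andP[? ?] /andP[? ?] /andP[? ?].
  by split; apply/andP; split; lra.
apply: norm_quat_le; rewrite /qmul /=.
- by have [] := sum4 _ _ _ _ _ (pr _ _ a1 b1) (pr _ _ a2 b2) (pr _ _ a3 b3) (pr _ _ a4 b4).
- by have [] := sum4 _ _ _ _ _ (pr _ _ a1 b2) (pr _ _ a2 b1) (pr _ _ a3 b4) (pr _ _ a4 b3).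
- by have [] := sum4 _ _ _ _ _ (pr _ _ a1 b3) (pr _ _ a2 b4) (pr _ _ a3 b1) (pr _ _ a4 b2).
- by have [] := sum4 _ _ _ _ _ (pr _ _ a1 b4) (pr _ _ a2 b3) (pr _ _ a3 b2) (pr _ _ a4 b1).
Qed.

(** A bounded linear map is its own differential. *)
Lemma differentiable_bounded_linear (V W : normedModType R) (L : V -> W) (C : R)
    (x : V) : linear L -> (forall h, `|L h| <= C * `|h|) -> differentiable L x.
Proof.
move=> linL bL.
pose isL := GRing.isLinear.Build _ _ _ _ L linL.
pose l : {linear V -> W} := HB.pack L isL.
have [] // := @differentiable_quadratic _ _ _ L L x C 0 1 linL bL ltr01 => h _.
by rewrite mul0r normr_le0 subr_eq0 subr_eq -[L (h + x)]/(l (h + x)) linearD.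
Qed.

Section compositions.
Context {V : normedModType R}.
Implicit Types (f g : V -> quat R) (x : V).

Lemma differentiable_components f x : differentiable f x ->
  [/\ differentiable (fun z => qre (f z)) x, differentiable (fun z => qi (f z)) x,
      differentiable (fun z => qj (f z)) x & differentiable (fun z => qk (f z)) x].
Proof.
move=> df; split; apply: (differentiable_comp df);
  apply: (@differentiable_bounded_linear _ _ _ 1) => // h; rewrite mul1r;
  by have [] := norm_quat_comp h.
Qed.

Lemma differentiable_quat f x :
  differentiable (fun z => qre (f z)) x -> differentiable (fun z => qi (f z)) x ->
  differentiable (fun z => qj (f z)) x -> differentiable (fun z => qk (f z)) x ->
  differentiable f x.
Proof.
move=> h1 h2 h3 h4.
rewrite (_ : f = fun z => (qre (f z), qi (f z), qj (f z), qk (f z))); last first.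
  by apply/funext => z; case: (f z) => [[[? ?] ?] ?].
exact: (differentiable_pair (differentiable_pair (differentiable_pair h1 h2) h3) h4).
Qed.

Lemma differentiable_fctM (u v : V -> R) x : differentiable u x -> differentiable v x ->
  differentiable (fun z => u z * v z) x.
Proof. exact: differentiableM. Qed.
Lemma differentiable_fctD (u v : V -> R) x : differentiable u x -> differentiable v x ->
  differentiable (fun z => u z + v z) x.
Proof. exact: differentiableD. Qed.
Lemma differentiable_fctB (u v : V -> R) x : differentiable u x -> differentiable v x ->
  differentiable (fun z => u z - v z) x.
Proof. exact: differentiableB. Qed.

Lemma differentiable_qmul f g x : differentiable f x -> differentiable g x ->
  differentiable (fun z => qmul (f z) (g z)) x.
Proof.
move=> /differentiable_components[f1 f2 f3 f4].
move=> /differentiable_components[g1 g2 g3 g4].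
apply: differentiable_quat; rewrite /qmul.
- by apply: differentiable_fctB; [apply: differentiable_fctB; [apply: differentiable_fctB|]|]; exact: differentiable_fctM.
- by apply: differentiable_fctB; [apply: differentiable_fctD; [apply: differentiable_fctD|]|]; exact: differentiable_fctM.
- by apply: differentiable_fctD; [apply: differentiable_fctD; [apply: differentiable_fctB|]|]; exact: differentiable_fctM.
- by apply: differentiable_fctD; [apply: differentiable_fctB; [apply: differentiable_fctD|]|]; exact: differentiable_fctM.
Qed.

End compositions.

End quaternion_calculus.

Section quaternion_laplace.
Context {R : realType}.
Local Notation mu := (@lebesgue_measure R).
Implicit Types (G : R -> quat R) (x y h k : R).

Definition qlaplaceable G :=
  [/\ laplaceable (fun t => qre (G t)), laplaceable (fun t => qi (G t)),
      laplaceable (fun t => qj (G t)) & laplaceable (fun t => qk (G t))].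

Definition tmul G (t : R) := t *: G t.

Lemma lap_expansion G x y : qlaplaceable G -> 0 < x ->
  exists2 M : R, 0 <= M & forall h k, `|h| <= x / 2 ->
  `|lapC G (x + h) (y + k) - lapC G x y -
    (h *: lapC (tmul G) x y - k *: lapS (tmul G) x y)| <= M * (h ^+ 2 + k ^+ 2) /\
  `|lapS G (x + h) (y + k) - lapS G x y -
    (h *: lapS (tmul G) x y + k *: lapC (tmul G) x y)| <= M * (h ^+ 2 + k ^+ 2).
Proof.
move=> [L1 L2 L3 L4] x0.
have [M1 M10 b1] := laplace_expansion y L1 x0.
have [M2 M20 b2] := laplace_expansion y L2 x0.
have [M3 M30 b3] := laplace_expansion y L3 x0.
have [M4 M40 b4] := laplace_expansion y L4 x0.
have [l1 l2 l3 l4] : [/\ M1 <= M1 + M2 + M3 + M4, M2 <= M1 + M2 + M3 + M4,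
    M3 <= M1 + M2 + M3 + M4 & M4 <= M1 + M2 + M3 + M4].
  by clear -M10 M20 M30 M40; split; lra.
have c0 : 0 <= ftc :> R by rewrite invr_ge0 sqrtr_ge0.
exists (ftc * (M1 + M2 + M3 + M4)) => [|h k hx].
  by rewrite mulr_ge0// !addr_ge0.
have hx' : `|h| < x by apply: le_lt_trans hx _; lra.
have [c1 s1] := b1 h k hx hx'; have [c2 s2] := b2 h k hx hx'.
have [c3 s3] := b3 h k hx hx'; have [c4 s4] := b4 h k hx hx'.
have hk0 : 0 <= h ^+ 2 + k ^+ 2 by rewrite addr_ge0// sqr_ge0.
have key (a b c d M : R) : M <= M1 + M2 + M3 + M4 ->
    `|a - b - (h * c + k * d)| <= M * (h ^+ 2 + k ^+ 2) ->
    `|ftc * a - ftc * b - (h * (ftc * c) + k * (ftc * d))| <=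
      ftc * (M1 + M2 + M3 + M4) * (h ^+ 2 + k ^+ 2).
  move=> MM ab; rewrite [X in `|X|](_ : _ = ftc * (a - b - (h * c + k * d))).
    rewrite normrM ger0_norm// -mulrA ler_wpM2l//; apply: le_trans ab _.
    by rewrite ler_wpM2r.
  by ring.
have key' (a b c d M : R) : M <= M1 + M2 + M3 + M4 ->
    `|a - b - (h * c - k * d)| <= M * (h ^+ 2 + k ^+ 2) ->
    `|ftc * a - ftc * b - (h * (ftc * c) - k * (ftc * d))| <=
      ftc * (M1 + M2 + M3 + M4) * (h ^+ 2 + k ^+ 2).
  move=> MM; have := key a b c (- d) M MM.
  by rewrite (mulrN k d) (mulrN ftc d) (mulrN k).
split; apply: norm_quat_le.
- exact: key' l1 c1.
- exact: key' l2 c2.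
- exact: key' l3 c3.
- exact: key' l4 c4.
- exact: key l1 s1.
- exact: key l2 s2.
- exact: key l3 s3.
- exact: key l4 s4.
Qed.

Lemma lapCN G x y : lapC G x (- y) = lapC G x y.
Proof. by congr (_ *: _); apply: eq_qint => t _; rewrite mulNr cosN. Qed.

Lemma lapSN G x y : qlaplaceable G -> 0 < x -> lapS G x (- y) = - lapS G x y.
Proof.
move=> [L1 L2 L3 L4] x0.
have mD : measurable [set t : R | t <= 0] by rewrite -set_itvNyc.
rewrite /lapS -scalerN -[X in _ = _ *: X]scaleN1r -(qintZ (-1))//.
  congr (_ *: _); apply: eq_qint => t _.
  by rewrite mulNr sinN mulrN scaleN1r scaleNr.
by split; exact: integrable_lapsin.
Qed.

Lemma lapS0 G x : lapS G x 0 = 0.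
Proof.
rewrite /lapS qint_eq0 ?scaler0// => t _.
by rewrite mul0r sin0 mulr0 scale0r.
Qed.

End quaternion_laplace.

(** * The slice regular extension *)

Section slice_extension.
Context {R : realType}.
Implicit Types (G : R -> quat R) (x y h k : R) (q a b J : quat R).

Definition qim q : quat R := (0, qi q, qj q, qk q).
Definition rho q := qnorm (qim q).

(** If [rho q = 0], the factor [(rho q)^-1] is 0 and the second term vanishes, in
    accordance with [lapS0]. *)
Definition laplace_slice G q :=
  lapC G (qre q) (rho q) + qmul ((rho q)^-1 *: qim q) (lapS G (qre q) (rho q)).

Lemma qre_slice J x y : sphere J -> qre (slice J x y) = x.
Proof. by move=> /sphereP[J0 _]; rewrite /slice quatE qscaleE quatE J0 mulr0 addr0. Qed.

Lemma qim_slice J x y : sphere J -> qim (slice J x y) = y *: J.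
Proof.
move=> /sphereP[J0 _]; rewrite /slice qscaleE.
by apply: quatP; rewrite /qim ?quatE /qreal /= ?J0 ?mulr0 ?add0r.
Qed.

Lemma rho_slice J x y : sphere J -> rho (slice J x y) = `|y|.
Proof. by move=> SJ; rewrite /rho qim_slice// qnormZ qnorm_sphere// mulr1. Qed.

Lemma qim_rho0 q : rho q = 0 -> qim q = 0.
Proof.
move=> r0; apply/normr0_eq0/eqP; rewrite eq_le normr_ge0 andbT -r0.
exact: norm_quat_le_qnorm.
Qed.

Lemma HplusP q : Hplus q <-> 0 < qre q.
Proof.
split=> [[x [y [J [x0 SJ ->]]]]|q0]; first by rewrite qre_slice.
have [r0|r0] := eqVneq (rho q) 0.
  exists (qre q), 0, (0, 1, 0, 0); split=> //.
    apply/sphereP; rewrite /qre /qi /qj /qk /=; split=> //.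
    by rewrite expr1n expr0n !addr0.
  have := qim_rho0 r0; rewrite /qim => -[i0 j0 k0].
  rewrite /slice qscaleE scale0r addr0.
  exact: quatP.
exists (qre q), (rho q), ((rho q)^-1 *: qim q); split=> //.
  apply/sphereP; rewrite !quatE /= mulr0; split=> //.
  have := sqr_qnorm (qim q); rewrite -/(rho q).
  rewrite /qim /qre /qi /qj /qk /= expr0n add0r !exprMn -!mulrDr => <-.
  by rewrite -exprMn mulVf// expr1n.
rewrite /slice qscaleE scalerA mulfV// scale1r.
by apply: quatP; rewrite quatE /qreal /qim /qre /qi /qj /qk /= ?addr0 ?add0r.
Qed.

(** The sign of [y] is immaterial: [lapC] is even and [lapS] odd in [y]. *)
Lemma laplace_sliceE G J x y : qlaplaceable G -> 0 < x -> sphere J ->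
  laplace_slice G (slice J x y) = lapC G x y + qmul J (lapS G x y).
Proof.
move=> LG x0 SJ; rewrite /laplace_slice.
rewrite (qre_slice x y SJ) (qim_slice x y SJ) (rho_slice x y SJ).
have [y0|y0|->] := ltgtP y 0.
- have -> : `|y|^-1 *: (y *: J) = - J.
    by rewrite scalerA ltr0_norm// invrN mulNr mulVf ?lt_eqF// scaleN1r.
  by rewrite (ltr0_norm y0) lapCN (lapSN y LG x0) qmulNl qmulNr opprK.
- have -> : `|y|^-1 *: (y *: J) = J.
    by rewrite scalerA gtr0_norm// mulVf ?gt_eqF// scale1r.
  by rewrite (gtr0_norm y0).
- rewrite normr0 lapS0; congr (_ + _).
  by quat_ring.
Qed.

Lemma rho_le_norm q : rho q <= 2 * `|q|.
Proof.
apply: (le_trans (qnorm_le_norm_quat _)); rewrite ler_wpM2l//.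
by have [? ? ? ?] := norm_quat_comp q; apply: norm_quat_le => //; rewrite normr0.
Qed.

Lemma norm_qim_unit q : `|(rho q)^-1 *: qim q| <= 1.
Proof.
have [r0|r0] := eqVneq (rho q) 0.
  by rewrite r0 invr0 scale0r normr0.
rewrite normrZ normrV ?unitfE// ger0_norm ?qnorm_ge0//.
by rewrite ler_pdivrMl ?mulr1 ?norm_quat_le_qnorm// lt_neqAle eq_sym r0 qnorm_ge0.
Qed.

Lemma norm_quat_scaleD (r s : R) a b c : `|r| <= c -> `|s| <= c ->
  `|r *: a + s *: b| <= (`|a| + `|b|) * c.
Proof.
move=> rc sc; apply: le_trans (ler_normD _ _) _.
by rewrite !normrZ mulrDl lerD// mulrC ler_wpM2l.
Qed.

Lemma linear_pair a b : linear (fun z : R * R => z.1 *: a + z.2 *: b).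
Proof.
move=> r u v; rewrite -[(r *: u + v).1]/(r * u.1 + v.1).
by rewrite -[(r *: u + v).2]/(r * u.2 + v.2) !scalerDl scalerDr !scalerA addrACA.
Qed.

Lemma sqr_norm_pair_le (z : R * R) :
  z.1 ^+ 2 + z.2 ^+ 2 <= 2 * `|z| ^+ 2.
Proof.
have z12 : `|z.1| <= `|z| /\ `|z.2| <= `|z|.
  by rewrite !prod_normE !le_max !lexx !orbT.
have sq r : `|r| <= `|z| -> r ^+ 2 <= `|z| ^+ 2.
  by move=> rq; rewrite -real_normK ?num_real// ler_pXn2r ?nnegrE.
by case: z12 => /sq h1 /sq h2; lra.
Qed.

Lemma differentiable_lap G x y : qlaplaceable G -> 0 < x ->
  differentiable (fun z : R * R => lapC G z.1 z.2) (x, y) /\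
  differentiable (fun z : R * R => lapS G z.1 z.2) (x, y).
Proof.
move=> LG x0; have [M M0 b] := lap_expansion y LG x0.
set Ct := lapC (tmul G) x y in b; set St := lapS (tmul G) x y in b.
have bz (z : R * R) : `|z.1| <= `|z| /\ `|z.2| <= `|z|.
  by rewrite !prod_normE !le_max !lexx !orbT.
have x20 : 0 < x / 2 by rewrite divr_gt0.
split.
- pose L (z : R * R) := z.1 *: Ct + z.2 *: - St.
  refine (proj1 (@differentiable_quadratic _ _ _ _ L (x, y) (`|Ct| + `|- St|)
    (2 * M) (x / 2) _ _ x20 _)).
  + exact: linear_pair.
  + by move=> h; case: (bz h) => h1 h2; exact: norm_quat_scaleD.
  + move=> h hx; have [|bC _] := b h.1 h.2.
      by case: (bz h) => h1 _; apply: le_trans h1 (ltW hx).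
    rewrite /L scalerN /= [h.1 + x]addrC [h.2 + y]addrC; apply: le_trans bC _.
    by rewrite -mulrA mulrCA ler_wpM2l// sqr_norm_pair_le.
- pose L (z : R * R) := z.1 *: St + z.2 *: Ct.
  refine (proj1 (@differentiable_quadratic _ _ _ _ L (x, y) (`|St| + `|Ct|)
    (2 * M) (x / 2) _ _ x20 _)).
  + exact: linear_pair.
  + by move=> h; case: (bz h) => h1 h2; exact: norm_quat_scaleD.
  + move=> h hx; have [|_ bS] := b h.1 h.2.
      by case: (bz h) => h1 _; apply: le_trans h1 (ltW hx).
    rewrite /L /= [h.1 + x]addrC [h.2 + y]addrC; apply: le_trans bS _.
    by rewrite -mulrA mulrCA ler_wpM2l// sqr_norm_pair_le.
Qed.

Lemma differentiable_rho q : rho q != 0 -> differentiable rho q.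
Proof.
move=> r0; have [_ d1 d2 d3] := differentiable_components (@ex_diff _ _ _ _ _ _ _ (is_diff_id q)).
have dN : differentiable (fun a : quat R => qi a ^+ 2 + qj a ^+ 2 + qk a ^+ 2) q.
  rewrite (_ : (fun _ => _) = fun a => qi a * qi a + qj a * qj a + qk a * qk a)//.
  by apply: differentiable_fctD; [apply: differentiable_fctD|];
    exact: differentiable_fctM.
have E a : rho a = Num.sqrt (qi a ^+ 2 + qj a ^+ 2 + qk a ^+ 2).
  by rewrite /rho /qnorm /qim {1}/qre /= expr0n add0r.
rewrite (_ : rho = Num.sqrt \o
  (fun a : quat R => qi a ^+ 2 + qj a ^+ 2 + qk a ^+ 2)); last first.
  by apply/funext => a; exact: E.
apply: differentiable_comp => //; apply/derivable1_diffP.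
have n0 : 0 < qi q ^+ 2 + qj q ^+ 2 + qk q ^+ 2.
  by move: r0; rewrite E sqrtr_eq0 -ltNge.
by have [] := is_derive1_sqrt n0.
Qed.

Lemma differentiable_laplace_slice_nonreal G q : qlaplaceable G -> 0 < qre q ->
  rho q != 0 -> differentiable (laplace_slice G) q.
Proof.
move=> LG q0 r0.
have [d0 d1 d2 d3] := differentiable_components (@ex_diff _ _ _ _ _ _ _ (is_diff_id q)).
have dr := differentiable_rho r0.
have dp : differentiable (fun a => (qre a, rho a)) q by exact: differentiable_pair.
have [dC dS] := differentiable_lap (rho q) LG q0.
apply: differentiableD; first exact: differentiable_comp dp dC.
apply: differentiable_qmul; last exact: differentiable_comp dp dS.
have dV : differentiable (fun a => (rho a)^-1) q by exact: differentiableV.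
apply: differentiable_quat => /=.
- rewrite (_ : (fun _ => _) = cst 0)//; apply/funext => a.
  by rewrite quatE /qim/= mulr0.
- exact: (differentiable_fctM dV d1).
- exact: (differentiable_fctM dV d2).
- exact: (differentiable_fctM dV d3).
Qed.

Let remainder_regroup a b c d e : a + b - c - (d + e) = a - c - d + (b - e).
Proof. by apply: quatP; rewrite !quatE; ring. Qed.

Let remainder_regroup' a b c d e f :
  a + b - (c + d) - (e + f) = a - c - e + (b - d - f).
Proof. by apply: quatP; rewrite !quatE; ring. Qed.

(** At a real point the differential is left multiplication of the increment
    [h] into [Ct], the derivative of [lapC]: the term in [lapS] grows like
    [(rho h) Ct], which the unit [(rho h)^-1 Im h] turns into [(Im h) Ct]. *)
Lemma differentiable_laplace_slice_real G q : qlaplaceable G -> 0 < qre q ->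
  rho q = 0 -> differentiable (laplace_slice G) q.
Proof.
move=> LG q0 r0; have [M M0 b] := lap_expansion 0 LG q0.
have S0 := lapS0 (tmul G) (qre q); rewrite S0 lapS0 in b.
set Ct := lapC (tmul G) (qre q) 0 in b.
have qim0 := qim_rho0 r0.
have q20 : 0 < qre q / 2 by rewrite divr_gt0.
refine (proj1 (@differentiable_quadratic _ _ _ _ (fun h : quat R => qmul h Ct) q
  (4 * `|Ct|) (25 * M) (qre q / 2) _ _ q20 _)).
- by move=> r u v; rewrite qmulDl qmulZl.
- by move=> h; apply: le_trans (norm_qmul _ _) _; rewrite -mulrA [`|Ct| * _]mulrC.
move=> h hq; have [hre _ _ _] := norm_quat_comp h.
have [|bC bS] := b (qre h) (rho h); first exact: le_trans hre (ltW hq).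
have qimD : qim (h + q) = qim h.
  by move: qim0; rewrite /qim => -[i0 j0 k0]; rewrite !quatE i0 j0 k0 !addr0.
have rhoD : rho (h + q) = rho h by rewrite /rho qimD.
have hE : h = qre h *: qreal 1 + rho h *: ((rho h)^-1 *: qim h).
  have [z0|z0] := eqVneq (rho h) 0.
    rewrite z0 scale0r addr0; move: (qim_rho0 z0); rewrite /qim => -[i0 j0 k0].
    by apply: quatP; rewrite quatE /qreal/= ?mulr1 ?mulr0.
  rewrite scalerA mulfV// scale1r.
  by apply: quatP; rewrite !quatE /qreal /qim/= ?mulr1 ?mulr0 ?addr0 ?add0r.
(* The constant is 25 = 5 + 4 * 5: rho h <= 2 |h| accounts for the two factors
   5 and the bound of qmul for the factor 4. *)
rewrite /laplace_slice qimD rhoD r0 lapS0 quatE [qre h + _]addrC.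
have := norm_qim_unit h; move: ((rho h)^-1 *: qim h) hE => K hE K1.
have -> : qmul h Ct = qre h *: Ct + rho h *: qmul K Ct.
  by rewrite {1}hE qmulDl !qmulZl qmul1.
move: bC bS; rewrite [0 + rho h]add0r !scaler0 !subr0 [0 + _ *: _]add0r.
set C1 := lapC G _ (rho h); set C0 := lapC G _ 0; set S1 := lapS G _ _ => bC bS.
rewrite [X in `|X|](_ : _ = (C1 - C0 - qre h *: Ct) +
  qmul K (S1 - rho h *: Ct)); last first.
  rewrite qmulBr qmulZr (_ : qmul _ 0 = 0); last by quat_ring.
  by rewrite addr0; exact: remainder_regroup.
have hk : qre h ^+ 2 + rho h ^+ 2 <= 5 * `|h| ^+ 2.
  have h1 : qre h ^+ 2 <= `|h| ^+ 2.
    by rewrite -real_normK ?num_real// ler_pXn2r ?nnegrE.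
  have h2 : rho h ^+ 2 <= (2 * `|h|) ^+ 2.
    by rewrite ler_pXn2r ?nnegrE ?qnorm_ge0 ?mulr_ge0//; exact: rho_le_norm.
  by move: h1 h2; rewrite exprMn; move: (qre h ^+ 2) (rho h ^+ 2) (`|h| ^+ 2);
    clear; move=> *; lra.
have hM : M * (qre h ^+ 2 + rho h ^+ 2) <= M * (5 * `|h| ^+ 2) by rewrite ler_wpM2l.
apply: le_trans (ler_normD _ _) _.
have := norm_qmul K (S1 - rho h *: Ct).
have := ler_wpM2r (normr_ge0 (S1 - rho h *: Ct)) K1.
move: hM bC bS; rewrite mulrCA -[25 * M * _]mulrA.
move: (M * _) (M * _) (`|qmul _ _|) (`|_ - _ - _|) (`|S1 - _|) (`|K| * _).
by clear; move=> *; lra.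
Qed.

(** On the slice of [J] the partial derivatives are [Ct + J St] and
    [- St + J Ct], and [J J = - 1]. *)
Lemma laplace_slice_regular G : qlaplaceable G ->
  slice_regular Hplus (laplace_slice G).
Proof.
move=> LG; split=> [q /HplusP q0|J x y SJ /HplusP].
  have [r0|r0] := eqVneq (rho q) 0.
    exact: differentiable_laplace_slice_real.
  exact: differentiable_laplace_slice_nonreal.
rewrite (qre_slice x y SJ) => x0.
have [M M0 b] := lap_expansion y LG x0.
set Ct := lapC (tmul G) x y in b; set St := lapS (tmul G) x y in b.
have x20 : 0 < x / 2 by rewrite divr_gt0.
have J1 : `|J| <= 1 by rewrite -(qnorm_sphere SJ) norm_quat_le_qnorm.
have combine (u v : quat R) (m : R) : `|u| <= m -> `|v| <= m ->
    `|u + qmul J v| <= 5 * m.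
  move=> um vm; apply: le_trans (ler_normD _ _) _.
  have := norm_qmul J v; have := ler_wpM2r (normr_ge0 v) J1; lra.
have lin (a : quat R) : linear (fun h : R => h *: a).
  by move=> r u v; rewrite scalerDl scalerA.
have bnd (a : quat R) (h : R) : `|h *: a| <= `|a| * `|h|.
  by rewrite normrZ mulrC.
have bnd_x h : `|h| < x / 2 -> `|laplace_slice G (slice J (h + x) y) -
    laplace_slice G (slice J x y) - h *: (Ct + qmul J St)| <= 5 * M * `|h| ^+ 2.
  move=> hx; have xh0 : 0 < h + x.
    by move: hx; rewrite ltr_norml => /andP[]; clear -x0; lra.
  have [|bC bS] := b h 0; first exact: ltW.
  rewrite (laplace_sliceE _ LG xh0 SJ) (laplace_sliceE _ LG x0 SJ).
  move: bC bS; rewrite expr0n !addr0 !scale0r subr0 addr0 [x + h]addrC => bC bS.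
  rewrite -mulrA real_normK ?num_real//; have := combine _ _ _ bC bS.
  by rewrite !qmulBr qmulZr scalerDr -remainder_regroup'.
have bnd_y h : `|h| < x / 2 -> `|laplace_slice G (slice J x (h + y)) -
    laplace_slice G (slice J x y) - h *: (- St + qmul J Ct)| <= 5 * M * `|h| ^+ 2.
  move=> hx; have [|bC bS] := b 0 h; first by rewrite normr0 ltW.
  rewrite !(laplace_sliceE _ LG x0 SJ); move: bC bS.
  rewrite expr0n add0r !scale0r sub0r add0r addr0 [y + h]addrC -[- (h *: St)]scalerN => bC bS.
  rewrite -mulrA real_normK ?num_real//; have := combine _ _ _ bC bS.
  by rewrite !qmulBr qmulZr scalerDr -remainder_regroup'.
have [dx ex] := @differentiable_quadratic _ _ _
  (fun u : R => laplace_slice G (slice J u y)) _ _ _ _ _ (lin _) (bnd _) x20 bnd_x.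
have [dy ey] := @differentiable_quadratic _ _ _
  (fun v : R => laplace_slice G (slice J x v)) _ _ _ _ _ (lin _) (bnd _) x20 bnd_y.
have e1 := etrans (derive1E' dx) (congr1 (fun L => L 1) ex).
have e2 := etrans (derive1E' dy) (congr1 (fun L => L 1) ey).
transitivity (qscale 2^-1 (Ct + qmul J St + qmul J (- St + qmul J Ct))).
  congr (qscale _ (_ + qmul _ _)); first exact: etrans e1 (scale1r _).
  exact: etrans e2 (scale1r _).
rewrite qmulDr (qmul_sphere _ SJ) qmulNr qscaleE.
by rewrite addrA addrK subrr scaler0.
Qed.

End slice_extension.

(** * Lebesgue points *)

Section lebesgue_points.
Context {R : realType}.
Local Notation mu := (@lebesgue_measure R).
Implicit Types (F : R -> quat R) (J : quat R) (a x y : R).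

Lemma locally_integrable_cutoff (h : R -> R) : measurable_fun setT h ->
  (forall n, mu.-integrable setT (EFin \o (fun s => cutoff n s * h s))) ->
  locally_integrable setT h.
Proof.
move=> mh ih; split=> //; first exact: openT.
move=> K _ cK; have [M [Mreal bM]] := compact_bounded cK.
have mK : measurable K.
  by apply: closed_measurable; apply: compact_closed cK; exact: norm_hausdorff.
pose n := Num.truncn (`|M| + 1).
have Kn s : K s -> cutoff n.+1 s = 1.
  move=> Ks; rewrite /cutoff indicE mem_set//= in_itv/= -ler_norml.
  have M1 : M < `|M| + 1 by rewrite (le_lt_trans (ler_norm M))// ltrDl.
  apply: le_trans (bM _ M1 s Ks) _; apply: ltW.
  exact: truncnS_gt.
have /integrableP[_ fin] : mu.-integrable K
    (EFin \o (fun s => cutoff n.+1 s * h s)).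
  by apply: integrableS (ih n.+1).
apply: le_lt_trans fin; rewrite le_eqVlt; apply/orP; left; apply/eqP.
by apply: eq_integral => s; rewrite inE /= => Ks; rewrite Kn// mul1r.
Qed.

Definition qlebesgue_pt F y :=
  [/\ lebesgue_pt (fun s => qre (F s)) y, lebesgue_pt (fun s => qi (F s)) y,
      lebesgue_pt (fun s => qj (F s)) y & lebesgue_pt (fun s => qk (F s)) y].

Lemma qlebesgue_ae (p : R) F : 1 <= p -> qLp p%:E F ->
  {ae mu, forall y, qlebesgue_pt F y}.
Proof.
move=> p1 Fp; have [[m1 m2 m3 m4] _] := Fp.
have i n := (qLp1_qintegrable _).1 (truncate_L1 p1 Fp n).
have l1 : locally_integrable setT (fun s => qre (F s)).
  by apply: locally_integrable_cutoff => // n; case: (i n).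
have l2 : locally_integrable setT (fun s => qi (F s)).
  by apply: locally_integrable_cutoff => // n; case: (i n).
have l3 : locally_integrable setT (fun s => qj (F s)).
  by apply: locally_integrable_cutoff => // n; case: (i n).
have l4 : locally_integrable setT (fun s => qk (F s)).
  by apply: locally_integrable_cutoff => // n; case: (i n).
have a12 := @filterI _ _ (ae_filter_ringOfSetsType mu) _ _
  (lebesgue_differentiation l1) (lebesgue_differentiation l2).
have a34 := @filterI _ _ (ae_filter_ringOfSetsType mu) _ _
  (lebesgue_differentiation l3) (lebesgue_differentiation l4).
have a1234 := @filterI _ _ (ae_filter_ringOfSetsType mu) _ _ a12 a34.
by move: a1234; apply: (@filterS _ _ (ae_filter_ringOfSetsType mu)) =>
  y [[h1 h2] [h3 h4]].
Qed.

Lemma poissonQ_cvg (p : R) F y0 a (T : Type) (Fl : set_system T) (FF : Filter Fl)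
    (X Y : T -> R) : 1 <= p -> qLp p%:E F -> qlebesgue_pt F y0 ->
  X q @[q --> Fl] --> 0 -> (\forall q \near Fl, 0 < X q) ->
  (\forall q \near Fl, `|Y q - y0| <= a * X q) ->
  poissonQ F (X q) (Y q) @[q --> Fl] --> F y0.
Proof.
move=> p1 Fp [L1 L2 L3 L4] X0 Xpos cone.
have [[m1 m2 m3 m4] _] := Fp.
have pi2 : 0 < 2 * pi :> R by rewrite mulr_gt0// pi_gt0.
have key (h : R -> R) : measurable_fun setT h -> lebesgue_pt h y0 ->
    (forall x y, 0 < x ->
      mu.-integrable setT (EFin \o (fun s => poisker x (y - s) * h s))) ->
    (2 * pi)^-1 * \int[mu]_s (poisker (X q) (Y q - s) * h s) @[q --> Fl] --> h y0.
  move=> mh hl ih; apply/cvgrPdist_le => e e0.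
  have e1 : 0 < e * (2 * pi) by rewrite mulr_gt0.
  have [d d0 bd] := poisson_nontangential a mh ih hl e1.
  have Xd : \forall q \near Fl, `|X q| < d.
    have /cvgrPdist_lt/(_ _ d0) := X0.
    by apply: filterS => q; rewrite sub0r normrN.
  near=> q.
  have xq : 0 < X q by near: q.
  have xd : X q < d by rewrite -(gtr0_norm xq); near: q.
  have cq : `|Y q - y0| <= a * X q by near: q.
  have b := bd _ _ xq xd cq.
  rewrite -[h y0](mulKf (lt0r_neq0 pi2)) -mulrBr normrM gtr0_norm ?invr_gt0//.
  by rewrite ler_pdivrMl// distrC [2 * pi * e]mulrC.
have i x y (x0 : 0 < x) := qintegrable_poisker p1 Fp y x0.
apply/cvg_quatP; split; apply: key => // x y x0; by case: (i x y x0).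
Unshelve. all: by end_near. Qed.

End lebesgue_points.

(** * Boundary values *)

Section boundary_values.
Context {R : realType}.
Local Notation mu := (@lebesgue_measure R).
Implicit Types (F G : R -> quat R) (I J q a b : quat R) (x y : R).

Definition evenpart F y := 2^-1 *: (F y + F (- y)).
Definition oddpart F y := 2^-1 *: (F y - F (- y)).

(** The values on [J R] forced by the values [F] on [I R]: [F = Fe + I (- I Fo)],
    and a slice function keeps its two coefficients from one slice to
    another. *)
Definition twist I J F y := evenpart F y - qmul J (qmul I (oddpart F y)).

Lemma twist_id I F y : sphere I -> twist I I F y = F y.
Proof.
move=> SI; rewrite /twist (qmul_sphere _ SI) opprK /evenpart /oddpart.
by apply: quatP; rewrite !quatE; field.
Qed.

Lemma qmeasurable_twist I J F : qmeasurable F -> qmeasurable (twist I J F).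
Proof.
move=> mF; have mFN : qmeasurable (fun y => F (- y)).
  have mN : measurable_fun setT (fun y : R => - y).
    by apply: eq_measurable_fun (measurable_reflect 0) => y _; rewrite sub0r.
  by case: mF => m1 m2 m3 m4; split; [exact: (measurableT_comp m1 mN)|
    exact: (measurableT_comp m2 mN)|exact: (measurableT_comp m3 mN)|
    exact: (measurableT_comp m4 mN)].
have m2 : measurable_fun setT (fun _ : R => 2^-1 : R) by exact: measurable_cst.
apply: qmeasurableB; first exact: qmeasurable_scale m2 (qmeasurableD mF mFN).
apply: qmeasurable_qmul; apply: qmeasurable_qmul.
exact: qmeasurable_scale m2 (qmeasurableB mF mFN).
Qed.

Lemma cvg_qscale (T : Type) (Fl : set_system T) (FF : Filter Fl) (k : T -> R)
    (f : T -> quat R) (c : R) (l : quat R) : k q @[q --> Fl] --> c -> f q @[q --> Fl] --> l ->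
  k q *: f q @[q --> Fl] --> c *: l.
Proof.
move=> kc /cvg_quatP[f1 f2 f3 f4].
by apply/cvg_quatP; split; apply: cvgM.
Qed.

Lemma slice0 J y : slice J 0 y = y *: J.
Proof. by rewrite /slice qscaleE -[RHS]add0r. Qed.

(** Triangle inequality for the distance to a point of the line J R. *)
Lemma rho_dist J q y : sphere J -> `|rho q - `|y| | <= qnorm (q - slice J 0 y).
Proof.
move=> /sphereP[J0 J1].
rewrite -(@ler_pXn2r _ 2) ?nnegrE ?qnorm_ge0// real_normK ?num_real//.
have rq : rho q ^+ 2 = qi q ^+ 2 + qj q ^+ 2 + qk q ^+ 2.
  by rewrite /rho sqr_qnorm /qim {1}/qre /= expr0n add0r.
have rq0 : 0 <= rho q by exact: qnorm_ge0.
pose s := qi q * qi J + qj q * qj J + qk q * qk J.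
have CS : `|s| <= rho q.
  rewrite -(@ler_pXn2r _ 2) ?nnegrE// real_normK ?num_real// -[rho q ^+ 2]mulr1.
  rewrite -J1 rq /s.
  have := sqr_ge0 (qi q * qj J - qj q * qi J).
  have := sqr_ge0 (qi q * qk J - qk q * qi J).
  have := sqr_ge0 (qj q * qk J - qk q * qj J).
  by clear; lra.
have ys : y * s <= `|y| * rho q.
  by apply: le_trans (ler_norm _) _; rewrite normrM ler_wpM2l.
rewrite slice0 sqr_qnorm !quatE J0 mulr0 subr0 sqrrB real_normK ?num_real// rq.
have -> : y ^+ 2 = y ^+ 2 * (qi J ^+ 2 + qj J ^+ 2 + qk J ^+ 2) by rewrite J1 mulr1.
by move: ys; rewrite /s; have := sqr_ge0 (qre q); clear; lra.
Qed.

(** The two coefficients express the change of imaginary unit through F and its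
    reflection instead of the even and odd parts. *)
Definition twistP I J := 2^-1 *: (qreal 1 - qmul J I).
Definition twistM I J := 2^-1 *: (qreal 1 + qmul J I).

Lemma half_double a : 2^-1 *: (a + a) = a.
Proof. by apply: quatP; rewrite !quatE; field. Qed.

Lemma twistPDM I J : twistP I J + twistM I J = qreal 1.
Proof.
by rewrite /twistP /twistM -scalerDr addrACA addNr addr0 half_double.
Qed.

Lemma twistPBM I J : twistP I J - twistM I J = - qmul J I.
Proof.
rewrite /twistP /twistM -scalerBr opprD addrACA subrr add0r -opprD scalerN.
by rewrite half_double.
Qed.

Lemma twistE I J F y :
  twist I J F y = qmul (twistP I J) (F y) + qmul (twistM I J) (F (- y)).
Proof.
rewrite /twist /evenpart /oddpart /twistP /twistM; move: (F y) (F (- y)) => a b.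
by rewrite !qmulZl !qmulZr qmulBr qmulDl qmulDl qmulBr qmulNl !qmul1 -!qmulA;
  apply: quatP; rewrite !quatE; ring.
Qed.

Lemma qnorm_twist I J F y : sphere I -> sphere J ->
  qnorm (twist I J F y) <= 4 * (qnorm (F y) + qnorm (F (- y))).
Proof.
move=> SI SJ.
have n1 : qnorm (qreal 1 : quat R) = 1.
  by rewrite /qnorm /qre /qi /qj /qk /= expr1n expr0n !addr0 sqrtr1.
have n2 a : qnorm a <= 1 -> qnorm (2^-1 *: (qreal 1 + a)) <= 2.
  move=> a1; rewrite qnormZ ger0_norm//.
  by have := qnormD_le (qreal 1) a; rewrite n1; lra.
have nJI : qnorm (qmul J I) = 1 by rewrite qnormM !qnorm_sphere// mulr1.
have P2 : qnorm (twistP I J) <= 2.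
  by apply: n2; rewrite -scaleN1r qnormZ normrN normr1 mul1r nJI.
have M2 : qnorm (twistM I J) <= 2 by apply: n2; rewrite nJI.
rewrite twistE; apply: le_trans (qnormD_le _ _) _; rewrite !qnormM.
have := ler_wpM2r (qnorm_ge0 (F y)) P2.
have := ler_wpM2r (qnorm_ge0 (F (- y))) M2.
lra.
Qed.

(** The twist fixes the even part and multiplies the odd part by [- J I]. *)
Lemma twistK I J F y : sphere I -> sphere J -> twist J I (twist I J F) y = F y.
Proof.
move=> SI SJ.
have oN : oddpart F (- y) = - oddpart F y.
  by rewrite /oddpart opprK -opprB scalerN.
have eN : evenpart F (- y) = evenpart F y by rewrite /evenpart opprK addrC.
have e : evenpart (twist I J F) y = evenpart F y.
  rewrite {1}/evenpart /twist eN oN !qmulNr opprK.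
  by rewrite addrACA addNr addr0 half_double.
have o : oddpart (twist I J F) y = - qmul J (qmul I (oddpart F y)).
  rewrite {1}/oddpart /twist eN oN !qmulNr opprK opprD addrACA subrr add0r.
  by rewrite -opprD scalerN half_double.
rewrite {1}/twist e o !qmulNr (qmul_sphere _ SJ) qmulNr (qmul_sphere _ SI) !opprK.
rewrite /evenpart /oddpart; move: (F y) (F (- y)) => a b.
by apply: quatP; rewrite !quatE; field.
Qed.

Lemma powRD_le (p a b : R) : 0 <= p -> 0 <= a -> 0 <= b ->
  (4 * (a + b)) `^ p <= 8 `^ p * (a `^ p + b `^ p).
Proof.
move=> p0 a0 b0; wlog ab : a b a0 b0 / a <= b => [wl|].
  have [/wl|/ltW/wl] := leP a b; first exact.
  by rewrite [b + a]addrC [b `^ p + _]addrC; apply.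
apply: (@le_trans _ _ ((8 * b) `^ p)).
  by rewrite ge0_ler_powR ?nnegrE ?mulr_ge0 ?addr_ge0//; lra.
by rewrite powRM// ler_wpM2l ?powR_ge0// lerDr powR_ge0.
Qed.

(** The reflected term has the same integral as the other one. *)
Lemma integral_powR_twist (p : R) I J F : 0 < p -> sphere I -> sphere J ->
  qmeasurable F ->
  (\int[mu]_y (qnorm (twist I J F y) `^ p)%:E <=
   (2 * 8 `^ p)%:E * \int[mu]_y (qnorm (F y) `^ p)%:E)%E.
Proof.
move=> p0 SI SJ mF.
pose h y : \bar R := (qnorm (F y) `^ p)%:E.
have h0 y : (0 <= h y)%E by rewrite lee_fin powR_ge0.
have mh : measurable_fun setT h.
  apply/measurable_EFinP; apply: (measurableT_comp (measurable_powR p)).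
  exact: qmeasurable_qnorm.
have mhN : measurable_fun setT (fun y => h (0 - y)).
  exact: (measurableT_comp mh (measurable_reflect 0)).
have mhD : measurable_fun setT (fun y => h y + h (0 - y)%R)%E.
  exact: emeasurable_funD.
have mT : measurable_fun setT (fun y => (qnorm (twist I J F y) `^ p)%:E).
  apply/measurable_EFinP; apply: (measurableT_comp (measurable_powR p)).
  exact: (qmeasurable_qnorm (qmeasurable_twist I J mF)).
apply: (@le_trans _ _ (\int[mu]_y ((8 `^ p)%:E * (h y + h (0 - y)%R)))%E).
  apply: ge0_le_integral => //.
  - by move=> y _; rewrite lee_fin powR_ge0.
  - exact: (measurable_funeM _ mhD).
  - move=> y _; rewrite /h sub0r -EFinD -EFinM lee_fin.
    apply: le_trans (powRD_le (ltW p0) (qnorm_ge0 _) (qnorm_ge0 _)).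
    apply: (ge0_ler_powR (ltW p0)); last exact: qnorm_twist.
    + by rewrite nnegrE qnorm_ge0.
    + by rewrite nnegrE mulr_ge0 ?addr_ge0 ?qnorm_ge0.
rewrite ge0_integralZl_EFin ?powR_ge0//.
  rewrite ge0_integralD// (ge0_integral_reflect 0 mh h0).
  by rewrite -[(_ + _)%E]mule2n -mule_natl muleA -EFinM mulrC.
by move=> y _; rewrite adde_ge0.
Qed.

Lemma qLp_twist (p : R) I J F : 0 < p -> sphere I -> sphere J ->
  qLp p%:E F -> qLp p%:E (twist I J F).
Proof.
move=> p0 SI SJ Fp; have [mF _] := Fp.
split; first exact: qmeasurable_twist.
rewrite qLnormE// poweR_lty//; apply: le_lt_trans (integral_powR_twist p0 SI SJ mF) _.
have /integrableP[_] := qLp_integrable p0 Fp.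
under eq_integral do rewrite /= ger0_norm ?powR_ge0//.
by move=> fin; rewrite lte_mul_pinfty// lee_fin mulr_ge0// powR_ge0.
Qed.

Lemma qLnorm_twist (p : R) I J F : 0 < p -> sphere I -> sphere J ->
  qmeasurable F ->
  (qLnorm p%:E (twist I J F) <= ((2 * 8 `^ p) `^ p^-1)%:E * qLnorm p%:E F)%E.
Proof.
move=> p0 SI SJ mF; rewrite !qLnormE//.
have i0 H : (0 <= \int[mu]_y (qnorm (H y) `^ p)%:E)%E.
  by apply: integral_ge0 => y _; rewrite lee_fin powR_ge0.
rewrite -poweR_EFin -poweRM ?lee_fin ?mulr_ge0 ?powR_ge0//.
apply: gt0_ler_poweR; rewrite ?invr_ge0 ?(ltW p0)//.
- by rewrite in_itv/= i0 leey.
- by rewrite in_itv/= leey andbT mule_ge0// lee_fin mulr_ge0// powR_ge0.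
- exact: integral_powR_twist.
Qed.

Lemma qint_reflect F : qmeasurable F -> qint setT (fun s => F (- s)) = qint setT F.
Proof.
move=> [m1 m2 m3 m4].
have key (h : R -> R) : measurable_fun setT h ->
    \int[mu]_s h (- s) = \int[mu]_s h s.
  move=> mh; rewrite -(Rintegral_reflect 0 mh).
  by apply: eq_Rintegral => s _; rewrite sub0r.
by apply: quatP; exact: key.
Qed.

Lemma qintegrable_reflect F : qintegrable setT F ->
  qintegrable setT (fun s => F (- s)).
Proof.
have key (h : R -> R) : mu.-integrable setT (EFin \o h) ->
    mu.-integrable setT (EFin \o (fun s => h (- s))).
  move=> /(integrable_reflect 0); apply: eq_integrableR => // s _.
  by rewrite sub0r.
by case=> i1 i2 i3 i4; split; [exact: key i1|exact: key i2|exact: key i3|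
  exact: key i4].
Qed.

Lemma qint_weight_twist (w : R -> R) I J F :
  qintegrable setT (fun s => w s *: F s) ->
  qintegrable setT (fun s => w s *: F (- s)) ->
  qint setT (fun s => w s *: twist I J F s) =
    qmul (twistP I J) (qint setT (fun s => w s *: F s)) +
    qmul (twistM I J) (qint setT (fun s => w s *: F (- s))).
Proof.
move=> i1 i2; rewrite -!qint_qmul// -qintD//; try exact: qintegrable_qmul.
by apply: eq_qint => s _; rewrite twistE scalerDr !qmulZr.
Qed.

(** Reflection fixes the cosine transform and changes the sign of the sine
    transform; the latter is thus multiplied by [- I J], and
    [- I (- I J) = - J]. *)
Lemma qFT1_twist I J F t : sphere I -> sphere J -> qintegrable setT F ->
  qFT1 I (twist J I F) t = qFT1 J F t.
Proof.
move=> SI SJ iF; have iFN := qintegrable_reflect iF.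
have iT : qintegrable setT (twist J I F).
  have := qintegrableD measurableT
    (qintegrable_qmul (twistP J I) measurableT iF)
    (qintegrable_qmul (twistM J I) measurableT iFN).
  by apply: eq_qintegrable => // s _; rewrite twistE.
rewrite !qFT1E// {1}/qcosT {1}/qsinT.
rewrite qint_weight_twist; [|exact: qintegrable_cos|exact: qintegrable_cos].
rewrite qint_weight_twist; [|exact: qintegrable_sin|exact: qintegrable_sin].
have -> : qint setT (fun s => cos (s * t) *: F (- s)) = qcosT F t.
  rewrite -[RHS]qint_reflect; last first.
    exact: qintegrable_qmeasurable (qintegrable_cos t iF).
  by apply: eq_qint => s _; rewrite mulNr cosN.
have -> : qint setT (fun s => sin (s * t) *: F (- s)) = - qsinT F t.
  rewrite -[qsinT F t]qint_reflect; last first.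
    exact: qintegrable_qmeasurable (qintegrable_sin t iF).
  rewrite -scaleN1r -qintZ//; last first.
    exact: qintegrable_reflect (qintegrable_sin t iF).
  by apply: eq_qint => s _; rewrite mulNr sinN scaleN1r scaleNr opprK.
rewrite -/(qcosT F t) -/(qsinT F t).
move: (qcosT F t) (qsinT F t) => C S; congr (_ *: (_ - _)).
  by rewrite -qmulDl twistPDM qmul1.
rewrite qmulNr -qmulNl -qmulDl twistPBM.
by rewrite qmulNl qmulNr -qmulA (qmul_sphere _ SI) opprK.
Qed.

Section half_line.
Variables (p : R) (I : quat R) (F G : R -> quat R).
Hypotheses (p1 : 1 <= p) (Fp : qLp p%:E F) (FG : is_qFT I p F G)
  (supp : esupp G `<=` [set t : R | t <= 0]).

Lemma qlaplaceable_spectrum : qlaplaceable G.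
Proof.
have mD : measurable [set t : R | t <= 0] by rewrite -set_itvNyc.
have key x (x0 : 0 < x) : qintegrable [set t : R | t <= 0] (fun t => expR (x * t) *: G t).
  have [iG _] := lapC_poisson p1 Fp FG supp 0 x0.
  by apply: (eq_qintegrable mD _ iG) => t _; rewrite mul0r cos0 mulr1.
by split=> x x0; case: (key x x0).
Qed.

Lemma laplace_slice_poisson q (s : R) : 0 < qre q -> `|s| = 1 ->
  laplace_slice G q =
    2^-1 *: (poissonQ F (qre q) (s * rho q) + poissonQ F (qre q) (- (s * rho q))) -
    qmul (s *: ((rho q)^-1 *: qim q)) (qmul I (2^-1 *:
      (poissonQ F (qre q) (s * rho q) - poissonQ F (qre q) (- (s * rho q))))).
Proof.
move=> q0 s1; rewrite /laplace_slice.
have [_ ->] := lapC_poisson p1 Fp FG supp (rho q) q0.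
have [_ ->] := lapS_poisson p1 Fp FG supp (rho q) q0.
move: ((rho q)^-1 *: qim q) => K.
have [s0|s0] := leP 0 s.
  have -> : s = 1 by rewrite -s1 ger0_norm.
  by rewrite mul1r scale1r qmulNr -qmulZr.
have -> : s = -1 by rewrite -[s]opprK -(ltr0_norm s0) s1.
rewrite mulN1r opprK scaleN1r.
move: (poissonQ F _ (rho q)) (poissonQ F _ (- rho q)) => A B.
by rewrite qmulNr qmulNl opprK -qmulZr [B + A]addrC -[B - A]opprB scalerN !qmulNr.
Qed.

(** With [s] the sign of [y], the pairs [(re q, s rho q)] and [(re q, - s rho q)]
    approach [y] and [- y] nontangentially as [q] tends to [y J] in the cone,
    while the unit [s (rho q)^-1 Im q] tends to [J]. *)
Lemma nt_lim_laplace_slice J y : sphere J -> y != 0 ->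
  qlebesgue_pt F y -> qlebesgue_pt F (- y) ->
  nt_lim (laplace_slice G) (slice J 0 y) (twist I J F y).
Proof.
move=> SJ y0 Ly LNy a a0.
set q0 := slice J 0 y; set Fl := within _ _.
have FF : Filter Fl by exact: within_filter.
pose s := Num.sg y.
have s1 : `|s| = 1 by rewrite normr_sg y0.
have idq : (fun q : quat R => q) q @[q --> Fl] --> q0.
  move=> A nA; exact: (@cvg_within _ _ (nbhs_filter q0) _ A nA).
have [re0 _ _ _] := (cvg_quatP _ _).1 idq.
have q0re : qre q0 = 0 by exact: qre_slice.
rewrite q0re in re0.
have cone : \forall q \near Fl, 0 < qre q /\ qnorm (q - q0) < a * qre q.
  by rewrite near_withinE; apply: nearW => q [/HplusP].
have pos : \forall q \near Fl, 0 < qre q by apply: filterS cone => q [].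
have sr : \forall q \near Fl, `|s * rho q - y| <= a * qre q.
  apply: filterS cone => q [q1 q2]; apply: le_trans (ltW q2).
  apply: le_trans (rho_dist q y SJ).
  rewrite {1}(numEsg y) -mulrBr normrM s1 mul1r//.
have srN : \forall q \near Fl, `|- (s * rho q) - - y| <= a * qre q.
  by apply: filterS sr => q; rewrite -opprD normrN.
have P1 := poissonQ_cvg FF p1 Fp Ly re0 pos sr.
have P2 := poissonQ_cvg FF p1 Fp LNy re0 pos srN.
have rho0 : rho q @[q --> Fl] --> `|y|.
  apply/cvgrPdist_le => e e0; have /cvgrPdist_le/(_ (e / a)) := re0.
  move=> /(_ (divr_gt0 e0 a0)) near_re; near=> q.
  have [q1 q2] : 0 < qre q /\ qnorm (q - q0) < a * qre q by near: q.
  rewrite distrC; apply: le_trans (rho_dist q y SJ) _.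
  apply: le_trans (ltW q2) _; rewrite mulrC -ler_pdivlMr//.
  rewrite -(gtr0_norm q1) -normrN -sub0r; near: q; exact: near_re.
have qim0 : qim q @[q --> Fl] --> y *: J.
  rewrite -(qim_slice 0 y SJ); have [_ i0 j0 k0] := (cvg_quatP _ _).1 idq.
  by apply/cvg_quatP; split; [exact: cvg_cst|exact: i0|exact: j0|exact: k0].
have K0 : s *: ((rho q)^-1 *: qim q) @[q --> Fl] --> J.
  have -> : J = s *: (`|y|^-1 *: (y *: J)).
    by rewrite !scalerA mulrAC -normrEsg mulfV ?normr_eq0// scale1r.
  apply: cvg_qZ; apply: cvg_qscale => //; apply: cvgV => //.
  by rewrite normr_eq0.
have lim : 2^-1 *: (poissonQ F (qre q) (s * rho q) +
      poissonQ F (qre q) (- (s * rho q))) -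
    qmul (s *: ((rho q)^-1 *: qim q)) (qmul I (2^-1 *:
      (poissonQ F (qre q) (s * rho q) - poissonQ F (qre q) (- (s * rho q)))))
    @[q --> Fl] --> twist I J F y.
  apply: cvg_qB; first by apply: cvg_qZ; exact: cvg_qD.
  apply: cvg_qmul => //; apply: cvg_qmul; first exact: cvg_cst.
  by apply: cvg_qZ; exact: cvg_qB.
apply: cvg_trans lim; apply: near_eq_cvg; apply: filterS pos => q qpos.
by rewrite (laplace_slice_poisson qpos s1).
Unshelve. all: by end_near. Qed.

Lemma boundary_value_laplace_slice J : sphere J ->
  boundary_value (laplace_slice G) J (twist I J F).
Proof.
move=> SJ; split; first by apply: qmeasurable_twist; case: Fp.
have ae0 : {ae mu, forall y : R, y != 0}.
  exists [set 0]; split; [exact: measurable_set1|exact: lebesgue_measure_set1|].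
  by move=> y /= /negP; rewrite negbK => /eqP.
have L := qlebesgue_ae p1 Fp.
have aeL := @filterI _ _ (ae_filter_ringOfSetsType mu) _ _ L (ae_reflect L).
move: (@filterI _ _ (ae_filter_ringOfSetsType mu) _ _ ae0 aeL).
apply: (@filterS _ _ (ae_filter_ringOfSetsType mu)) => y [y0 [Ly LNy]].
exact: nt_lim_laplace_slice.
Qed.

Hypothesis SI : sphere I.

Lemma hardy_laplace_slice : hardy p (laplace_slice G).
Proof.
have p0 : 0 < p by exact: lt_le_trans ltr01 p1.
split; first exact/laplace_slice_regular/qlaplaceable_spectrum.
exists (twist I ^~ F); split=> [J SJ|]; first exact: boundary_value_laplace_slice.
have [mF _] := Fp.
pose N : \bar R := (\int[mu]_y (qnorm (F y) `^ p)%:E)%E.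
have Noo : (N < +oo)%E.
  have /integrableP[_] := qLp_integrable p0 Fp.
  by under eq_integral do rewrite /= ger0_norm ?powR_ge0//.
apply: (@le_lt_trans _ _ ((2 * 8 `^ p)%:E * N)%E).
  by apply: ge_ereal_sup => _ [J SJ <-]; exact: integral_powR_twist.
by rewrite lte_mul_pinfty// lee_fin mulr_ge0// powR_ge0.
Qed.

(** A sequence that approximates the boundary value on [J R] becomes, by
    [twist J I], a sequence that approximates [F], with the same transforms. *)
Lemma essential_FT_laplace_slice : is_essential_FT p (laplace_slice G) G.
Proof.
have p0 : 0 < p by exact: lt_le_trans ltr01 p1.
move=> J SJ; exists (twist I J F); first exact: boundary_value_laplace_slice.
have [Gp FTG] := FG; split=> // H Hp Hlim.
have [mF _] := Fp.
have lim : qLnorm p%:E (fun x => twist J I (H n) x - F x) @[n --> \oo] --> 0%E.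
  have E n : (fun x => twist J I (H n) x - F x) =
      twist J I (fun x => H n x - twist I J F x).
    apply/funext => x; rewrite -[F x in LHS](twistK F x SI SJ) !twistE.
    by rewrite !qmulBr opprD addrACA.
  pose c : R := (2 * 8 `^ p) `^ p^-1.
  have cH0 : (c%:E * qLnorm p%:E (fun x => (H n x - twist I J F x)%R))%E
      @[n --> \oo] --> 0%E.
    by rewrite -(mule0 c%:E); exact: cvgeZl.
  apply: (squeeze_cvge _ (cvg_cst 0%E) cH0).
  apply: nearW => n; rewrite Lnorm_ge0/= E; apply: qLnorm_twist => //.
  have [_ [mH _]] := Hp n.
  by apply: qmeasurableB => //; exact: qmeasurable_twist.
have HT n : qLp 1%E (twist J I (H n)) /\ qLp p%:E (twist J I (H n)).
  by have [? ?] := Hp n; split; exact: qLp_twist.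
have := FTG _ HT lim; apply: cvg_trans; apply: near_eq_cvg; apply: nearW => n.
suff -> : qFT1 I (twist J I (H n)) = qFT1 J (H n) by [].
by apply/funext => t; apply: qFT1_twist => //; apply/qLp1_qintegrable; case: (Hp n).
Qed.

Lemma laplace_slice_formula x y J : 0 < x -> sphere J ->
  laplace_slice G (slice J x y) =
  qscale (Num.sqrt (2 * pi))^-1
    (qint [set t : R | t <= 0]
       (fun t => qmul (qexp J (x * t) (y * t)) (G t))).
Proof.
move=> x0 SJ; rewrite (laplace_sliceE y qlaplaceable_spectrum x0 SJ) qscaleE.
have [iC _] := lapC_poisson p1 Fp FG supp y x0.
have [iS _] := lapS_poisson p1 Fp FG supp y x0.
have mD : measurable [set t : R | t <= 0] by rewrite -set_itvNyc.
rewrite /lapC /lapS qmulZr -scalerDr; congr (_ *: _).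
rewrite -qint_qmul// -qintD//; last exact: qintegrable_qmul.
by apply: eq_qint => t _; rewrite qmul_qexp qmulZr.
Qed.

End half_line.

End boundary_values.

(** * The extension theorem *)

Theorem mainTheorem3 (R : realType) (p : R) (F : R -> quat R)
    (hp1 : 1 <= p) (hp2 : p <= 2) (hF : qLp p%:E F)
    (I : quat R) (hI : sphere I)
    (FhatI : R -> quat R) (hFhatI : is_qFT I p F FhatI)
    (hsupp : esupp FhatI `<=` [set t : R | t <= 0]) :
  exists f : quat R -> quat R,
    [/\ hardy p f,
        boundary_value f I F,
        is_essential_FT p f FhatI &
        forall (x y : R) (J : quat R), 0 < x -> sphere J ->
          f (slice J x y) =
          qscale (Num.sqrt (2 * pi))^-1
            (qint [set t : R | t <= 0]
               (fun t => qmul (qexp J (x * t) (y * t)) (FhatI t)))].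
Proof.
exists (laplace_slice FhatI); split.
- exact: hardy_laplace_slice hFhatI hsupp hI.
- have -> : F = twist I I F by apply/funext => y; rewrite twist_id.
  exact: boundary_value_laplace_slice hFhatI hsupp I hI.
- exact: essential_FT_laplace_slice hFhatI hsupp hI.
- by move=> x y J; exact: laplace_slice_formula hFhatI hsupp x y J.
Qed.
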